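(* Let $n\ge 1$, $1<p,q<\infty$, $m\in\mathbb{R}$ and $0<\delta<1$. If $m>-\left|\frac1q-\frac12\right|\delta n$, then there exists a symbol $\sigma\in S^m_{1,\delta}$ such that the pseudo-differential operator $\sigma(X,D)$ is not bounded on $M^{p,q}(\mathbb{R}^n)$, i.e. there is no constant $C$ with $\|\sigma(X,D)f\|_{M^{p,q}}\le C\|f\|_{M^{p,q}}$ for all $f\in\mathcal{S}(\mathbb{R}^n)$.
   Context: Fourier transform: $\widehat f(\xi)=\mathcal{F}f(\xi)=\int_{\mathbb{R}^n}e^{-i\xi\cdot x}f(x)\,dx$, $\mathcal{F}^{-1}f(x)=(2\pi)^{-n}\int e^{ix\cdot\xi}f(\xi)\,d\xi$. For $m\in\mathbb{R}$, $0\le\delta\le\rho\le1$, the class $S^m_{\rho,\delta}$ consists of all $\sigma\in C^\infty(\mathbb{R}^n\times\mathbb{R}^n)$ with $|\partial_\xi^\alpha\partial_x^\beta\sigma(x,\xi)|\le C_{\alpha,\beta}(1+|\xi|)^{m-\rho|\alpha|+\delta|\beta|}$ for all multi-indices $\alpha,\beta$. For such $\sigma$, $\sigma(X,D)f(x)=(2\pi)^{-n}\int e^{ix\cdot\xi}\sigma(x,\xi)\widehat f(\xi)\,d\xi$ for $f\in\mathcal{S}(\mathbb{R}^n)$. Modulation spaces: fix a window $\gamma\in\mathcal{S}(\mathbb{R}^n)\setminus\{0\}$; for $f\in\mathcal{S}'(\mathbb{R}^n)$ the short-time Fourier transform is $V_\gamma f(x,\xi)=(f,M_\xi T_x\gamma)$,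 i.e. formally $\int f(t)\overline{\gamma(t-x)}e^{-i\xi\cdot t}\,dt$, where $M_\xi\gamma(t)=e^{i\xi\cdot t}\gamma(t)$, $T_x\gamma(t)=\gamma(t-x)$. For $1\le p,q\le\infty$, $M^{p,q}(\mathbb{R}^n)$ is the set of $f\in\mathcal{S}'(\mathbb{R}^n)$ with $\|f\|_{M^{p,q}}=\left(\int\left(\int|V_\gamma f(x,\xi)|^p\,dx\right)^{q/p}d\xi\right)^{1/q}<\infty$ (different windows give equivalent norms). *)

(* Defs.v *)
From HB Require Import structures.
From mathcomp Require Import all_boot all_order all_algebra.
From mathcomp Require Import all_classical all_reals all_analysis.
From mathcomp Require Import complex.

Set Implicit Arguments.
Unset Strict Implicit.
Unset Printing Implicit Defensive.

Import Order.TTheory GRing.Theory Num.Theory.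
Import numFieldNormedType.Exports.

Local Open Scope ring_scope.

Section PDO.
Context {R : realType}.

Definition cre (z : R[i]) : R := @complex.Re R z.
Definition cim (z : R[i]) : R := @complex.Im R z.
Definition cexp (t : R) : R[i] := (cos t +i* sin t)%C.
Definition cmod (z : R[i]) : R := Num.sqrt (cre z ^+ 2 + cim z ^+ 2).
Definition cconj (z : R[i]) : R[i] := (cre z -i* cim z)%C.

Definition dotv k (x y : 'rV[R]_k) : R := \sum_(j < k) x 0 j * y 0 j.
Definition enorm k (x : 'rV[R]_k) : R := Num.sqrt (dotv x x).
Definition unitv k (i : 'I_k) : 'rV[R]_k := delta_mx 0 i.

Fixpoint pderiv k (s : seq 'I_k) (f : 'rV[R]_k -> R) : 'rV[R]_k -> R :=
  match s with
  | [::] => f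
  | i :: s' => fun x => 'D_(unitv i) (pderiv s' f) x
  end.

Definition smooth k (f : 'rV[R]_k -> R) : Prop :=
  forall s : seq 'I_k, continuous (pderiv s f) /\
    forall (i : 'I_k) (x : 'rV[R]_k), derivable (pderiv s f) x (unitv i).

Definition Csmooth k (f : 'rV[R]_k -> R[i]) : Prop :=
  smooth (fun x => cre (f x)) /\ smooth (fun x => cim (f x)).

Definition cpderiv k (s : seq 'I_k) (f : 'rV[R]_k -> R[i]) : 'rV[R]_k -> R[i] :=
  fun x => (pderiv s (fun y => cre (f y)) x +i* pderiv s (fun y => cim (f y)) x)%C.

Definition schwartz n (f : 'rV[R]_n -> R[i]) : Prop :=
  Csmooth f /\
  forall a b : seq 'I_n, exists M : R, forall x : 'rV[R]_n,
    `|\prod_(i <- a) x 0 i| * cmod (cpderiv b f x) <= M.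

Definition upd k (x : 'rV[R]_k) (i : 'I_k) (t : R) : 'rV[R]_k :=
  \row_j (if j == i then t else x 0 j).

Fixpoint iRint k (s : seq 'I_k) (F : 'rV[R]_k -> R) (x : 'rV[R]_k) : R :=
  match s with
  | [::] => F x
  | i :: s' => (\int[@lebesgue_measure R]_t iRint s' F (upd x i t))%R
  end.

Fixpoint iEint k (s : seq 'I_k) (F : 'rV[R]_k -> \bar R) (x : 'rV[R]_k) : \bar R :=
  match s with
  | [::] => F x
  | i :: s' => (\int[@lebesgue_measure R]_t iEint s' F (upd x i t))%E
  end.

Definition Rint n (F : 'rV[R]_n -> R) : R := iRint (enum 'I_n) F 0.
Definition Cint n (F : 'rV[R]_n -> R[i]) : R[i] :=
  (Rint (fun x => cre (F x)) +i* Rint (fun x => cim (F x)))%C.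
Definition Eint n (F : 'rV[R]_n -> \bar R) : \bar R := iEint (enum 'I_n) F 0.

Definition fourier n (f : 'rV[R]_n -> R[i]) (xi : 'rV[R]_n) : R[i] :=
  Cint (fun x => cexp (- dotv xi x) * f x).

Definition pdo n (sigma : 'rV[R]_n -> 'rV[R]_n -> R[i])
    (f : 'rV[R]_n -> R[i]) (x : 'rV[R]_n) : R[i] :=
  ((2 * pi) ^- n)%:C%C *
    Cint (fun xi => cexp (dotv x xi) * sigma x xi * fourier f xi).

Definition sym2 n (sigma : 'rV[R]_n -> 'rV[R]_n -> R[i]) : 'rV[R]_(n + n) -> R[i] :=
  fun z => sigma (lsubmx z) (rsubmx z).

(* a = multi-index alpha (derivatives in xi), b = multi-index beta (in x),
   as lists of coordinates; |alpha| = size a *)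
Definition symbol_class n (m rho delta : R) (sigma : 'rV[R]_n -> 'rV[R]_n -> R[i]) : Prop :=
  Csmooth (sym2 sigma) /\
  forall a b : seq 'I_n, exists Cst : R, forall x xi : 'rV[R]_n,
    cmod (cpderiv (map (@rshift n n) a ++ map (@lshift n n) b) (sym2 sigma)
                  (row_mx x xi))
    <= Cst * powR (1 + enorm xi) (m - rho * (size a)%:R + delta * (size b)%:R).

Definition stft n (gamma f : 'rV[R]_n -> R[i]) (x xi : 'rV[R]_n) : R[i] :=
  Cint (fun t => f t * cconj (gamma (t - x)) * cexp (- dotv xi t)).

Definition Mnorm n (p q : R) (gamma f : 'rV[R]_n -> R[i]) : \bar R :=
  poweR (Eint (fun xi =>
      poweR (Eint (fun x => (powR (cmod (stft gamma f x xi)) p)%:E)) (q / p)))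
    q^-1.

End PDO.

(* Main.v *)
(** For each dyadic scale 2^j the symbol is, near xi ~ (2^j, ..., 2^j), equal to
    2^(mj) a_j(x), where a_j is a tensor product of Rudin-Shapiro sums
    A_j(t) = N^(-1/2) sum_(k <= N) eps_k cos (k L t), N ~ 2^((delta-eps) j), L = 2^(eps j).
    The flatness |A_j| <= C puts the symbol in S^m_(1,delta), and on a Gaussian modulated
    to frequencies near (2^j, ..., 2^j) the operator is multiplication by 2^(mj) a_j up to
    a factor and an error O(2^(-jK)).  Multiplication by a_j splits one time-frequency
    packet into about N^n packets with coefficients of size N^(-n/2) at separated
    frequencies, so it multiplies the M^(p,q) norm by N^(n(1/q-1/2)); this is tested on a
    single packet when q <= 2.  When q >= 2 one tests on a_j times a packet: since a_j^2
    has mean 2^(-n), the operator collects the N^n packets back into one, gaining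
    N^(n(1/2-1/q)).  Boundedness would thus keep 2^(mj) N^(n|1/q-1/2|) bounded in j. *)
Require Import Defs.
From HB Require Import structures.
From mathcomp Require Import all_boot all_order all_algebra.
From mathcomp Require Import all_classical all_reals all_analysis.
From mathcomp Require Import complex ring lra measurable_realfun filter.
Set Implicit Arguments.
Unset Strict Implicit.
Unset Printing Implicit Defensive.
Import Order.TTheory GRing.Theory Num.Theory.
Import numFieldNormedType.Exports.
Local Open Scope classical_set_scope.
Local Open Scope ring_scope.
Local Notation Rint := Defs.Rint.

(** * Iterated integrals of continuous functions dominated by an integrable weight *)

Section weight.
Context {R : realType}.
Notation mu := (@lebesgue_measure R).

(** Why signs: N coefficients of size N^(-1/2) only give the trivial bound N^(1/2), and such a loss
    would leave S^m_(1,delta). Rudin-Shapiro sums are flat together with all their partial sums, so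
    Abel summation makes each derivative of A_j cost only the top frequency, at most 2^(delta j).
    Why sparse frequencies: the spacing 2^(eps j) tends to infinity, which makes the interaction of
    distinct packets negligible when the short-time Fourier transform is bounded from below. It
    costs a factor 2^(-eps j) in N, paid by the strict inequality for m. Since delta < 1, the shifts
    by at most 2^(delta j) stay below 2^j / 16, where the cutoff equals 1. All packets share one
    position, so p enters only through constants. The window is arbitrary and its transform against
    a given Gaussian may vanish; the Gaussian is therefore taken narrow, depending on the window.
    The integrals are iterated one-dimensional ones. Linearity, translation and limits are
    established for continuous integrands dominated by the product weight prod 1 / (1 + x_i^2), and
    all arguments stay in that class. *)

Definition w1 (t : R) : R := (1 + t ^+ 2)^-1.
Definition Iw : R := \int[mu]_t w1 t.

Lemma w1_gt0 t : 0 < w1 t.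
Proof. by rewrite invr_gt0 ltr_wpDr// sqr_ge0. Qed.

Lemma w1_le1 t : w1 t <= 1.
Proof. by rewrite invf_le1 ?lerDl ?sqr_ge0// ltr_wpDr// sqr_ge0. Qed.

Lemma w1_continuous : continuous w1.
Proof.
move=> t; apply: cvgV; first by rewrite gt_eqF// ltr_wpDr// sqr_ge0.
by apply: cvgD; [exact: cvg_cst|apply: exprn_continuous].
Qed.

Lemma w1_integral_lty : (\int[mu]_t (w1 t)%:E < +oo)%E.
Proof.
rewrite ge0_symfun_integralT.
- rewrite (_ : [set x | _] = `[0%R, +oo[%classic); last first.
    by apply/seteqP; split => x /=; rewrite in_itv/= andbT.
  rewrite [X in (_ * X)%E](_ : _ = (pi / 2)%:E) ?ltry//.
  by rewrite -integral0y_oneDsqr.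
- by move=> t; exact: ltW (w1_gt0 t).
- exact: w1_continuous.
- by move=> t; rewrite /= /w1 sqrrN.
Qed.

Lemma w1_integrable : mu.-integrable setT (EFin \o w1).
Proof.
apply/integrableP; split.
  by apply/measurable_EFinP; apply: continuous_measurable_fun w1_continuous.
under eq_integral do rewrite /= ger0_norm ?(ltW (w1_gt0 _))//.
exact: w1_integral_lty.
Qed.

Lemma continuous_w1_integrable (f : R -> R) (C : R) :
  continuous f -> (forall t, `|f t| <= C * w1 t) ->
  mu.-integrable setT (EFin \o f).
Proof.
move=> cf fC; apply: (le_integrable measurableT _ _ (integrableZl measurableT C w1_integrable)).
- by apply/measurable_EFinP; exact: continuous_measurable_fun.
- by move=> t _ /=; rewrite lee_fin (le_trans (fC t))// ler_norm.
Qed.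

Lemma Iw_ge0 : 0 <= Iw.
Proof. by apply: Rintegral_ge0 => t _; rewrite ltW// w1_gt0. Qed.

Lemma w1_Rintegral_le (f : R -> R) (C : R) :
  continuous f -> (forall t, `|f t| <= C * w1 t) -> `|\int[mu]_t f t| <= C * Iw.
Proof.
move=> cf fC; have fi := continuous_w1_integrable cf fC.
rewrite (le_trans (le_normr_Rintegral _ fi))//.
rewrite -RintegralZl//; last exact: w1_integrable.
apply: le_Rintegral => //; first by have /integrable_norm := fi.
by have := integrableZl measurableT C w1_integrable.
Qed.

(* Peetre's inequality *)
Lemma w1_peetre (s t : R) : w1 (t + s) <= 2 * (1 + s ^+ 2) * w1 t.
Proof.
rewrite /w1 ler_pdivlMr ?ltr_wpDr ?sqr_ge0// mulrC ler_pdivrMr ?ltr_wpDr ?sqr_ge0//.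
have h : 2 * (1 + s ^+ 2) * (1 + (t + s) ^+ 2) - (1 + t ^+ 2) = (1 + (t + 2 * s) ^+ 2) + 2 * (s * (t + s)) ^+ 2.
  by ring.
rewrite -subr_ge0 h; have := sqr_ge0 (t + 2 * s); have := sqr_ge0 (s * (t + s)); lra.
Qed.

(** Substitution is applied to the positive and the negative part separately, both being continuous
    and nonnegative. *)
Lemma integral_shift (f : R -> R) (h : R) : continuous f ->
  \int[mu]_t f (t + h) = \int[mu]_t f t.
Proof.
have pos (g : R -> R) : continuous g -> (forall t, 0 <= g t) ->
    (\int[mu]_t (g (t + h)%R)%:E = \int[mu]_t (g t)%:E)%E.
  move=> cg g0.
  have dF : (shift h : R -> R)^`()%classic = cst 1.
    by apply/funext => x; rewrite derive1E; have [_ ->] := @is_derive_shift R x 1 h.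
  rewrite [RHS](@increasing_ge0_integration_by_substitutionT R (shift h) g)//.
  - by apply: eq_integral => x _; rewrite /= dF/= mulr1.
  - by move=> x y; rewrite /= ltrD2r.
  - by rewrite dF => x; exact: cvg_cst.
  - by rewrite dF; exact: is_cvg_cst.
  - by rewrite dF; exact: is_cvg_cst.
  - apply/cvgrNyPle => M; exists (M - h); split; first exact: num_real.
    by move=> x /ltW; rewrite /= lerBrDr.
  - apply/cvgryPge => M; exists (M - h); split; first exact: num_real.
    by move=> x /ltW; rewrite /= lerBlDr.
move=> cf; rewrite /Rintegral [in LHS]integralE [in RHS]integralE; congr fine.
have cp (u : R -> R) : continuous u -> continuous (fun t => Num.max (u t) 0).
  by move=> cu x; apply: continuous_max; [exact: cu|exact: cvg_cst].
congr (_ - _)%E.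
- have E (k : R) : (fun t => (f (t + k))%:E)^\+%E = (fun t => ((fun u => Num.max (f u) 0) (t + k))%:E).
    by apply/funext => t; rewrite funeposE/= EFin_max.
  have := E 0; under [X in X ^\+%E = _]eq_fun do rewrite addr0; move->; rewrite E.
  rewrite [RHS](_ : _ = \int[mu]_t (Num.max (f t) 0)%:E)%E; last first.
    by apply: eq_integral => t _; rewrite addr0.
  by apply: (pos (fun u => Num.max (f u) 0)); [exact: cp|move=> t; rewrite le_max lexx orbT].
- have E (k : R) : (fun t => (f (t + k))%:E)^\-%E = (fun t => ((fun u => Num.max (- f u) 0) (t + k))%:E).
    by apply/funext => t; rewrite funenegE/= EFin_max.
  have := E 0; under [X in X ^\-%E = _]eq_fun do rewrite addr0; move->; rewrite E.
  rewrite [RHS](_ : _ = \int[mu]_t (Num.max (- f t) 0)%:E)%E; last first.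
    by apply: eq_integral => t _; rewrite addr0.
  apply: (pos (fun u => Num.max (- f u) 0)); last by move=> t; rewrite le_max lexx orbT.
  by apply: (cp (fun u => - f u)) => x; apply: cvgN; exact: cf.
Qed.

Lemma cvg_rV k (u : nat -> 'rV[R]_k) (l : 'rV[R]_k) :
  (forall j, u n 0 j @[n --> \oo] --> l 0 j) -> u n @[n --> \oo] --> l.
Proof.
move=> ul; apply/cvgrPdist_lt => e e0.
have h : \forall n \near \oo, forall j : 'I_k, `|l 0 j - u n 0 j| < e.
  by apply: filter_forall => j; have /cvgrPdist_lt := ul j; exact.
near=> n; rewrite /Num.norm/= mx_normrE; apply: bigmax_lt => // -[i j] _ /=.
rewrite !mxE ord1; have : forall j : 'I_k, `|l 0 j - u n 0 j| < e by near: n.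
exact.
Unshelve. all: by end_near. Qed.

Lemma cvg_rV_coord k (u : nat -> 'rV[R]_k) (l : 'rV[R]_k) j :
  u n @[n --> \oo] --> l -> u n 0 j @[n --> \oo] --> l 0 j.
Proof. by move=> ul; apply: (cvg_comp u (fun v : 'rV[R]_k => v 0 j) ul); exact: coord_continuous. Qed.

(** By contraposition and countable choice. Continuity of parameter integrals comes from dominated
    convergence, which speaks of sequences. *)
Lemma seq_continuous_at (V W : normedModType R) (f : V -> W) (x : V) :
  (forall u : nat -> V, u n @[n --> \oo] --> x -> f (u n) @[n --> \oo] --> f x) ->
  {for x, continuous f}.
Proof.
move=> H; apply: contrapT => nf.
have [e e0 he] : exists2 e : R, 0 < e & forall d : R, 0 < d ->
    exists y : V, `|x - y| < d /\ e <= `|f x - f y|.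
  apply: contrapT => hn; apply: nf; apply/cvgrPdist_lt => e e0.
  apply: contrapT => hn2; apply: hn; exists e => // d d0.
  apply: contrapT => hn3; apply: hn2; apply/nbhs_normP; exists d => //= y xy.
  by rewrite ltNge; apply/negP => h; apply: hn3; exists y.
have /choice[u hu] : forall n : nat, exists y : V, `|x - y| < n.+1%:R^-1 /\ e <= `|f x - f y|.
  by move=> n; apply: he; rewrite invr_gt0.
have ux : u n @[n --> \oo] --> x.
  apply/cvgrPdist_lt => d d0; near=> n.
  have [h _] := hu n; apply: (lt_le_trans h); near: n.
  by near=> n; apply: ltW; near: n; exact: near_infty_natSinv_lt (PosNum d0).
have /cvgrPdist_lt/(_ e e0)[N _ /(_ N)/= ] := H u ux.
by move=> /(_ (leqnn _)); rewrite ltNge; have [_ ->] := hu N.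
Unshelve. all: by end_near. Qed.

Lemma ctsD (T : topologicalType) (f g : T -> R) : continuous f -> continuous g ->
  continuous (fun x => f x + g x).
Proof. by move=> cf cg x; apply: cvgD; [exact: cf|exact: cg]. Qed.

Lemma ctsM (T : topologicalType) (f g : T -> R) : continuous f -> continuous g ->
  continuous (fun x => f x * g x).
Proof. by move=> cf cg x; apply: cvgM; [exact: cf|exact: cg]. Qed.

Lemma ctsN (T : topologicalType) (f : T -> R) : continuous f ->
  continuous (fun x => - f x).
Proof. by move=> cf x; apply: cvgN; exact: cf. Qed.

Lemma ctsC (T : topologicalType) (c : R) : continuous (fun _ : T => c).
Proof. by move=> x; exact: cvg_cst. Qed.

Lemma cts_comp (T U : topologicalType) (f : T -> U) (g : U -> R) :
  continuous f -> continuous g -> continuous (fun x => g (f x)).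
Proof. by move=> cf cg x; apply: continuous_comp; [exact: cf|exact: cg]. Qed.

Lemma cts_sum (T : topologicalType) I (r : seq I) (f : I -> T -> R) :
  (forall i, continuous (f i)) -> continuous (fun x => \sum_(i <- r) f i x).
Proof.
move=> cf; elim: r => [|i r IH].
  by under eq_fun do rewrite big_nil; exact: ctsC.
by under eq_fun do rewrite big_cons; exact: ctsD.
Qed.

Lemma cts_prod (T : topologicalType) I (r : seq I) (f : I -> T -> R) :
  (forall i, continuous (f i)) -> continuous (fun x => \prod_(i <- r) f i x).
Proof.
move=> cf; elim: r => [|i r IH].
  by under eq_fun do rewrite big_nil; exact: ctsC.
by under eq_fun do rewrite big_cons; exact: ctsM.
Qed.

Lemma cts_addcst (U : normedModType R) (v : U) : continuous (fun x : U => x + v).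
Proof. by move=> x; apply: cvgD; [exact: cvg_id|exact: cvg_cst]. Qed.

End weight.

(** * Iterated integrals over a list of coordinates *)

Section iterated_integrals.
Context {R : realType} {k : nat}.
Notation mu := (@lebesgue_measure R).
Notation V := 'rV[R]_k.
Implicit Types (s r : seq 'I_k) (x y : V) (F G : V -> R).

Definition wpr s x : R := \prod_(j <- s) w1 (x 0 j).

Lemma wpr_gt0 s x : 0 < wpr s x.
Proof. by apply: prodr_gt0 => j _; exact: w1_gt0. Qed.

Lemma wpr_le1 s x : wpr s x <= 1.
Proof. by apply: prodr_ile1 => j _; rewrite w1_le1 ltW ?w1_gt0. Qed.

Lemma wpr_upd s x i t : i \notin s -> wpr s (upd x i t) = wpr s x.
Proof.
move=> is_; apply: eq_big_seq => j js; rewrite mxE; case: eqP => // ji.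
by rewrite -ji js in is_.
Qed.

Lemma upd_id x i t : upd x i t 0 i = t.
Proof. by rewrite mxE eqxx. Qed.

Lemma upd_neq x i j t : j != i -> upd x i t 0 j = x 0 j.
Proof. by rewrite mxE => /negbTE ->. Qed.

Lemma cvg_upd (y_ : nat -> V) y i t : y_ n @[n --> \oo] --> y ->
  upd (y_ n) i t @[n --> \oo] --> upd y i t.
Proof.
move=> h; apply: cvg_rV => j; rewrite mxE.
under eq_cvg do rewrite mxE.
by case: eqP => _; [exact: cvg_cst|exact: cvg_rV_coord].
Qed.

Lemma continuous_upd x i : continuous (upd x i).
Proof.
move=> t; apply: seq_continuous_at => u ut; apply: cvg_rV => j; rewrite mxE.
under eq_cvg do rewrite mxE.
by case: eqP => _ //; exact: cvg_cst.
Qed.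

(* Continuous convergence: it passes through the iterated integral one variable at a
   time, and implies both continuity in the remaining variables and dominated convergence. *)
Definition seqcvg (F_ : nat -> V -> R) F := forall (y_ : nat -> V) y,
  y_ n @[n --> \oo] --> y -> F_ n (y_ n) @[n --> \oo] --> F y.

Lemma seqcvg_cst F : continuous F -> seqcvg (fun=> F) F.
Proof. by move=> cF y_ y h; apply: (cvg_comp y_ F h); exact: cF. Qed.

Lemma seqcvg_continuous F : seqcvg (fun=> F) F -> continuous F.
Proof. by move=> h x; apply: seq_continuous_at => u; exact: h. Qed.

(** Induction on the integrated variables [s]. The list [r] collects the outer ones, whose weights
    must survive the inner integrations because they dominate the outer integrands. Bound and
    convergence are proved together since each outer integration needs both. *)
Lemma iRint_dominated s r (C : R) (F_ : nat -> V -> R) F : uniq (r ++ s) ->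
  (forall n, continuous (F_ n)) -> continuous F ->
  (forall n x, `|F_ n x| <= C * wpr (r ++ s) x) -> seqcvg F_ F ->
  (forall n x, `|iRint s (F_ n) x| <= C * Iw ^+ size s * wpr r x) /\
  seqcvg (fun n => iRint s (F_ n)) (iRint s F).
Proof.
elim: s r F_ F => [|i s IH] r F_ F.
  by rewrite cats0 /= => _ _ _ b h; split => // n x; rewrite expr0 mulr1.
rewrite -cat_rcons => u cF_ cF b h.
have C0 : 0 <= C.
  have := le_trans (normr_ge0 _) (b 0%N 0); rewrite pmulr_lge0//; exact: wpr_gt0.
have wr x t : wpr (rcons r i) (upd x i t) = wpr r x * w1 t.
  rewrite /wpr -cats1 big_cat big_seq1 upd_id /=; congr (_ * _).
  apply: wpr_upd; move: u; rewrite cat_uniq rcons_uniq.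
  by case/andP => /andP[].
(* The limit inherits the bound, so the induction hypothesis also applies to the constant sequence
   [F]. *)
have bF x : `|F x| <= C * wpr (rcons r i ++ s) x.
  have hx : F_ n x @[n --> \oo] --> F x by apply: h; exact: cvg_cst.
  have hn : `|F_ n x| @[n --> \oo] --> `|F x| by apply: cvg_norm.
  rewrite -(cvg_lim (@Rhausdorff R) hn); apply: limr_le; last exact: nearW.
  by apply/cvg_ex; exists `|F x|.
have [B1 S1] := IH _ F_ F u cF_ cF b h.
have cI G : continuous G -> (forall x, `|G x| <= C * wpr (rcons r i ++ s) x) ->
    (forall x, `|iRint s G x| <= C * Iw ^+ size s * wpr (rcons r i) x) /\ continuous (iRint s G).
  move=> cG bG; have [|B2 S2] := IH _ (fun=> G) G u (fun=> cG) cG (fun=> bG).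
    exact: seqcvg_cst.
  by split; [exact: (B2 0%N)|exact: seqcvg_continuous].
have cu G x : continuous (iRint s G) -> continuous (fun t => iRint s G (upd x i t)).
  by move=> cG t; apply: continuous_comp; [exact: continuous_upd|exact: cG].
have bd G x t : (forall x, `|iRint s G x| <= C * Iw ^+ size s * wpr (rcons r i) x) ->
    `|iRint s G (upd x i t)| <= (C * Iw ^+ size s * wpr r x) * w1 t.
  by move=> hG; rewrite (le_trans (hG _))// wr mulrA.
split=> [n x|y_ y hy] /=.
  have [B2 C2] := cI _ (cF_ n) (b n).
  rewrite (_ : C * _ * _ = (C * Iw ^+ size s * wpr r x) * Iw); last by rewrite exprS; ring.
  by apply: w1_Rintegral_le => [|t]; [exact: cu|exact: bd].
have [B2 C2] := cI _ cF bF.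
have D0 : 0 <= C * Iw ^+ size s by rewrite mulr_ge0// exprn_ge0// Iw_ge0.
apply: fine_cvg; rewrite /Rintegral fineK; last first.
  apply: integrable_fin_num => //.
  by apply: (continuous_w1_integrable (cu _ y C2)) => t; exact: bd.
apply: (@dominated_cvg _ _ _ mu setT measurableT _ _ (fun t => (C * Iw ^+ size s * w1 t)%:E)) => //.
- move=> n; apply/measurable_EFinP; apply: continuous_measurable_fun. apply: (cu (F_ n) (y_ n)).
  exact: (cI _ (cF_ n) (b n)).2.
- move=> t _; apply: cvg_EFin; first exact: nearW.
  by apply: S1; exact: cvg_upd.
- exact: integrableZl w1_integrable.
- move=> n t _ /=; rewrite lee_fin (le_trans (bd _ _ _ (B1 n)))//.
  by rewrite ler_wpM2r ?(ltW (w1_gt0 _))// ler_piMr ?wpr_le1.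
Qed.

Lemma iRint_eq_off s F G x :
  (forall y, (forall j, j \notin s -> y 0 j = x 0 j) -> F y = G y) ->
  iRint s F x = iRint s G x.
Proof.
elim: s x => [|i s IH] x FG /=; first exact: FG.
apply: eq_Rintegral => t _; apply: IH => y hy; apply: FG => j.
by rewrite inE negb_or => /andP[ji js]; rewrite hy// upd_neq.
Qed.

Definition idom s F := continuous F /\ exists C, forall x, `|F x| <= C * wpr s x.

Lemma iRint_idom s F : uniq s -> idom s F -> continuous (iRint s F).
Proof.
move=> us [cF [C b]].
have [|_ h] := @iRint_dominated s [::] C (fun=> F) F us (fun=> cF) cF (fun=> b).
  exact: seqcvg_cst.
exact: seqcvg_continuous.
Qed.

Lemma iRint_head_integrable i s F x : uniq (i :: s) -> idom (i :: s) F ->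
  mu.-integrable setT (EFin \o (fun t => iRint s F (upd x i t))).
Proof.
move=> us [cF [C b]].
have [|B h] := @iRint_dominated s [:: i] C (fun=> F) F us (fun=> cF) cF (fun=> b).
  exact: seqcvg_cst.
apply: (@continuous_w1_integrable _ _ (C * Iw ^+ size s)).
  move=> t; apply: continuous_comp; first exact: continuous_upd.
  exact: (seqcvg_continuous h).
by move=> t; rewrite (le_trans (B 0%N _))// /wpr big_seq1 upd_id.
Qed.

Lemma idom_tail i s F : idom (i :: s) F -> idom s F.
Proof.
move=> [cF [C b]]; split => //; exists C => x; rewrite (le_trans (b x))//.
have C0 : 0 <= C.
  have := le_trans (normr_ge0 _) (b 0); rewrite pmulr_lge0//; exact: wpr_gt0.
by rewrite ler_wpM2l// /wpr big_cons ler_piMl ?w1_le1// ltW// wpr_gt0.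
Qed.

Lemma iRintD s F G x : uniq s -> idom s F -> idom s G ->
  iRint s (fun y => F y + G y) x = iRint s F x + iRint s G x.
Proof.
elim: s x => [//|i s IH] x us dF dG /=.
rewrite -RintegralD//; [|exact: iRint_head_integrable..].
apply: eq_Rintegral => t _; apply: IH; [by case/andP: us|exact: idom_tail dF|exact: idom_tail dG].
Qed.

Lemma iRintZ s F c x : uniq s -> idom s F ->
  iRint s (fun y => c * F y) x = c * iRint s F x.
Proof.
elim: s x => [//|i s IH] x us dF /=.
rewrite -RintegralZl//; last exact: iRint_head_integrable.
by apply: eq_Rintegral => t _; apply: IH; [case/andP: us|exact: idom_tail dF].
Qed.

Lemma iRint_shift_notin s F x (i : 'I_k) h : i \notin s ->
  iRint s (fun y => F (y + h *: unitv i)) x = iRint s F (x + h *: unitv i).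
Proof.
elim: s x => [//|j s IH] x; rewrite inE negb_or => /andP[ij is_] /=.
apply: eq_Rintegral => t _; rewrite IH//; congr (iRint s F _).
apply/rowP => l; rewrite !mxE; case: (eqVneq l j) => // ->.
by rewrite eq_sym (negbTE ij) andbF mulr0 addr0.
Qed.

Lemma iRint_shift s F x (i : 'I_k) h : uniq s -> i \in s -> idom s F ->
  iRint s (fun y => F (y + h *: unitv i)) x = iRint s F x.
Proof.
elim: s x => [//|j s IH] x us; rewrite inE => is_ dF /=.
case: (eqVneq i j) is_ us dF => [<- _|ij /= is_] us dF.
- have js : i \notin s by case/andP: us.
  transitivity (\int[mu]_t (fun t => iRint s F (upd x i t)) (t + h)).
    apply: eq_Rintegral => t _; rewrite iRint_shift_notin//; congr (iRint s F _).
    apply/rowP => l; rewrite !mxE; case: (eqVneq l i) => [_|li].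
      by rewrite eqxx mulr1.
    by rewrite andbF mulr0 addr0.
  apply: integral_shift => t; apply: continuous_comp; first exact: continuous_upd.
  by apply: iRint_idom; [case/andP: us|exact: idom_tail dF].
- apply: eq_Rintegral => t _; apply: IH => //; first by case/andP: us.
  exact: idom_tail dF.
Qed.

End iterated_integrals.

(** * Integrals over the whole space: linearity, translation, integration by parts, tensor
    products *)

Section integral.
Context {R : realType} {k : nat}.
Notation mu := (@lebesgue_measure R).
Notation V := 'rV[R]_k.
Implicit Types (x y : V) (F G : V -> R).

(** A product rather than a power of the Euclidean norm: it can be integrated one coordinate at a
    time, and its inverse is the polynomial [prod (1 + x_i^2)], which Schwartz bounds and
    integration by parts control. *)
Definition W x : R := \prod_(i < k) w1 (x 0 i).

Lemma WE x : W x = wpr (enum 'I_k) x.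
Proof. by rewrite /wpr big_enum. Qed.

Lemma W_gt0 x : 0 < W x. Proof. by rewrite WE wpr_gt0. Qed.
Lemma W_le1 x : W x <= 1. Proof. by rewrite WE wpr_le1. Qed.

Definition dom F := continuous F /\ exists C, forall x, `|F x| <= C * W x.

Lemma dom_idom F : dom F <-> idom (enum 'I_k) F.
Proof. by split=> -[cF [C h]]; split=> //; exists C => x; have := h x; rewrite WE. Qed.

Lemma dom_bound_ge0 F C : (forall x, `|F x| <= C * W x) -> 0 <= C.
Proof. by move=> /(_ 0) /(le_trans (normr_ge0 _)); rewrite pmulr_lge0// W_gt0. Qed.

Lemma RintD F G : dom F -> dom G -> Rint (fun x => F x + G x) = Rint F + Rint G.
Proof. by move=> /dom_idom dF /dom_idom dG; exact: iRintD (enum_uniq _) dF dG. Qed.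

Lemma RintZ c F : dom F -> Rint (fun x => c * F x) = c * Rint F.
Proof. by move=> /dom_idom dF; exact: iRintZ (enum_uniq _) dF. Qed.

Lemma eq_Rint F G : F =1 G -> Rint F = Rint G.
Proof. by move=> /funext ->. Qed.

Lemma Rint_bound F C : continuous F -> (forall x, `|F x| <= C * W x) ->
  `|Rint F| <= C * Iw ^+ k.
Proof.
move=> cF b; have [] := @iRint_dominated R k (enum 'I_k) [::] C (fun=> F) F (enum_uniq _) (fun=> cF) cF.
- by move=> _ x; rewrite cat0s -WE.
- exact: seqcvg_cst.
- by move=> /(_ 0%N 0) + _; rewrite /wpr big_nil mulr1 -cardE card_ord.
Qed.

Lemma Rint_cvg (F_ : nat -> V -> R) F C : (forall n, continuous (F_ n)) -> continuous F ->
  (forall n x, `|F_ n x| <= C * W x) -> seqcvg F_ F -> Rint (F_ n) @[n --> \oo] --> Rint F.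
Proof.
move=> cF_ cF b h; have [] := @iRint_dominated R k (enum 'I_k) [::] C F_ F (enum_uniq _) cF_ cF.
- by move=> n x; rewrite cat0s -WE.
- by [].
- by move=> _; apply; exact: cvg_cst.
Qed.

Lemma domD F G : dom F -> dom G -> dom (fun x => F x + G x).
Proof.
move=> [cF [C bF]] [cG [D bG]]; split; first exact: ctsD.
exists (C + D) => x; rewrite mulrDl (le_trans (ler_normD _ _))// lerD//.
Qed.

Lemma domZ c F : dom F -> dom (fun x => c * F x).
Proof.
move=> [cF [C bF]]; split; first by apply: ctsM => //; exact: ctsC.
by exists (`|c| * C) => x; rewrite normrM -mulrA ler_wpM2l.
Qed.

Lemma dom0 : dom (fun=> 0).
Proof. by split; [exact: ctsC|exists 0 => x; rewrite normr0 mul0r]. Qed.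

Lemma dom_mul_bounded F G B : dom F -> continuous G -> (forall x, `|G x| <= B) ->
  dom (fun x => F x * G x).
Proof.
move=> [cF [C bF]] cG bG; split; first exact: ctsM.
exists (C * B) => x; rewrite normrM mulrAC ler_pM//.
Qed.

Lemma dom_sum (I : Type) (r : seq I) (F : I -> V -> R) : (forall i, dom (F i)) ->
  dom (fun x => \sum_(i <- r) F i x).
Proof.
move=> dF; elim: r => [|i r IH].
  by rewrite (_ : (fun x => _) = fun=> 0); [exact: dom0|apply/funext => x; rewrite big_nil].
rewrite (_ : (fun x => _) = fun x => F i x + \sum_(j <- r) F j x); first exact: domD.
by apply/funext => x; rewrite big_cons.
Qed.

Lemma Rint_cst0 : Rint (fun _ : V => 0) = 0.
Proof.
rewrite -[RHS](mul0r (Rint (fun _ : V => 0))) -RintZ; last exact: dom0.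
by apply: eq_Rint => x; rewrite mul0r.
Qed.

Lemma Rint_sum (I : Type) (r : seq I) (F : I -> V -> R) : (forall i, dom (F i)) ->
  Rint (fun x => \sum_(i <- r) F i x) = \sum_(i <- r) Rint (F i).
Proof.
move=> dF; elim: r => [|i r IH].
  by rewrite big_nil -[RHS]Rint_cst0; apply: eq_Rint => x; rewrite big_nil.
rewrite big_cons -IH -RintD//; last exact: dom_sum.
by apply: eq_Rint => x; rewrite big_cons.
Qed.

Lemma Rint_shift F i h : dom F -> Rint (fun x => F (x + h *: unitv i)) = Rint F.
Proof. by move=> /dom_idom dF; apply: iRint_shift => //; [exact: enum_uniq|rewrite mem_enum]. Qed.

Lemma W_shift x i h : W (x + h *: unitv i) <= 2 * (1 + h ^+ 2) * W x.
Proof.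
rewrite /W (bigD1 i)//= [in leRHS](bigD1 i)//= mulrA.
rewrite (_ : \prod_(j < k | j != i) w1 ((x + h *: unitv i) 0 j) = \prod_(j < k | j != i) w1 (x 0 j)).
  apply: ler_wpM2r; first by apply: prodr_ge0 => j _; exact: ltW (w1_gt0 _).
  by rewrite !mxE !eqxx mulr1 w1_peetre.
by apply: eq_bigr => j ji; rewrite !mxE eqxx (negbTE ji) mulr0 addr0.
Qed.

Lemma line_is_derive F x v (t : R) : derivable F (x + t *: v) v ->
  is_derive t 1 (fun u => F (x + u *: v)) ('D_v F (x + t *: v)).
Proof.
have E : (fun h : R => h^-1 *: ((fun u => F (x + u *: v)) (h *: (1 : R) + t) - F (x + t *: v))) =
   (fun h : R => h^-1 *: (F (h *: v + (x + t *: v)) - F (x + t *: v))).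
  apply/funext => h; congr (_ *: (F _ - _)).
  by rewrite scaler1 scalerDl addrCA.
by move=> d; split; [rewrite /derivable E|rewrite /derive E].
Qed.

(** Translation invariance gives every difference quotient the integral zero. The quotients converge
    to the derivative and, being values of it at nearby points, share a bound by [W]. *)
Lemma Rint_derive_eq0 F i C : dom F -> (forall x, derivable F x (unitv i)) ->
  continuous ('D_(unitv i) F) -> (forall x, `|'D_(unitv i) F x| <= C * W x) ->
  Rint ('D_(unitv i) F) = 0.
Proof.
move=> dF dd cD bD.
pose h (n : nat) : R := n.+1%:R^-1.
have h0 n : 0 < h n by rewrite invr_gt0.
have h1 n : h n <= 1 by rewrite invf_le1// ler1n.
have cF : continuous F by case: dF.
have shc t : continuous (fun x : V => x + t *: unitv i).
  exact: cts_addcst.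
have cFs t : continuous (fun x => F (x + t *: unitv i)).
  exact: (cts_comp (shc t)).
have C0 := dom_bound_ge0 bD.
have dFs t : dom (fun x => F (x + t *: unitv i)).
  split => //; have [_ [D bF]] := dF; exists (D * (2 * (1 + t ^+ 2))) => x.
  by rewrite (le_trans (bF _))// -mulrA ler_wpM2l ?(dom_bound_ge0 bF)// W_shift.
pose Q n x := (h n)^-1 * (F (x + h n *: unitv i) + -1 * F x).
have dQ n : dom (fun x => F (x + h n *: unitv i) + -1 * F x).
  by apply: domD => //; exact: domZ.
have IQ n : Rint (Q n) = 0.
  by rewrite RintZ// RintD ?RintZ ?Rint_shift//; [ring|exact: domZ].
have Qmv n x : exists t, 0 <= t <= h n /\ Q n x = 'D_(unitv i) F (x + t *: unitv i).
  have der (t : R) : is_derive t 1 (fun u => F (x + u *: unitv i)) ('D_(unitv i) F (x + t *: unitv i)).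
    exact: line_is_derive.
  have [|t] := @MVT_segment R _ _ 0 (h n) (ltW (h0 n)) (fun t _ => der t).
    apply: continuous_subspaceT => t; apply: differentiable_continuous.
    by apply/derivable1_diffP; have [] := der t.
  rewrite in_itv/= subr0 scale0r addr0 => th e; exists t; split => //.
  by rewrite /Q mulN1r e mulrC mulfK// gt_eqF.
(* Peetre's inequality for a shift [0 <= t <= 1] costs [2 * (1 + t ^+ 2) <= 4]. *)
have bQ n x : `|Q n x| <= (4 * C) * W x.
  have [t [/andP[t0 th] ->]] := Qmv n x; rewrite (le_trans (bD _))//.
  rewrite [4 * C]mulrC -mulrA ler_wpM2l// (le_trans (W_shift _ _ _))//.
  rewrite ler_wpM2r ?(ltW (W_gt0 _))//.
  by have t1 := le_trans th (h1 n); have := mulr_ile1 t0 t0 t1 t1; rewrite expr2; lra.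
have := Rint_cvg (fun n => (domZ (h n)^-1 (dQ n)).1) cD bQ.
have sQ : seqcvg Q ('D_(unitv i) F).
  move=> y_ y hy; have /choice[t ht] : forall n, exists t, 0 <= t <= h n /\ Q n (y_ n) = 'D_(unitv i) F (y_ n + t *: unitv i).
    by move=> n; exact: Qmv.
  have t0 : t n @[n --> \oo] --> 0.
    apply: (@squeeze_cvgr _ _ _ _ (fun=> 0) h); last 2 first.
    - exact: cvg_cst.
    - exact: cvg_harmonic.
    by apply: nearW => n; have [] := ht n.
  under eq_cvg => n do rewrite (ht n).2.
  have hz : y_ n + t n *: unitv i @[n --> \oo] --> y.
    rewrite -[X in _ --> X]addr0 -[X in _ + X](scale0r (unitv i)).
    by apply: cvgD => //; apply: cvgZl.
  exact: (cvg_comp _ _ hz (cD y)).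
move=> /(_ sQ); under eq_cvg do rewrite IQ.
move=> /(cvg_lim (@Rhausdorff R)) <-; exact: lim_cst.
Qed.

Lemma iEint_ge0 s (F : V -> \bar R) x : (forall y, 0 <= F y)%E -> (0 <= iEint s F x)%E.
Proof.
move=> F0; case: s => [|i s] /=; first exact: F0.
by elim: s i x => [|j s IH] i x /=; apply: integral_ge0 => t _ //; exact: IH.
Qed.

(** The integral of a nonnegative function is a supremum over simple functions below it, so a
    pointwise inequality between inner integrals passes to the outer ones. *)
Lemma iEint_le s (F G : V -> \bar R) x : (forall y, 0 <= F y)%E -> (forall y, F y <= G y)%E ->
  (iEint s F x <= iEint s G x)%E.
Proof.
move=> F0 FG; have G0 y : (0 <= G y)%E by exact: le_trans (F0 y) (FG y).
elim: s x => [|i s IH] x /=; first exact: FG.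
rewrite !ge0_integralE; [|by move=> t _; exact: iEint_ge0..].
apply: ereal_sup_le => _ [g hg <-]; exists g => // t.
apply: le_trans (hg t) _; rewrite !patch_setT; exact: IH.
Qed.

Lemma iEint_eq_off s (F G : V -> \bar R) x :
  (forall y, (forall j, j \notin s -> y 0 j = x 0 j) -> F y = G y) ->
  iEint s F x = iEint s G x.
Proof.
elim: s x => [|i s IH] x FG /=; first exact: FG.
apply: eq_integral => t _; apply: IH => y hy; apply: FG => j.
by rewrite inE negb_or => /andP[ji js]; rewrite hy// upd_neq.
Qed.

(** [c] is arbitrary so that the factor of the outer variable can be absorbed into it. The mixed
    norms below are estimated by comparison with such tensors. *)
Lemma iEint_tensor s (phi : 'I_k -> R -> R) (a : 'I_k -> R) c x : uniq s -> 0 <= c ->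
  (forall i t, 0 <= phi i t) -> (forall i, measurable_fun setT (phi i)) ->
  (forall i, \int[mu]_t (phi i t)%:E = (a i)%:E)%E ->
  iEint s (fun y => (c * \prod_(i <- s) phi i (y 0 i))%:E) x = (c * \prod_(i <- s) a i)%:E.
Proof.
move=> us c0 p0 mp ip.
have a0 i : 0 <= a i by rewrite -lee_fin -ip integral_ge0// => t _; rewrite lee_fin.
elim: s us c c0 x => [|i s IH] us c c0 x /=; first by rewrite !big_nil.
case/andP: us => is_ us.
transitivity (\int[mu]_t ((c * \prod_(j <- s) a j)%:E * (phi i t)%:E))%E; last first.
  rewrite ge0_integralZl//; last 3 first.
  - by apply/measurable_EFinP; exact: mp.
  - by move=> t _; rewrite lee_fin.
  - by rewrite lee_fin mulr_ge0// prodr_ge0.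
  by rewrite ip big_cons -EFinM; congr EFin; ring.
apply: eq_integral => t _.
rewrite -EFinM mulrAC -(IH us (c * phi i t) _ (upd x i t)) ?mulr_ge0//.
apply: iEint_eq_off => y hy; congr EFin.
by rewrite big_cons mulrA hy// upd_id.
Qed.

Lemma Eint_tensor (phi : 'I_k -> R -> R) (a : 'I_k -> R) c : 0 <= c ->
  (forall i t, 0 <= phi i t) -> (forall i, measurable_fun setT (phi i)) ->
  (forall i, \int[mu]_t (phi i t)%:E = (a i)%:E)%E ->
  Eint (fun y : V => (c * \prod_i phi i (y 0 i))%:E) = (c * \prod_i a i)%:E.
Proof.
move=> c0 p0 mp ip; rewrite -[in RHS]big_enum -(iEint_tensor 0 (enum_uniq 'I_k) c0 p0 mp ip).
by congr (iEint _ _ _); apply/funext => y; rewrite big_enum.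
Qed.

End integral.

(** * Complex-valued functions *)

Section complex_values.
Context {R : realType}.
Implicit Types (z w : R[i]) (a b : R).

Lemma cmodE z : cmod z = Normc.normc z.
Proof. by case: z. Qed.

Lemma creD z w : cre (z + w) = cre z + cre w. Proof. by case: z; case: w. Qed.
Lemma cimD z w : cim (z + w) = cim z + cim w. Proof. by case: z; case: w. Qed.
Lemma creM z w : cre (z * w) = cre z * cre w - cim z * cim w.
Proof. by case: z; case: w. Qed.
Lemma cimM z w : cim (z * w) = cre z * cim w + cim z * cre w.
Proof. by case: z; case: w. Qed.
Lemma cre_real a : cre a%:C%C = a. Proof. by []. Qed.
Lemma cim_real a : cim a%:C%C = 0. Proof. by []. Qed.

Lemma complex_ext z w : cre z = cre w -> cim z = cim w -> z = w.
Proof. by case: z => a b; case: w => c d; rewrite /cre /cim /= => -> ->. Qed.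

Lemma cmodM z w : cmod (z * w) = cmod z * cmod w.
Proof. by rewrite !cmodE Normc.normcM. Qed.

Lemma cmodD z w : cmod (z + w) <= cmod z + cmod w.
Proof. by rewrite !cmodE le_normcD. Qed.

Lemma cmodN z : cmod (- z) = cmod z.
Proof. by rewrite !cmodE normcN. Qed.

Lemma cmod0 : cmod (0 : R[i]) = 0.
Proof. by rewrite cmodE Normc.normc0. Qed.

Lemma cmod_ge0 z : 0 <= cmod z. Proof. exact: sqrtr_ge0. Qed.

Lemma cmod_real a : cmod a%:C%C = `|a|.
Proof. by rewrite /cmod cre_real cim_real expr0n/= addr0 sqrtr_sqr. Qed.

Lemma cmod_cexp a : cmod (cexp a) = 1.
Proof. by rewrite /cmod /cre /cim /= cos2Dsin2 sqrtr1. Qed.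

Lemma cmod_conj z : cmod (cconj z) = cmod z.
Proof. by rewrite /cmod /cconj /cre /cim /= sqrrN. Qed.

Lemma cre_le_cmod z : `|cre z| <= cmod z.
Proof. by rewrite /cmod -[leLHS]sqrtr_sqr ler_wsqrtr// lerDl sqr_ge0. Qed.

Lemma cim_le_cmod z : `|cim z| <= cmod z.
Proof. by rewrite /cmod -[leLHS]sqrtr_sqr ler_wsqrtr// lerDr sqr_ge0. Qed.

Lemma cmod_le_add z : cmod z <= `|cre z| + `|cim z|.
Proof.
rewrite -[leRHS]ger0_norm ?addr_ge0// -sqrtr_sqr ler_wsqrtr//.
rewrite sqrrD !real_normK ?num_real// -addrA lerD2l lerDr mulrn_wge0// mulr_ge0//.
Qed.

Lemma cmod_sum (I : Type) (r : seq I) (F : I -> R[i]) :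
  cmod (\sum_(i <- r) F i) <= \sum_(i <- r) cmod (F i).
Proof.
elim: r => [|i r IH]; first by rewrite !big_nil cmod0.
by rewrite !big_cons (le_trans (cmodD _ _))// lerD2l.
Qed.

Lemma cexpD a b : cexp (a + b) = cexp a * cexp b.
Proof. by apply: complex_ext; rewrite ?creM ?cimM /cre /cim /= ?cosD ?sinD//; ring. Qed.

Lemma cexp0 : cexp (0 : R) = 1.
Proof. by apply: complex_ext; rewrite /cre /cim /= ?cos0 ?sin0. Qed.

Lemma cexp_sum (I : Type) (r : seq I) (F : I -> R) :
  cexp (\sum_(i <- r) F i) = \prod_(i <- r) cexp (F i).
Proof.
elim: r => [|i r IH]; first by rewrite !big_nil cexp0.
by rewrite !big_cons cexpD IH.
Qed.

Lemma cre_sum (I : Type) (r : seq I) (F : I -> R[i]) :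
  cre (\sum_(i <- r) F i) = \sum_(i <- r) cre (F i).
Proof. by elim: r => [|i r IH]; rewrite ?big_nil// !big_cons creD IH. Qed.

Lemma cim_sum (I : Type) (r : seq I) (F : I -> R[i]) :
  cim (\sum_(i <- r) F i) = \sum_(i <- r) cim (F i).
Proof. by elim: r => [|i r IH]; rewrite ?big_nil// !big_cons cimD IH. Qed.

Section Cint.
Context {k : nat}.
Notation V := 'rV[R]_k.
Implicit Types (F G : V -> R[i]).

Definition domc F := dom (fun x => cre (F x)) /\ dom (fun x => cim (F x)).

Definition ccont (T : topologicalType) (F : T -> R[i]) :=
  continuous (fun x => cre (F x)) /\ continuous (fun x => cim (F x)).

Lemma domcP F : domc F <-> ccont F /\ exists C, forall x, cmod (F x) <= C * W x.
Proof.
split=> [[[c1 [C b1]] [c2 [D b2]]]|[[c1 c2] [C b]]].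
  split => //; exists (C + D) => x; rewrite (le_trans (cmod_le_add _))// mulrDl lerD//.
split; split => //; exists C => x.
  exact: le_trans (cre_le_cmod _) (b x).
exact: le_trans (cim_le_cmod _) (b x).
Qed.

Lemma ccontD (T : topologicalType) (F G : T -> R[i]) : ccont F -> ccont G -> ccont (fun x => F x + G x).
Proof.
move=> [a b] [c d]; split.
  by under eq_fun do rewrite creD; exact: ctsD.
by under eq_fun do rewrite cimD; exact: ctsD.
Qed.

Lemma ccontM (T : topologicalType) (F G : T -> R[i]) : ccont F -> ccont G -> ccont (fun x => F x * G x).
Proof.
move=> [a b] [c d]; split.
  under eq_fun do rewrite creM; apply: ctsD; first exact: ctsM.
  by apply: ctsN; exact: ctsM.
by under eq_fun do rewrite cimM; apply: ctsD; exact: ctsM.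
Qed.

Lemma ccont_cst (T : topologicalType) z : ccont (fun _ : T => z).
Proof. by split; exact: ctsC. Qed.

Lemma ccont_real (T : topologicalType) (f : T -> R) : continuous f -> ccont (fun x => (f x)%:C%C).
Proof. by move=> cf; split => //; exact: ctsC. Qed.

Lemma ccont_cexp (T : topologicalType) (f : T -> R) : continuous f -> ccont (fun x => cexp (f x)).
Proof.
move=> cf; split.
  exact: (cts_comp cf (@continuous_cos R)).
exact: (cts_comp cf (@continuous_sin R)).
Qed.

Lemma ccont_sum (T : topologicalType) (I : Type) (r : seq I) (F : I -> T -> R[i]) :
  (forall i, ccont (F i)) -> ccont (fun x => \sum_(i <- r) F i x).
Proof.
move=> h; split.
  by under eq_fun do rewrite cre_sum; apply: cts_sum => i; exact: (h i).1.
by under eq_fun do rewrite cim_sum; apply: cts_sum => i; exact: (h i).2.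
Qed.

Lemma continuous_coord (j : 'I_k) : continuous (fun x : V => x 0 j).
Proof. exact: coord_continuous. Qed.

Lemma continuous_dotv (y : V) : continuous (fun x : V => dotv y x).
Proof.
apply: cts_sum => j; apply: ctsM; first exact: ctsC.
exact: continuous_coord.
Qed.

Lemma dotvC (x y : V) : dotv x y = dotv y x.
Proof. by apply: eq_bigr => j _; rewrite mulrC. Qed.

Lemma dotvDl (x y z : V) : dotv (x + y) z = dotv x z + dotv y z.
Proof. by rewrite /dotv -big_split; apply: eq_bigr => j _; rewrite mxE mulrDl. Qed.

Lemma dotvNl (x z : V) : dotv (- x) z = - dotv x z.
Proof. by rewrite /dotv -sumrN; apply: eq_bigr => j _; rewrite mxE mulNr. Qed.

Lemma domcD F G : domc F -> domc G -> domc (fun x => F x + G x).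
Proof.
move=> [a b] [c d]; split.
  by under eq_fun do rewrite creD; exact: domD.
by under eq_fun do rewrite cimD; exact: domD.
Qed.

Lemma domcZ z F : domc F -> domc (fun x => z * F x).
Proof.
move=> [a b]; split.
  under eq_fun do rewrite creM -mulNr; by apply: domD; exact: domZ.
by under eq_fun do rewrite cimM; apply: domD; exact: domZ.
Qed.

Lemma domc_mul_bounded F G B : domc F -> ccont G -> (forall x, cmod (G x) <= B) ->
  domc (fun x => F x * G x).
Proof.
move=> /domcP[cF [C bF]] cG bG; apply/domcP; split; first exact: ccontM.
by exists (C * B) => x; rewrite cmodM mulrAC ler_pM// cmod_ge0.
Qed.

Lemma eq_Cint F G : F =1 G -> Cint F = Cint G.
Proof. by move=> /funext ->. Qed.

Lemma creCint F : cre (Cint F) = Rint (fun x => cre (F x)). Proof. by []. Qed.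
Lemma cimCint F : cim (Cint F) = Rint (fun x => cim (F x)). Proof. by []. Qed.

Lemma CintD F G : domc F -> domc G -> Cint (fun x => F x + G x) = Cint F + Cint G.
Proof.
move=> [a b] [c d]; rewrite /Cint; apply: complex_ext; rewrite ?creD ?cimD /cre /cim /=.
  by rewrite -RintD//; apply: eq_Rint => x; rewrite -creD.
by rewrite -RintD//; apply: eq_Rint => x; rewrite -cimD.
Qed.

Lemma CintZ z F : domc F -> Cint (fun x => z * F x) = z * Cint F.
Proof.
move=> [a b]; rewrite /Cint; apply: complex_ext; rewrite ?creM ?cimM /cre /cim /=.
  rewrite -!RintZ// -mulN1r -RintZ; last exact: domZ.
  rewrite -RintD; [|exact: domZ|by apply: domZ; exact: domZ].
  by apply: eq_Rint => x; rewrite -/(cre (z * F x)) creM /cre /cim; ring.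
rewrite -!RintZ// -RintD; [|exact: domZ..].
by apply: eq_Rint => x; rewrite -/(cim (z * F x)) cimM.
Qed.

Lemma domc_sum (I : Type) (r : seq I) (F : I -> V -> R[i]) : (forall i, domc (F i)) ->
  domc (fun x => \sum_(i <- r) F i x).
Proof.
move=> h; split.
  by under eq_fun do rewrite cre_sum; apply: dom_sum => i; exact: (h i).1.
by under eq_fun do rewrite cim_sum; apply: dom_sum => i; exact: (h i).2.
Qed.

Lemma Cint_sum (I : Type) (r : seq I) (F : I -> V -> R[i]) : (forall i, domc (F i)) ->
  Cint (fun x => \sum_(i <- r) F i x) = \sum_(i <- r) Cint (F i).
Proof.
move=> h; apply: complex_ext; rewrite ?cre_sum ?cim_sum.
  rewrite {1}/cre /= (eq_Rint (fun x => cre_sum r (F^~ x))).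
  by apply: Rint_sum => i; exact: (h i).1.
rewrite {1}/cim /= (eq_Rint (fun x => cim_sum r (F^~ x))).
by apply: Rint_sum => i; exact: (h i).2.
Qed.

Lemma Cint_bound F C : ccont F -> (forall x, cmod (F x) <= C * W x) ->
  cmod (Cint F) <= 2 * C * Iw ^+ k.
Proof.
move=> [c1 c2] b; rewrite (le_trans (cmod_le_add _))// -mulrA mulr2n mulrDl !mul1r.
apply: lerD; apply: Rint_bound => // x.
  exact: le_trans (cre_le_cmod _) (b x).
exact: le_trans (cim_le_cmod _) (b x).
Qed.

Lemma Cint_seqcvg_cont (F : V -> V -> R[i]) C :
  (forall x, ccont (F x)) -> (forall x y, cmod (F x y) <= C * W y) ->
  (forall x_ y_ x y, x_ n @[n --> \oo] --> x -> y_ n @[n --> \oo] --> y ->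
     cre (F (x_ n) (y_ n)) @[n --> \oo] --> cre (F x y) /\
     cim (F (x_ n) (y_ n)) @[n --> \oo] --> cim (F x y)) ->
  ccont (fun x => Cint (F x)).
Proof.
move=> cF b h; split => x; apply: seq_continuous_at => u ux.
- apply: (@Rint_cvg _ _ (fun n y => cre (F (u n) y)) (fun y => cre (F x y)) C).
  + by move=> n; exact: (cF _).1.
  + exact: (cF _).1.
  + by move=> n y; exact: le_trans (cre_le_cmod _) (b _ _).
  + by move=> y_ y hy; exact: (h _ _ _ _ ux hy).1.
- apply: (@Rint_cvg _ _ (fun n y => cim (F (u n) y)) (fun y => cim (F x y)) C).
  + by move=> n; exact: (cF _).2.
  + exact: (cF _).2.
  + by move=> n y; exact: le_trans (cim_le_cmod _) (b _ _).
  + by move=> y_ y hy; exact: (h _ _ _ _ ux hy).2.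
Qed.

End Cint.
End complex_values.

(** * Calculus of iterated partial derivatives *)

Section smooth_functions.
Context {R : realType} {k : nat}.
Notation V := 'rV[R]_k.
Implicit Types (s : seq 'I_k) (x y : V) (f g : V -> R).

Lemma pderiv_cat s1 s2 f : pderiv (s1 ++ s2) f = pderiv s1 (pderiv s2 f).
Proof. by elim: s1 => //= i s ->. Qed.

Lemma smooth_pderiv s f : smooth f -> smooth (pderiv s f).
Proof. by move=> sf s'; rewrite -pderiv_cat; exact: sf. Qed.

Lemma smooth_continuous f : smooth f -> continuous f.
Proof. by move=> /(_ [::])[]. Qed.

Lemma smooth_derivable f x i : smooth f -> derivable f x (unitv i).
Proof. by move=> /(_ [::])[_]. Qed.

Lemma pderivD s f g : smooth f -> smooth g ->
  pderiv s (fun x => f x + g x) = (fun x => pderiv s f x + pderiv s g x).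
Proof.
move=> sf sg; elim: s => //= i s ->; apply/funext => x.
by rewrite deriveD //; [exact: (sf s).2|exact: (sg s).2].
Qed.

Lemma smoothD f g : smooth f -> smooth g -> smooth (fun x => f x + g x).
Proof.
move=> sf sg s; rewrite pderivD//; split.
  by apply: ctsD; [exact: (sf s).1|exact: (sg s).1].
by move=> i x; apply: derivableD; [exact: (sf s).2|exact: (sg s).2].
Qed.

Lemma pderivZ s c f : smooth f -> pderiv s (fun x => c * f x) = (fun x => c * pderiv s f x).
Proof.
move=> sf; elim: s => //= i s ->; apply/funext => x.
by rewrite (@deriveZ _ _ _ (pderiv s f) c)//; exact: (sf s).2.
Qed.

Lemma smoothZ c f : smooth f -> smooth (fun x => c * f x).
Proof.
move=> sf s; rewrite pderivZ//; split.
  by apply: ctsM; [exact: ctsC|exact: (sf s).1].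
by move=> i x; apply: (@derivableZ _ _ _ (pderiv s f) c); exact: (sf s).2.
Qed.

Lemma pderiv_cst c s : pderiv s (fun _ : V => c) = fun=> if s is [::] then c else 0.
Proof.
by elim: s => //= i s ->; apply/funext => x; case: s => [|? ?]; rewrite derive_cst.
Qed.

Lemma smooth_cst c : smooth (fun _ : V => c).
Proof. by move=> s; rewrite pderiv_cst; split; [exact: ctsC|move=> i x; exact: derivable_cst]. Qed.

Lemma smooth_sum (I : Type) (r : seq I) (f : I -> V -> R) : (forall i, smooth (f i)) ->
  smooth (fun x => \sum_(i <- r) f i x).
Proof.
move=> sf; elim: r => [|i r IH].
  by under eq_fun do rewrite big_nil; exact: smooth_cst.
by under eq_fun do rewrite big_cons; exact: smoothD.
Qed.

Lemma pderiv_sum s (I : Type) (r : seq I) (f : I -> V -> R) : (forall i, smooth (f i)) ->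
  pderiv s (fun x => \sum_(i <- r) f i x) = (fun x => \sum_(i <- r) pderiv s (f i) x).
Proof.
move=> sf; elim: r => [|i r IH].
  under eq_fun do rewrite big_nil; rewrite pderiv_cst; apply/funext => x.
  by rewrite big_nil; case: s.
under eq_fun do rewrite big_cons.
rewrite pderivD//; last exact: smooth_sum.
by apply/funext => x; rewrite IH big_cons.
Qed.

(** Pairs of complementary subwords of [s], with repetitions; listing each split separately replaces
    multinomial coefficients. *)
Fixpoint leibniz s : seq (seq 'I_k * seq 'I_k) :=
  if s is i :: s' then
    [seq (i :: p.1, p.2) | p <- leibniz s'] ++ [seq (p.1, i :: p.2) | p <- leibniz s']
  else [:: ([::], [::])].

Lemma pderivM_aux f g s : smooth f -> smooth g ->
  pderiv s (fun x => f x * g x) = (fun x => \sum_(p <- leibniz s) pderiv p.1 f x * pderiv p.2 g x) /\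
  forall i x, is_derive x (unitv i) (fun x => \sum_(p <- leibniz s) pderiv p.1 f x * pderiv p.2 g x)
    (\sum_(p <- leibniz (i :: s)) pderiv p.1 f x * pderiv p.2 g x).
Proof.
move=> sf sg.
have D (r : seq (seq 'I_k * seq 'I_k)) i x :
    is_derive x (unitv i) (fun x => \sum_(p <- r) pderiv p.1 f x * pderiv p.2 g x)
     (\sum_(p <- r) (pderiv (i :: p.1) f x * pderiv p.2 g x + pderiv p.1 f x * pderiv (i :: p.2) g x)).
  elim: r => [|p r IH].
    rewrite big_nil (_ : (fun x => _) = cst 0); first exact: is_derive_cst.
    by apply/funext => y; rewrite big_nil.
  rewrite big_cons (_ : (fun x => _) = (fun x => pderiv p.1 f x * pderiv p.2 g x) +
     (fun x => \sum_(p <- r) pderiv p.1 f x * pderiv p.2 g x)); last first.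
    by apply/funext => y; rewrite big_cons.
  apply: is_deriveD.
  have df : is_derive x (unitv i) (pderiv p.1 f) (pderiv (i :: p.1) f x).
    exact/derivableP/(sf p.1).2.
  have dg : is_derive x (unitv i) (pderiv p.2 g) (pderiv (i :: p.2) g x).
    exact/derivableP/(sg p.2).2.
  apply: (is_derive_eq (is_deriveM df dg)).
  by rewrite -!/(_ * _) /GRing.scale /= addrC mulrC.
have E i x : is_derive x (unitv i) (fun x => \sum_(p <- leibniz s) pderiv p.1 f x * pderiv p.2 g x)
    (\sum_(p <- leibniz (i :: s)) pderiv p.1 f x * pderiv p.2 g x).
  apply: (is_derive_eq (D _ i x)).
  by rewrite big_split big_cat !big_map.
split=> //; elim: s {E} => [|i s IH].
  by apply/funext => x; rewrite big_seq1.
rewrite [LHS]/= IH; apply/funext => x.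
by have /@derive_val -> := D (leibniz s) i x; rewrite big_split big_cat !big_map.
Qed.

Lemma pderivM f g s : smooth f -> smooth g ->
  pderiv s (fun x => f x * g x) = (fun x => \sum_(p <- leibniz s) pderiv p.1 f x * pderiv p.2 g x).
Proof. by move=> sf sg; have [] := pderivM_aux s sf sg. Qed.

Lemma smoothM f g : smooth f -> smooth g -> smooth (fun x => f x * g x).
Proof.
move=> sf sg s; rewrite pderivM//; split.
  by apply: cts_sum => p; apply: ctsM; [exact: (sf _).1|exact: (sg _).1].
by move=> i x; have [_ /(_ i x)[]] := pderivM_aux s sf sg.
Qed.

Lemma pderiv_shift s f c : pderiv s (fun x => f (x + c)) = (fun x => pderiv s f (x + c)).
Proof.
elim: s => //= i s ->; apply/funext => x; rewrite /derive.
have -> // : (fun y => pderiv s f (y + c)) \o shift x = pderiv s f \o shift (x + c).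
by apply/funext => h; rewrite /= addrA.
Qed.

Lemma smooth_shift f c : smooth f -> smooth (fun x => f (x + c)).
Proof.
move=> sf s; rewrite pderiv_shift; split.
  by apply: cts_comp; [exact: cts_addcst|exact: (sf s).1].
move=> i x; have := (sf s).2 i (x + c); rewrite /derivable.
have -> // : (fun y => pderiv s f (y + c)) \o shift x = pderiv s f \o shift (x + c).
by apply/funext => h; rewrite /= addrA.
Qed.

Lemma is_derive_line f x (v : V) d :
  is_derive (0 : R) 1 (fun u => f (x + u *: v)) d -> is_derive x v f d.
Proof.
have E : (fun h : R => h^-1 *: ((fun u => f (x + u *: v)) (h *: (1 : R) + 0) - (fun u => f (x + u *: v)) 0)) =
   (fun h : R => h^-1 *: (f (h *: v + x) - f x)).
  apply/funext => h; congr (_ *: (f _ - f _)); last by rewrite scale0r addr0.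
  by rewrite scaler1 addr0 addrC.
by move=> [d1 d2]; split; [rewrite /derivable -E|rewrite /derive -E].
Qed.

Lemma is_derive_tensor (phi dphi : 'I_k -> R -> R) j x :
  is_derive (x 0 j) 1 (phi j) (dphi j (x 0 j)) ->
  is_derive x (unitv j) (fun y => \prod_i phi i (y 0 i))
    (\prod_i (if i == j then dphi i else phi i) (x 0 i)).
Proof.
move=> d; apply: is_derive_line.
rewrite (_ : (fun u => _) = (fun u : R => (\prod_(i | i != j) phi i (x 0 i)) *: phi j (u + x 0 j))); last first.
  apply/funext => u; rewrite (bigD1 j)//= mulrC; congr (_ * _).
    apply: eq_bigr => i ij; congr (phi i _).
    by rewrite !mxE eqxx (negbTE ij) mulr0 addr0.
  by rewrite !mxE !eqxx mulr1 addrC.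
have -> : \prod_i (if i == j then dphi i else phi i) (x 0 i) =
    (\prod_(i | i != j) phi i (x 0 i)) *: dphi j (x 0 j).
  rewrite (bigD1 j)//= eqxx mulrC; congr (_ * _).
  by apply: eq_bigr => i /negbTE ->.
apply: is_deriveZ.
have E : (fun h : R => h^-1 *: (phi j (h *: (1 : R) + 0 + x 0 j) - phi j (0 + x 0 j))) =
   (fun h : R => h^-1 *: (phi j (h *: (1 : R) + x 0 j) - phi j (x 0 j))).
  by apply/funext => h; rewrite addr0 add0r.
by case: d => d1 d2; split; [rewrite /derivable E|rewrite /derive E].
Qed.

Section tensor.
Variable phi : 'I_k -> nat -> R -> R.
Hypothesis hphi : forall (i : 'I_k) (l : nat) (t : R), is_derive t 1 (phi i l) (phi i l.+1 t).

(** A derivative in direction [j] only raises the order of the [j]-th factor, so a word of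
    derivatives acts through its letter counts. *)
Lemma pderiv_tensor s :
  pderiv s (fun x => \prod_i phi i 0%N (x 0 i)) = (fun x => \prod_i phi i (count_mem i s) (x 0 i)).
Proof.
elim: s => //= j s ->; apply/funext => x.
have := @is_derive_tensor (fun i => phi i (count_mem i s)) (fun i => phi i (count_mem i s).+1) j x (hphi _ _ _).
move=> /@derive_val ->; apply: eq_bigr => i _.
by rewrite eq_sym; case: eqP.
Qed.

Lemma smooth_tensor : smooth (fun x => \prod_i phi i 0%N (x 0 i)).
Proof.
move=> s; rewrite pderiv_tensor; split.
  apply: cts_prod => i; apply: (cts_comp (@continuous_coord _ _ i)) => t.
  by apply: differentiable_continuous; apply/derivable1_diffP; have [] := hphi i (count_mem i s) t.
move=> j x.
by have [] := @is_derive_tensor (fun i => phi i (count_mem i s)) (fun i => phi i (count_mem i s).+1) j x (hphi _ _ _).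
Qed.
End tensor.

Lemma is_derive_cosD (eta p t : R) : is_derive t 1 (fun u => cos (eta * u + p)) (eta * cos (eta * t + p + pi / 2)).
Proof.
have h1 : is_derive t 1 (fun u : R => eta * u + p) eta.
  have h : is_derive t 1 ((eta \*: (id : R -> R)) + cst p) (eta *: 1 + 0).
    by apply: is_deriveD.
  by apply: (is_derive_eq h); rewrite /GRing.scale /= mulr1 addr0.
have h2 := @is_derive1_comp R cos (fun u => eta * u + p) t _ _ (is_derive_cos _) h1.
by apply: (is_derive_eq h2); rewrite cosDpihalf mulrC.
Qed.

Lemma is_derive_cosdotv (eta x : V) (p : R) i :
  is_derive x (unitv i) (fun y => cos (dotv eta y + p)) (eta 0 i * cos (dotv eta x + p + pi / 2)).
Proof.
apply: is_derive_line.
have E u : dotv eta (x + u *: unitv i) = eta 0 i * u + dotv eta x.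
  rewrite dotvC dotvDl dotvC addrC; congr (_ + _).
  rewrite /dotv (bigD1 i)//= big1; last by move=> j ji; rewrite !mxE (negbTE ji) andbF mulr0 mul0r.
  by rewrite !mxE !eqxx mulr1 addr0 mulrC.
rewrite (_ : (fun u => _) = fun u => cos (eta 0 i * u + (dotv eta x + p))); last first.
  by apply/funext => u; rewrite E addrA.
apply: (is_derive_eq (is_derive_cosD _ _ _)).
by rewrite mulr0 add0r.
Qed.

(** Writing [- sin] as [cos] advanced by [pi / 2] keeps all derivatives in one family. *)
Lemma pderiv_cos (eta : V) (p : R) s : pderiv s (fun x => cos (dotv eta x + p)) =
  (fun x => (\prod_(i <- s) eta 0 i) * cos (dotv eta x + (p + (size s)%:R * (pi / 2)))).
Proof.
elim: s => [|i s IH] /=.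
  by apply/funext => x; rewrite big_nil mul1r mul0r addr0.
rewrite IH; apply/funext => x.
have d := is_derive_cosdotv eta x (p + (size s)%:R * (pi / 2)) i.
have := @is_deriveZ _ _ _ _ (\prod_(i <- s) eta 0 i) x (unitv i) _ d => /@derive_val.
rewrite {1}/GRing.scale /= => ->.
rewrite big_cons /GRing.scale /= mulrCA mulrA; congr (_ * cos _).
by rewrite -addrA -addrA -natr1; congr (_ + _); ring.
Qed.

Lemma smooth_cos (eta : V) (p : R) : smooth (fun x => cos (dotv eta x + p)).
Proof.
move=> s; rewrite pderiv_cos; split.
  apply: ctsM; first exact: ctsC.
  apply: cts_comp; last exact: continuous_cos.
  by apply: ctsD; [exact: continuous_dotv|exact: ctsC].
move=> i x; have d := is_derive_cosdotv eta x (p + (size s)%:R * (pi / 2)) i.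
by have [] := @is_deriveZ _ _ _ _ (\prod_(i <- s) eta 0 i) x (unitv i) _ d.
Qed.

Lemma pderiv_local (P : set V) f g s : open P -> (forall x, P x -> f x = g x) ->
  forall x, P x -> pderiv s f x = pderiv s g x.
Proof.
move=> oP fg; elim: s => //= i s IH x Px; apply: near_eq_derive.
by apply: (filterS IH); exact: open_nbhs_nbhs.
Qed.

(** Meant for the locally finite sum over dyadic scales that defines the symbol. *)
Lemma smooth_local f : (forall x, exists P g, [/\ open P, P x, smooth g & forall y, P y -> f y = g y]) ->
  smooth f.
Proof.
move=> h s; split=> [x|i x]; have [P [g [oP Px sg fg]]] := h x;
  have near_fg : \forall y \near x, pderiv s g y = pderiv s f y.
- by apply: filterS (fun y Py => esym (pderiv_local s oP fg Py)) _; exact: open_nbhs_nbhs.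
- rewrite /continuous_at (pderiv_local s oP fg Px).
  exact: cvg_trans (near_eq_cvg near_fg) ((sg s).1 x).
- by apply: filterS (fun y Py => esym (pderiv_local s oP fg Py)) _; exact: open_nbhs_nbhs.
- by apply: (near_eq_derivable near_fg); exact: (sg s).2.
Qed.

(* Derivative bounds [|D^s (f a)| <= C_s w a], uniform in the parameter [a]. *)
Definition sbd (X : Type) (w : X -> V -> R) (f : X -> V -> R) :=
  (forall a, smooth (f a)) /\
  forall s, exists C, forall a x, `|pderiv s (f a) x| <= C * w a x.

Lemma sbdM (X : Type) w w' (f g : X -> V -> R) : sbd w f -> sbd w' g ->
  sbd (fun a x => w a x * w' a x) (fun a x => f a x * g a x).
Proof.
move=> [sf bf] [sg bg]; split=> [a|s]; first exact: smoothM.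
have [Cf hf] := choice bf; have [Cg hg] := choice bg.
exists (\sum_(p <- leibniz s) Cf p.1 * Cg p.2) => a x.
rewrite pderivM// mulr_suml (le_trans (ler_norm_sum _ _ _))//.
apply: ler_sum => p _; rewrite normrM mulrACA; exact: ler_pM.
Qed.

Lemma sbdD (X : Type) w (f g : X -> V -> R) : sbd w f -> sbd w g ->
  sbd w (fun a x => f a x + g a x).
Proof.
move=> [sf bf] [sg bg]; split=> [a|s]; first exact: smoothD.
have [C hf] := bf s; have [D hg] := bg s; exists (C + D) => a x.
by rewrite pderivD// mulrDl (le_trans (ler_normD _ _))// lerD.
Qed.

Lemma sbdZ (X : Type) w c (f : X -> V -> R) : sbd w f -> sbd w (fun a x => c * f a x).
Proof.
move=> [sf bf]; split=> [a|s]; first exact: smoothZ.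
have [C hf] := bf s; exists (`|c| * C) => a x.
by rewrite pderivZ// normrM -mulrA ler_wpM2l.
Qed.

Lemma sbd_pderiv (X : Type) w s (f : X -> V -> R) : sbd w f -> sbd w (fun a => pderiv s (f a)).
Proof.
move=> [sf bf]; split=> [a|s']; first exact: smooth_pderiv.
by have [C hf] := bf (s' ++ s); exists C => a x; rewrite -pderiv_cat.
Qed.

Lemma sbd_le (X : Type) w w' K (f : X -> V -> R) : (forall a x, 0 <= w a x <= K * w' a x) ->
  sbd w f -> sbd w' f.
Proof.
move=> h [sf bf]; split => // s; have [C hf] := bf s; exists (`|C| * K) => a x.
have /andP[h1 h2] := h a x.
rewrite (le_trans (hf a x))// (@le_trans _ _ (`|C| * w a x))//.
  by rewrite ler_wpM2r// ler_norm.
by rewrite -mulrA ler_wpM2l.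
Qed.

End smooth_functions.

(** * Decay of short-time Fourier transforms *)

Section oscillatory_integrals.
Context {R : realType} {k : nat}.
Notation V := 'rV[R]_k.
Implicit Types (x y eta : V) (u : V -> R) (p : R).

Lemma cvg_sumr (I : Type) (r : seq I) (u : I -> nat -> R) (l : I -> R) :
  (forall i, u i n @[n --> \oo] --> l i) ->
  \sum_(i <- r) u i n @[n --> \oo] --> \sum_(i <- r) l i.
Proof.
move=> h; elim: r => [|i r IH].
  by under eq_cvg do rewrite big_nil; rewrite big_nil; exact: cvg_cst.
by under eq_cvg do rewrite big_cons; rewrite big_cons; exact: cvgD.
Qed.

Lemma cvg_dotv (e_ y_ : nat -> V) (e y : V) : e_ n @[n --> \oo] --> e ->
  y_ n @[n --> \oo] --> y -> dotv (e_ n) (y_ n) @[n --> \oo] --> dotv e y.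
Proof.
move=> he hy; apply: (@cvg_sumr _ _ (fun j n => e_ n 0 j * y_ n 0 j)) => j.
by apply: cvgM; exact: cvg_rV_coord.
Qed.

(* The phase [p] encodes both real and imaginary parts of the Fourier integral
   ([p = 0] and [p = pi / 2]) and turns integration by parts into a shift of [p]. *)
Definition Josc u eta p := Rint (fun t => u t * cos (dotv eta t + p)).

Lemma dom_osc u eta p : dom u -> dom (fun t => u t * cos (dotv eta t + p)).
Proof.
move=> du; apply: (@dom_mul_bounded _ _ _ _ 1) => //.
  by apply: smooth_continuous; exact: smooth_cos.
by move=> x; rewrite ler_norml cos_geN1 cos_le1.
Qed.

Lemma cosDpihalf2 p : cos (p + pi / 2 + pi / 2) = - cos p.
Proof. by rewrite cosDpihalf sinDpihalf. Qed.

(** The integral of the derivative of [u cos] vanishes; differentiating the cosine brings down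
    [eta_i] and advances the phase by a quarter turn. *)
Lemma Josc_parts u eta p i : smooth u ->
  (forall s, exists C, forall t, `|pderiv s u t| <= C * W t) ->
  Josc (pderiv [:: i] u) eta p = - eta 0 i * Josc u eta (p + pi / 2).
Proof.
move=> su bu; pose G t := u t * cos (dotv eta t + p).
have d s : dom (pderiv s u) by split; [exact: (su s).1|exact: bu].
have sG : smooth G by exact: (smoothM su (smooth_cos _ _)).
have E : pderiv [:: i] G = (fun t => pderiv [:: i] u t * cos (dotv eta t + p) +
    eta 0 i * (u t * cos (dotv eta t + (p + pi / 2)))).
  rewrite (pderivM _ su (smooth_cos _ _)).
  have -> : leibniz [:: i] = [:: ([:: i], [::]); ([::], [:: i])] by [].
  apply/funext => t; rewrite big_cons big_seq1.
  change (pderiv [:: i] u t * cos (dotv eta t + p) +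
    u t * pderiv [:: i] (fun x => cos (dotv eta x + p)) t = pderiv [:: i] u t * cos (dotv eta t + p) +
    eta 0 i * (u t * cos (dotv eta t + (p + pi / 2)))).
  rewrite pderiv_cos big_seq1 mul1r.
  by congr (_ + _); rewrite mulrCA.
have dG : dom (pderiv [:: i] G).
  by rewrite E; apply: domD; [exact: (dom_osc _ _ (d [:: i]))|apply: domZ; exact: (dom_osc _ _ (d [::]))].
have [_ [C bG]] := dG.
have := @Rint_derive_eq0 R k G i C (dom_osc _ _ (d [::])) _ dG.1 bG.
have -> : 'D_(unitv i) G = pderiv [:: i] G by [].
move=> /(_ (fun x => @smooth_derivable _ _ G x i sG)); rewrite E RintD; last 2 first.
- exact: (dom_osc _ _ (d [:: i])).
- by apply: domZ; exact: (dom_osc _ _ (d [::])).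
rewrite RintZ; last exact: (dom_osc _ _ (d [::])).
by move=> /eqP; rewrite addr_eq0 mulNr => /eqP.
Qed.

(* Each factor [1 + eta_i^2] is absorbed by integrating [u - D_i^2 u] instead of [u]. *)
Lemma Josc_decay (X : Type) (om : X -> R) (u : X -> V -> R) (l : seq 'I_k) :
  sbd (fun a t => om a * W t) u ->
  exists C, forall a eta p, (\prod_(i <- l) (1 + eta 0 i ^+ 2)) * `|Josc (u a) eta p| <= C * om a.
Proof.
elim: l u => [|i l IH] u su.
  have [C bC] := su.2 [::]; exists (C * Iw ^+ k) => a eta p.
  rewrite big_nil mul1r (_ : C * _ * _ = (C * om a) * Iw ^+ k); last by ring.
  apply: Rint_bound => [|t].
    apply: ctsM; first exact: smooth_continuous (su.1 a).
    by apply: smooth_continuous; exact: smooth_cos.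
  rewrite normrM -mulrA; apply: (le_trans _ (bC a t)).
  by rewrite ler_piMr// ler_norml cos_geN1 cos_le1.
have [C bC] := IH _ (sbdD su (sbdZ (-1) (sbd_pderiv [:: i; i] su))).
exists C => a eta p; apply: (le_trans _ (bC a eta p)).
have ba s : exists D, forall t, `|pderiv s (u a) t| <= D * W t.
  by have [D bD] := su.2 s; exists (D * om a) => t; rewrite -mulrA.
have da s : dom (pderiv s (u a)) by split; [exact: (su.1 a s).1|exact: ba].
suff -> : Josc (fun x => u a x + -1 * pderiv [:: i; i] (u a) x) eta p = (1 + eta 0 i ^+ 2) * Josc (u a) eta p.
  rewrite normrM big_cons [`|1 + _|]ger0_norm ?addr_ge0 ?sqr_ge0//.
  by rewrite mulrA [_ * (1 + _)]mulrC.
transitivity (Josc (u a) eta p + -1 * Josc (pderiv [:: i; i] (u a)) eta p).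
  rewrite /Josc -RintZ; last exact: (dom_osc _ _ (da [:: i; i])).
  rewrite -RintD; [|exact: (dom_osc _ _ (da [::]))|by apply: domZ; exact: (dom_osc _ _ (da [:: i; i]))].
  by apply: eq_Rint => t; rewrite mulrDl -mulrA.
have -> : pderiv [:: i; i] (u a) = pderiv [:: i] (pderiv [:: i] (u a)) by [].
rewrite Josc_parts; [|exact: (smooth_pderiv [:: i] (su.1 a))|by move=> s; rewrite -pderiv_cat].
rewrite Josc_parts; [|exact: (su.1 a)|exact: ba].
have -> : Josc (u a) eta (p + pi / 2 + pi / 2) = -1 * Josc (u a) eta p.
  rewrite /Josc -RintZ; last exact: (dom_osc _ _ (da [::])).
  by apply: eq_Rint => t; rewrite addrA addrA cosDpihalf2; ring.
ring.
Qed.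

Lemma W_inv eta : \prod_(i <- enum 'I_k) (1 + eta 0 i ^+ 2) = (W eta)^-1.
Proof. by rewrite big_enum /W prodfV invrK. Qed.

Lemma Josc_decayW (X : Type) (om : X -> R) (u : X -> V -> R) :
  sbd (fun a t => om a * W t) u ->
  exists C, forall a eta p, `|Josc (u a) eta p| <= C * om a * W eta.
Proof.
move=> /(Josc_decay (enum 'I_k))[C bC]; exists C => a eta p.
by have := bC a eta p; rewrite W_inv mulrC ler_pdivrMr// W_gt0.
Qed.

(** Multiplying out the factors [1 + x_i^2] one at a time, each either leaves the monomial [a] alone
    or extends it by the letter [i] twice. *)
Lemma schwartz_W (gam : V -> R[i]) b : schwartz gam ->
  exists C, forall x, cmod (cpderiv b gam x) <= C * W x.
Proof.
move=> [_ bg].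
have H l a : exists C, forall x, (\prod_(i <- l) (1 + x 0 i ^+ 2)) *
    (`|\prod_(i <- a) x 0 i| * cmod (cpderiv b gam x)) <= C.
  elim: l a => [|i l IH] a.
    by have [C bC] := bg a b; exists C => x; rewrite big_nil mul1r.
  have [C1 b1] := IH a; have [C2 b2] := IH [:: i, i & a].
  exists (C1 + C2) => x; apply: (le_trans _ (lerD (b1 x) (b2 x))).
  rewrite !big_cons !normrM -[x 0 i ^+ 2]ger0_norm ?sqr_ge0// normrX.
  by rewrite le_eqVlt; apply/orP; left; apply/eqP; ring.
have [C bC] := H (enum 'I_k) [::]; exists C => x; have := bC x.
by rewrite W_inv big_nil normr1 mul1r mulrC ler_pdivrMr ?W_gt0.
Qed.

Lemma schwartz_sbd (gam : V -> R[i]) : schwartz gam ->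
  sbd (fun (_ : unit) x => W x) (fun _ x => cre (gam x)) /\
  sbd (fun (_ : unit) x => W x) (fun _ x => cim (gam x)).
Proof.
move=> sg; have [[s1 s2] _] := sg; split.
  split=> [_|s]; first exact: s1.
  have [C bC] := schwartz_W s sg; exists C => _ x; apply: (le_trans _ (bC x)).
  exact: (cre_le_cmod (cpderiv s gam x)).
split=> [_|s]; first exact: s2.
have [C bC] := schwartz_W s sg; exists C => _ x; apply: (le_trans _ (bC x)).
exact: (cim_le_cmod (cpderiv s gam x)).
Qed.

(** Peetre's inequality in each coordinate: a point [t] cannot be close both to [x] and to the
    origin when [x] is large. *)
Lemma W_sub x t : W (t - x) * W t <= 2 ^+ k * W x.
Proof.
rewrite /W -big_split -[k in 2 ^+ k]card_ord -prodr_const -big_split /=.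
apply: ler_prod => i _; rewrite mulr_ge0 ?(ltW (w1_gt0 _))//= !mxE.
rewrite (_ : w1 (t 0 i - x 0 i) = w1 (x 0 i + - t 0 i)); last first.
  by rewrite /w1 -(sqrrN (t 0 i - x 0 i)) opprB.
have := w1_peetre (- t 0 i) (x 0 i); rewrite sqrrN => h.
rewrite (le_trans (ler_wpM2r (ltW (w1_gt0 (t 0 i))) h))//.
have e : (1 + t 0 i ^+ 2) * w1 (t 0 i) = 1 by rewrite divff// gt_eqF// ltr_wpDr// sqr_ge0.
rewrite (_ : _ * w1 (t 0 i) = 2 * w1 (x 0 i) * ((1 + t 0 i ^+ 2) * w1 (t 0 i))); last by ring.
by rewrite e mulr1.
Qed.

(* [stft gamma (M_omega g) x xi = Astft g gamma x (xi - omega)] *)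
Definition Astft (g : V -> R) (gam : V -> R[i]) x eta :=
  Cint (fun t => (g t)%:C%C * cconj (gam (t - x)) * cexp (- dotv eta t)).

Section window.
Variables (g : V -> R) (gam : V -> R[i]).
Hypothesis sgam : schwartz gam.
Hypothesis sg : sbd (fun (_ : unit) x => W x * W x) (fun _ => g).

(** Of the two powers of [W t] supplied by [g], one is traded together with [W (t - x)] for decay in
    [x]; the other keeps the integral over [t] convergent. *)
Lemma window_sbd (c : V -> R) : sbd (fun (_ : unit) x => W x) (fun _ => c) ->
  sbd (fun x t => W x * W t) (fun x t => g t * c (t - x)).
Proof.
move=> sc; have h : sbd (fun x t => (W t * W t) * W (t - x)) (fun x t => g t * c (t - x)).
  apply: (@sbdM _ _ _ (fun x t => W t * W t) (fun x t => W (t - x)) (fun=> g) (fun x t => c (t - x))).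
    by split=> [a|s]; [exact: sg.1 tt|have [C bC] := sg.2 s; exists C => _; exact: bC tt].
  split=> [a|s]; first exact: smooth_shift (sc.1 tt).
  by have [C bC] := sc.2 s; exists C => a x; rewrite pderiv_shift; exact: bC tt _.
apply: (@sbd_le _ _ _ _ _ (2 ^+ k) _ _ h) => x t.
have [p1 p2] : 0 <= W t /\ 0 <= W (t - x) by rewrite !ltW ?W_gt0.
apply/andP; split; first by rewrite !mulr_ge0.
have := ler_wpM2r p1 (W_sub x t); rewrite -[2 ^+ k * W x * W t]mulrA.
by rewrite (_ : W t * W t * W (t - x) = W (t - x) * W t * W t)//; ring.
Qed.

Let g1 := fun x => cre (gam x).
Let g2 := fun x => cim (gam x).
Let s1 := window_sbd (schwartz_sbd sgam).1.
Let s2 := window_sbd (schwartz_sbd sgam).2.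

Lemma sbd_dom (u : V -> V -> R) x : sbd (fun x t => W x * W t) u -> dom (u x).
Proof.
move=> su; split; first exact: smooth_continuous (su.1 x).
by have [C bC] := su.2 [::]; exists (C * W x) => t; rewrite -mulrA; exact: bC.
Qed.

Lemma Astft_re x eta : cre (Astft g gam x eta) =
  Josc (fun t => g t * g1 (t - x)) eta 0 + Josc (fun t => g t * g2 (t - x)) eta (pi / 2).
Proof.
rewrite /Josc -RintD; [|exact: dom_osc (sbd_dom x s1)|exact: dom_osc (sbd_dom x s2)].
rewrite creCint; apply: eq_Rint => t.
rewrite creM creM cimM ?cre_real ?cim_real /g1 /g2 /cexp /cconj [in LHS]/cre [in LHS]/cim /= cosN sinN addr0 cosDpihalf; ring.
Qed.

Lemma Astft_im x eta : cim (Astft g gam x eta) =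
  Josc (fun t => g t * g1 (t - x)) eta (pi / 2) + -1 * Josc (fun t => g t * g2 (t - x)) eta 0.
Proof.
rewrite /Josc -RintZ; last exact: dom_osc (sbd_dom x s2).
rewrite -RintD; [|exact: dom_osc (sbd_dom x s1)|by apply: domZ; exact: dom_osc (sbd_dom x s2)].
rewrite cimCint; apply: eq_Rint => t.
rewrite cimM creM cimM ?cre_real ?cim_real /g1 /g2 /cexp /cconj [in LHS]/cre [in LHS]/cim /= cosN sinN addr0 cosDpihalf; ring.
Qed.

Lemma Astft_bound : exists2 C, 0 <= C & forall x eta, cmod (Astft g gam x eta) <= C * (W x * W eta).
Proof.
have [C1 b1] := Josc_decayW s1; have [C2 b2] := Josc_decayW s2.
have C10 : 0 <= C1.
  by have := le_trans (normr_ge0 _) (b1 0 0 0); rewrite -mulrA pmulr_lge0// mulr_gt0// W_gt0.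
have C20 : 0 <= C2.
  by have := le_trans (normr_ge0 _) (b2 0 0 0); rewrite -mulrA pmulr_lge0// mulr_gt0// W_gt0.
exists (2 * (C1 + C2)); first by rewrite mulr_ge0// addr_ge0.
move=> x eta; rewrite (le_trans (cmod_le_add _))// Astft_re Astft_im.
have h1 p := b1 x eta p; have h2 p := b2 x eta p.
rewrite (_ : 2 * _ * _ = (C1 * W x * W eta + C2 * W x * W eta) + (C1 * W x * W eta + C2 * W x * W eta)); last by ring.
apply: lerD; rewrite (le_trans (ler_normD _ _))//; apply: lerD => //.
by rewrite mulN1r normrN.
Qed.

Lemma Josc_seqcvg (u : V -> V -> R) p (x_ e_ : nat -> V) (x e : V) :
  sbd (fun x t => W x * W t) u ->
  (forall (y_ : nat -> V) (y : V), y_ n @[n --> \oo] --> y -> u (x_ n) (y_ n) @[n --> \oo] --> u x y) ->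
  e_ n @[n --> \oo] --> e ->
  Josc (u (x_ n)) (e_ n) p @[n --> \oo] --> Josc (u x) e p.
Proof.
move=> su hu he; have [C bC] := su.2 [::].
have C0 : 0 <= C.
  by have := le_trans (normr_ge0 _) (bC 0 0); rewrite pmulr_lge0// mulr_gt0// W_gt0.
have cc x' e' : continuous (fun t => u x' t * cos (dotv e' t + p)).
  by have [] := @dom_osc (u x') e' p (sbd_dom x' su).
apply: (@Rint_cvg _ _ (fun n t => u (x_ n) t * cos (dotv (e_ n) t + p)) _ C) => //.
- move=> n t; rewrite normrM (@le_trans _ _ (C * (W (x_ n) * W t)))//.
    by apply: (le_trans _ (bC _ t)); rewrite ler_piMr// ler_norml cos_geN1 cos_le1.
  by rewrite ler_wpM2l// ler_piMl ?W_le1// ltW// W_gt0.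
- move=> y_ y hy; apply: cvgM; first exact: hu.
  apply: (cvg_comp (fun n => dotv (e_ n) (y_ n) + p) cos); last exact: continuous_cos.
  apply: cvgD; last exact: cvg_cst.
  exact: cvg_dotv.
Qed.

(** By joint sequential continuity: otherwise points converging to [(x0, e0)] would have modulus
    below half of the limit value. *)
Lemma Astft_lower x0 e0 : Astft g gam x0 e0 != 0 ->
  exists2 r, 0 < r & exists2 c, 0 < c & forall x e : V,
   (forall j, `|x 0 j - x0 0 j| <= r) -> (forall j, `|e 0 j - e0 0 j| <= r) -> c <= cmod (Astft g gam x e).
Proof.
move=> A0.
have c0 : 0 < cmod (Astft g gam x0 e0).
  rewrite lt_neqAle cmod_ge0 andbT eq_sym; apply: contra A0.
  by rewrite cmodE => /eqP/Normc.eq0_normc ->.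
apply: contrapT => hn.
have /choice[z hz] : forall n : nat, exists z : V * V, [/\ forall j, `|z.1 0 j - x0 0 j| <= n.+1%:R^-1,
   forall j, `|z.2 0 j - e0 0 j| <= n.+1%:R^-1 & cmod (Astft g gam z.1 z.2) < cmod (Astft g gam x0 e0) / 2].
  move=> n; apply: contrapT => hn2; apply: hn; exists n.+1%:R^-1; first by rewrite invr_gt0.
  exists (cmod (Astft g gam x0 e0) / 2); first by rewrite divr_gt0.
  move=> x e hx he; rewrite leNgt; apply/negP => h; apply: hn2; by exists (x, e).
have hc (y_ : nat -> V) (y : V) : (forall n j, `|y_ n 0 j - y 0 j| <= n.+1%:R^-1) -> y_ n @[n --> \oo] --> y.
  move=> h; apply: cvg_rV => j; apply/cvgrPdist_le => e eg0; near=> n.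
  rewrite distrC (le_trans (h n j))// ltW//; near: n.
  exact: near_infty_natSinv_lt (PosNum eg0).
have hx : (z n).1 @[n --> \oo] --> x0 by apply: hc => n; have [] := hz n.
have he : (z n).2 @[n --> \oo] --> e0 by apply: hc => n; have [] := hz n.
have hu (c : V -> R) : continuous c -> forall (y_ : nat -> V) (y : V), y_ n @[n --> \oo] --> y ->
    g (y_ n) * c (y_ n - (z n).1) @[n --> \oo] --> g y * c (y - x0).
  move=> cc y_ y hy; apply: cvgM.
    have cg : continuous g by exact: smooth_continuous (sg.1 tt).
    exact: (cvg_comp _ _ hy (cg y)).
  by apply: (cvg_comp (fun n => y_ n - (z n).1) c _ (cc (y - x0))); exact: cvgB.
have c1 : continuous g1 by exact: smooth_continuous (sgam.1.1).
have c2 : continuous g2 by exact: smooth_continuous (sgam.1.2).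
have J1 p := @Josc_seqcvg _ p _ _ _ _ s1 (hu _ c1) he.
have J2 p := @Josc_seqcvg _ p _ _ _ _ s2 (hu _ c2) he.
have hre : cre (Astft g gam (z n).1 (z n).2) @[n --> \oo] --> cre (Astft g gam x0 e0).
  under eq_cvg do rewrite Astft_re; rewrite Astft_re; by apply: cvgD; [exact: J1|exact: J2].
have him : cim (Astft g gam (z n).1 (z n).2) @[n --> \oo] --> cim (Astft g gam x0 e0).
  under eq_cvg do rewrite Astft_im; rewrite Astft_im; apply: cvgD; first exact: J1.
  by apply: cvgM; [exact: cvg_cst|exact: J2].
have hm : cmod (Astft g gam (z n).1 (z n).2) @[n --> \oo] --> cmod (Astft g gam x0 e0).
  apply: (cvg_comp (fun n => cre (Astft g gam (z n).1 (z n).2) ^+ 2 + cim (Astft g gam (z n).1 (z n).2) ^+ 2) Num.sqrt);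
    last exact: sqrt_continuous.
  by rewrite !expr2; under eq_cvg do rewrite !expr2; apply: cvgD; apply: cvgM.
have : cmod (Astft g gam x0 e0) <= cmod (Astft g gam x0 e0) / 2.
  rewrite -(cvg_lim (@Rhausdorff R) hm); apply: limr_le; first by apply/cvg_ex; exists (cmod (Astft g gam x0 e0)).
  by apply: nearW => n; rewrite (cvg_lim (@Rhausdorff R) hm) ltW//; have [] := hz n.
lra.
Unshelve. all: by end_near. Qed.

End window.
End oscillatory_integrals.

(** * Gaussians *)

Section gaussian_line.
Context {R : realType}.
Notation mu := (@lebesgue_measure R).

Lemma segment_lipschitz (f df : R -> R) (a b K : R) : a <= b ->
  (forall x : R, is_derive x 1 f (df x)) -> (forall x, a <= x <= b -> `|df x| <= K) ->
  `|f b - f a| <= K * (b - a).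
Proof.
move=> ab d bd; have [|c] := MVT_segment ab (fun x _ => d x).
  apply: continuous_subspaceT => t; apply: differentiable_continuous.
  by apply/derivable1_diffP; have [] := d t.
rewrite in_itv/= => cab ->; rewrite normrM [`|b - a|]ger0_norm ?subr_ge0//.
by rewrite ler_wpM2r ?subr_ge0// bd.
Qed.

(** A remainder of second order comes directly out of Taylor bounds. This serves both
    differentiation under an integral and the flat function at the origin. *)
Lemma is_derive_quadratic (f : R -> R) (s D C : R) :
  (forall h, `|f (s + h) - f s - h * D| <= C * h ^+ 2) -> is_derive s 1 f D.
Proof.
move=> H; have C0 : 0 <= C by have := le_trans (normr_ge0 _) (H 1); rewrite expr1n mulr1.
suff h : h^-1 *: ((f \o shift s) (h *: (1 : R)) - f s) @[h --> 0^'] --> D.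
  by split; [apply/cvg_ex; exists D|exact: (cvg_lim (@Rhausdorff R) h)].
apply/cvgrPdist_le => e e0; near=> h.
have h0 : h != 0 by near: h; exact: nbhs_dnbhs_neq.
rewrite distrC /= scaler1 [h + s]addrC.
have -> : h^-1 *: (f (s + h) - f s) - D = h^-1 * (f (s + h) - f s - h * D).
  by rewrite /GRing.scale /= [RHS]mulrBr mulKf.
rewrite normrM normfV mulrC ler_pdivrMr ?normr_gt0//.
rewrite (le_trans (H h))// -real_normK ?num_real// expr2 mulrA ler_wpM2r//.
have : `|h| <= e / (C + 1).
  near: h; apply: dnbhs0_le; rewrite divr_gt0//; lra.
rewrite ler_pdivlMr; last lra.
by rewrite mulrDr mulr1 mulrC => hh; rewrite (le_trans _ hh)// lerDl.
Unshelve. all: by end_near. Qed.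

Lemma is_derive_sinD (y t : R) : is_derive t 1 (fun u => sin (y + u)) (cos (y + t)).
Proof.
have h1 : is_derive t 1 (fun u : R => y + u) 1.
  have h : is_derive t 1 (cst y + (id : R -> R)) (0 + 1) by apply: is_deriveD.
  by apply: (is_derive_eq h); rewrite add0r.
have h2 := @is_derive1_comp R sin (fun u => y + u) t _ _ (is_derive_sin _) h1.
by apply: (is_derive_eq h2); rewrite mulr1.
Qed.

Lemma is_derive_cosD1 (y t : R) : is_derive t 1 (fun u => cos (y + u)) (- sin (y + t)).
Proof.
have h1 : is_derive t 1 (fun u : R => y + u) 1.
  have h : is_derive t 1 (cst y + (id : R -> R)) (0 + 1) by apply: is_deriveD.
  by apply: (is_derive_eq h); rewrite add0r.
have h2 := @is_derive1_comp R cos (fun u => y + u) t _ _ (is_derive_cos _) h1.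
by apply: (is_derive_eq h2); rewrite mulr1.
Qed.

Lemma sin_lip0 (y d : R) : 0 <= d -> `|sin (y + d) - sin y| <= d.
Proof.
move=> d0; have := @segment_lipschitz _ _ 0 d 1 d0 (is_derive_sinD y).
rewrite addr0 subr0 mul1r; apply => x _; by rewrite ler_norml cos_geN1 cos_le1.
Qed.

Lemma cos_taylor (y d : R) : `|cos (y + d) - cos y + d * sin y| <= d ^+ 2.
Proof.
have pos (z e : R) : 0 <= e -> `|cos (z + e) - cos z + e * sin z| <= e ^+ 2.
  move=> e0; pose F := (fun u : R => cos (z + u)) + (sin z \*: (id : R -> R)).
  have dF (x : R) : is_derive x 1 F (- sin (z + x) + sin z *: 1).
    by apply: is_deriveD; exact: is_derive_cosD1.
  have := @segment_lipschitz F _ 0 e e e0 dF.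
  have E u : F u = cos (z + u) + sin z * u by [].
  rewrite !E addr0 mulr0 addr0 subr0 -expr2 [e * _]mulrC addrAC; apply => x /andP[x0 xe].
  rewrite /GRing.scale /= mulr1 -normrN opprD opprK; apply: le_trans xe; exact: sin_lip0.
have [d0|d0] := leP 0 d; first exact: pos.
have := pos (- y) (- d); rewrite oppr_ge0 ltW// => /(_ isT).
by rewrite -opprD !cosN sinN mulrNN sqrrN.
Qed.

(* Unnormalized density [exp (- a t^2 / 2)]; [gsd a l] is its [l]-th derivative. *)
Definition gs (a t : R) : R := expR (- (a / 2 * t ^+ 2)).

Lemma gs_gt0 a t : 0 < gs a t. Proof. exact: expR_gt0. Qed.

(** The inequality [1 + b t^2 <= exp (b t^2)] with [b = a / (2 M)] becomes, in the power [M], a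
    lower bound for [exp (a t^2 / 2)]. *)
Lemma gs_bound a M : 0 < a -> exists2 C, 0 <= C & forall t, gs a t <= C * w1 t ^+ M.
Proof.
move=> a0; have [->|M0] := posnP M.
  exists 1 => // t; rewrite expr0 mulr1 /gs -expR0 ler_expR oppr_le0 mulr_ge0 ?sqr_ge0//.
  by rewrite divr_ge0// ltW.
have M0' : 0 < M%:R :> R by rewrite ltr0n.
pose b := a / 2 / M%:R; have b0 : 0 < b by rewrite !divr_gt0.
pose c := 1 + b^-1; have c0 : 0 < c by rewrite addr_gt0 ?invr_gt0.
have H t : 1 + t ^+ 2 <= c * expR (b * t ^+ 2).
  apply: (@le_trans _ _ (c * (1 + b * t ^+ 2))); last by rewrite ler_wpM2l ?(ltW c0)// expR_ge1Dx.
  rewrite (_ : c * _ = 1 + b^-1 + b * t ^+ 2 + b^-1 * b * t ^+ 2); last by rewrite /c; ring.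
  have bi : 0 < b^-1 by rewrite invr_gt0.
  by rewrite mulVf ?gt_eqF// mul1r; have := mulr_ge0 (ltW b0) (sqr_ge0 t); lra.
exists (c ^+ M); first by rewrite exprn_ge0// ltW.
move=> t; rewrite /w1 exprVn ler_pdivlMr; last by rewrite exprn_gt0// ltr_wpDr// sqr_ge0.
rewrite /gs expRN mulrC ler_pdivrMr ?expR_gt0//.
have -> : expR (a / 2 * t ^+ 2) = expR (b * t ^+ 2) ^+ M.
  have e : M%:R * b = a / 2 by rewrite /b mulrC divfK// gt_eqF.
  by rewrite -[RHS]expRM_natl [M%:R * _]mulrA e.
rewrite -exprMn; apply: lerXn2r; rewrite ?nnegrE ?mulr_ge0 ?expR_ge0 ?(ltW c0)//.
by rewrite addr_ge0// sqr_ge0.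
Qed.

Lemma is_derive_gs (a t : R) : is_derive t 1 (gs a) (- (a * t) * gs a t).
Proof.
have h1 : is_derive t 1 (fun u : R => - (a / 2 * u ^+ 2)) (- (a * t)).
  have h : is_derive t 1 ((- (a / 2)) \*: ((id : R -> R) ^+ 2)) (- (a / 2) *: (2%:R * t ^+ 1 *: (1 : R))).
    apply: is_deriveZ; exact: (is_deriveX 2 (is_derive_id _ _)).
  rewrite (_ : (fun u => _) = (- (a / 2)) \*: ((id : R -> R) ^+ 2)); last first.
    by apply/funext => u; rewrite /= /GRing.scale/= mulNr.
  by apply: (is_derive_eq h); rewrite /GRing.scale /= expr1; field.
have h2 := @is_derive1_comp R expR _ t _ _ (is_derive_expR _) h1.
by apply: (is_derive_eq h2); rewrite mulrC.
Qed.

(** The Hermite polynomials, up to sign and scaling. *)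
Fixpoint gsp (a : R) (l : nat) : {poly R} :=
  if l is l'.+1 then (gsp a l')^`() - (a *: 'X) * gsp a l' else 1.

Definition gsd a l t := (gsp a l).[t] * gs a t.

Lemma is_derive_gsd (a : R) l (t : R) : is_derive t 1 (gsd a l) (gsd a l.+1 t).
Proof.
have h := is_deriveM (is_derive_poly (gsp a l) t) (is_derive_gs a t).
apply: (is_derive_eq h); rewrite /gsd /= !hornerE /GRing.scale /=; ring.
Qed.

Lemma poly_bound (p : {poly R}) : exists2 C, 0 <= C & forall t, `|p.[t]| <= C * (1 + t ^+ 2) ^+ size p.
Proof.
exists (\sum_(i < size p) `|p`_i|); first by rewrite sumr_ge0.
move=> t; rewrite horner_coef (le_trans (ler_norm_sum _ _ _))// mulr_suml.
apply: ler_sum => i _; rewrite normrM normrX ler_wpM2l//.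
have t1 : 1 <= 1 + t ^+ 2 by rewrite lerDl sqr_ge0.
have tt : `|t| <= 1 + t ^+ 2.
  rewrite -real_normK ?num_real//; have := sqr_ge0 (`|t| - 1/2); rewrite !expr2; lra.
apply: (@le_trans _ _ ((1 + t ^+ 2) ^+ i)); last by rewrite ler_weXn2l// ltnW.
by apply: lerXn2r; rewrite ?nnegrE// (le_trans _ t1).
Qed.

Lemma gsd_bound a l M : 0 < a -> exists2 C, 0 <= C & forall t, `|gsd a l t| <= C * w1 t ^+ M.
Proof.
move=> a0; have [C1 C10 b1] := poly_bound (gsp a l).
have [C2 C20 b2] := gs_bound (M + size (gsp a l)) a0.
exists (C1 * C2); first by rewrite mulr_ge0.
move=> t; rewrite normrM [`|gs a t|]ger0_norm ?(ltW (gs_gt0 _ _))//.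
rewrite (le_trans (ler_pM _ _ (b1 t) (b2 t)))// ?(ltW (gs_gt0 _ _))//.
rewrite exprD mulrACA ler_wpM2l ?mulr_ge0// mulrCA -exprMn divff ?expr1n ?mulr1//.
by rewrite gt_eqF// ltr_wpDr// sqr_ge0.
Qed.

Lemma gs_continuous a : continuous (gs a).
Proof.
move=> t; apply: differentiable_continuous; apply/derivable1_diffP.
by have [] := is_derive_gs a t.
Qed.

Lemma gs_integral_gt0 a : 0 < a -> 0 < \int[mu]_t gs a t.
Proof.
move=> a0; have [C C0 b] := gs_bound 1 a0.
have ig : mu.-integrable setT (EFin \o gs a).
  apply: (@continuous_w1_integrable _ _ C); first exact: gs_continuous.
  by move=> t; rewrite ger0_norm ?(ltW (gs_gt0 _ _))//; have := b t; rewrite expr1.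
suff : (0 < \int[mu]_t (gs a t)%:E)%E.
  by move=> h; rewrite -lte_fin /Rintegral fineK//; exact: integrable_fin_num.
apply: (@lt_le_trans _ _ (\int[mu]_(t in `[0%R, 1%R]) (expR (- (a / 2)))%:E)%E).
  by rewrite integral_cst//= lebesgue_measure_itv/= lte01 sube0 mule1 lte_fin expR_gt0.
apply: (@le_trans _ _ (\int[mu]_(t in `[0%R, 1%R]) (gs a t)%:E)%E).
  apply: ge0_le_integral => //.
  - apply/measurable_EFinP; apply: measurable_funTS.
    by apply: continuous_measurable_fun; exact: gs_continuous.
  - move=> t /=; rewrite in_itv/= => /andP[t0 t1]; rewrite lee_fin ler_expR lerN2.
    rewrite ler_piMr//; last by rewrite expr_le1.
    by rewrite divr_ge0// ltW.
apply: (@ge0_subset_integral _ _ _ mu `[0%R, 1%R] setT _ _ (EFin \o gs a)) => //.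
- apply/measurable_EFinP; apply: continuous_measurable_fun; exact: gs_continuous.
- by move=> t _; rewrite lee_fin ltW// gs_gt0.
Qed.

End gaussian_line.

(** * Gaussians in several variables and their Fourier transforms *)

Section gaussian_space.
Context {R : realType} {k : nat}.
Notation mu := (@lebesgue_measure R).
Notation V := 'rV[R]_k.
Implicit Types (x y eta xi om : V) (a p : R).

Lemma W_add x v : W (x + v) <= (\prod_i (2 * (1 + v 0 i ^+ 2))) * W x.
Proof.
rewrite /W -big_split /=; apply: ler_prod => i _.
by rewrite (ltW (w1_gt0 _))/= mxE w1_peetre.
Qed.

Lemma dom_shift (F : V -> R) v : dom F -> dom (fun x => F (x + v)).
Proof.
move=> [cF [C bF]]; split; first exact: (cts_comp (@cts_addcst _ _ v) cF).
exists (C * \prod_i (2 * (1 + v 0 i ^+ 2))) => x.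
by rewrite (le_trans (bF _))// -mulrA ler_wpM2l ?(dom_bound_ge0 bF)// W_add.
Qed.

Lemma Rint_translate (F : V -> R) v : dom F -> Rint (fun x => F (x + v)) = Rint F.
Proof.
move=> dF; have -> : v = \sum_(i <- enum 'I_k) v 0 i *: unitv i.
  by rewrite big_enum -row_sum_delta.
elim: (enum 'I_k) => [|i r IH].
  by apply: eq_Rint => x; rewrite big_nil addr0.
rewrite -[RHS]IH -[RHS](Rint_shift i (v 0 i)); last exact: (dom_shift _ dF).
by apply: eq_Rint => x; rewrite big_cons addrA.
Qed.

Lemma Cint_translate (F : V -> R[i]) v : domc F -> Cint (fun x => F (x + v)) = Cint F.
Proof.
move=> [d1 d2]; apply: complex_ext; rewrite ?creCint ?cimCint.
  exact: (Rint_translate v d1).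
exact: (Rint_translate v d2).
Qed.

Definition gauss a x : R := \prod_i gs a (x 0 i).

Lemma gsd0 a t : gsd a 0 t = gs a t.
Proof. by rewrite /gsd /= hornerE mul1r. Qed.

Lemma gaussE a : gauss a = (fun x : V => \prod_i gsd a 0 (x 0 i)).
Proof. by apply/funext => x; apply: eq_bigr => i _; rewrite gsd0. Qed.

Lemma pderiv_gauss a s : pderiv s (gauss a) = (fun x : V => \prod_i gsd a (count_mem i s) (x 0 i)).
Proof.
by rewrite gaussE (pderiv_tensor (phi := fun _ => gsd a) (fun (_ : 'I_k) l t => is_derive_gsd a l t)).
Qed.

Lemma gauss_exp a x : gauss a x = expR (- (a / 2 * dotv x x)).
Proof.
rewrite /gauss /dotv mulr_sumr -sumrN expR_sum.
by apply: eq_bigr => i _; rewrite /gs expr2.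
Qed.

Lemma gauss_gt0 a x : 0 < gauss a x.
Proof. by rewrite gauss_exp expR_gt0. Qed.

Lemma gaussN a x : gauss a (- x) = gauss a x.
Proof. by rewrite !gauss_exp dotvNl dotvC dotvNl opprK. Qed.

Lemma gauss_sbd a M : 0 < a -> sbd (fun (_ : unit) x => W x ^+ M) (fun _ => gauss a).
Proof.
move=> a0; split=> [_|s].
  by rewrite gaussE; apply: (@smooth_tensor _ _ (fun _ => gsd a)) => i l t; exact: is_derive_gsd.
have /choice[C hC] : forall l, exists C, 0 <= C /\ forall t, `|gsd a l t| <= C * w1 t ^+ M.
  by move=> l; have [C C0 h] := gsd_bound l M a0; exists C.
exists (\prod_(i < k) C (count_mem i s)) => _ x.
rewrite pderiv_gauss.
rewrite normr_prod /W -prodrXl -big_split /=; apply: ler_prod => i _.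
by rewrite normr_ge0 /=; have [_] := hC (count_mem i s); exact.
Qed.

Lemma gauss_bound a M : 0 < a -> exists2 C, 0 <= C & forall x, gauss a x <= C * W x ^+ M.
Proof.
move=> /(gauss_sbd M)[_ /(_ [::])[C hC]]; exists C.
  have := le_trans (normr_ge0 _) (hC tt 0); rewrite pmulr_lge0// exprn_gt0// W_gt0 //.
by move=> x; have := hC tt x; rewrite /= ger0_norm// ltW// gauss_gt0.
Qed.

Lemma gauss_smooth a : 0 < a -> smooth (gauss a).
Proof. by move=> /(gauss_sbd 1)[/(_ tt)]. Qed.

Lemma gauss_continuous a : 0 < a -> continuous (gauss a).
Proof. by move=> /gauss_smooth /smooth_continuous. Qed.

Lemma gauss_dom a : 0 < a -> dom (gauss a).
Proof.
move=> a0; split; first exact: gauss_continuous.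
have [C _ h] := gauss_bound 1 a0; exists C => x.
by rewrite ger0_norm ?(ltW (gauss_gt0 _ _))//; have := h x; rewrite expr1.
Qed.

Lemma gauss_derive a i : 0 < a -> pderiv [:: i] (gauss a) = (fun x => - a * (x 0 i * gauss a x)).
Proof.
move=> a0; rewrite pderiv_gauss gaussE.
apply/funext => x; rewrite (bigD1 i)//= [in RHS](bigD1 i)//= eqxx addn0.
have -> : gsd a 1 (x 0 i) = - a * (x 0 i * gsd a 0 (x 0 i)).
  by rewrite gsd0 /gsd /= -polyC1 derivC !hornerE /=; ring.
rewrite -!mulrA; congr (_ * (_ * (_ * _))).
by congr (_ * _); apply: eq_bigr => j ji; rewrite eq_sym (negbTE ji).
Qed.

Lemma coord_W x i : `|x 0 i| <= (W x)^-1.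
Proof.
rewrite /W -prodfV (bigD1 i)//= /w1 invrK -[leLHS]mulr1; apply: ler_pM => //.
  rewrite -real_normK ?num_real//; have := sqr_ge0 (`|x 0 i| - 1/2); rewrite !expr2; lra.
apply: (big_ind (fun z : R => 1 <= z)) => //; first exact: mulr_ege1.
by move=> j _; rewrite invrK lerDl sqr_ge0.
Qed.

Lemma dotv_W eta x : `|dotv eta x| <= (\sum_j `|eta 0 j|) * (W x)^-1.
Proof.
rewrite /dotv mulr_suml (le_trans (ler_norm_sum _ _ _))//; apply: ler_sum => j _.
by rewrite normrM ler_wpM2l// coord_W.
Qed.

Lemma coord_gauss_dom a i : 0 < a -> dom (fun x => x 0 i * gauss a x).
Proof.
move=> a0; split.
  by apply: ctsM; [exact: continuous_coord|exact: gauss_continuous].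
have [C C0 h] := gauss_bound 2 a0; exists C => x.
rewrite normrM [`|gauss a x|]ger0_norm ?(ltW (gauss_gt0 _ _))//.
rewrite (le_trans (ler_pM _ _ (coord_W x i) (h x)))// ?(ltW (gauss_gt0 _ _))//.
by rewrite expr2 mulrCA mulKf// gt_eqF// W_gt0.
Qed.

(** [x_i] times the Gaussian is [- 1 / a] times its [i]-th derivative, so a coordinate factor is
    removed by integration by parts. *)
Lemma Josc_coord_gauss a i eta p : 0 < a ->
  Josc (fun x => x 0 i * gauss a x) eta p = eta 0 i / a * Josc (gauss a) eta (p + pi / 2).
Proof.
move=> a0; have := @Josc_parts R k (gauss a) eta p i (gauss_smooth a0) _.
have b s : exists C : R, forall t : V, `|pderiv s (gauss a) t| <= C * W t.
  by have [_ /(_ s)[C h]] := gauss_sbd 1 a0; exists C => t; have := h tt t; rewrite expr1.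
move=> /(_ b); rewrite gauss_derive//.
have -> : Josc (fun x => - a * (x 0 i * gauss a x)) eta p = - a * Josc (fun x => x 0 i * gauss a x) eta p.
  rewrite /Josc -RintZ; last exact: (dom_osc _ _ (coord_gauss_dom i a0)).
  by apply: eq_Rint => t; ring.
move=> h; have : a * Josc (fun x : V => x 0 i * gauss a x) eta p = eta 0 i * Josc (gauss a) eta (p + pi / 2).
  by apply: oppr_inj; rewrite -!mulNr; exact: h.
by move=> h2; rewrite mulrAC -h2 mulrC mulrA mulVf ?mul1r// gt_eqF.
Qed.

(** Differentiation under the integral brings down the coordinates of the integration variable;
    [Josc_coord_gauss] turns each into [s eta_j / a]. Two phase shifts by [pi / 2] add up to the
    minus sign. *)
Lemma Josc_line_derive a eta p (s : R) : 0 < a ->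
  is_derive s 1 (fun s : R => Josc (gauss a) (s *: eta) p)
    (- (dotv eta eta / a * s) * Josc (gauss a) (s *: eta) p).
Proof.
move=> a0; pose D := - (dotv eta eta / a * s) * Josc (gauss a) (s *: eta) p.
have dg := gauss_dom a0.
have DE : D = \sum_j eta 0 j * Josc (fun x => x 0 j * gauss a x) (s *: eta) (p + pi / 2).
  rewrite /D (eq_bigr (fun j => (eta 0 j * eta 0 j) * (s / a * - Josc (gauss a) (s *: eta) p))).
    by rewrite -mulr_suml -/(dotv eta eta); ring.
  move=> j _; rewrite Josc_coord_gauss// !mxE.
  have -> : Josc (gauss a) (s *: eta) (p + pi / 2 + pi / 2) = - Josc (gauss a) (s *: eta) p.
    rewrite -mulN1r /Josc -RintZ; last exact: dom_osc.
    by apply: eq_Rint => t; rewrite addrA addrA cosDpihalf2; ring.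
  by ring.
(* Two powers of [W] absorb the square of [dotv eta t] in the Taylor remainder, the third makes it
   integrable. *)
have [C C0 hC] := gauss_bound 3 a0.
pose B := \sum_j `|eta 0 j|.
have ds i : dom (fun t => (t 0 i * gauss a t) * cos (dotv (s *: eta) t + (p + pi / 2))).
  exact: (dom_osc _ _ (coord_gauss_dom i a0)).
apply: (@is_derive_quadratic _ _ _ _ (C * B ^+ 2 * Iw ^+ k)) => h.
rewrite -/D DE.
have -> : Josc (gauss a) ((s + h) *: eta) p - Josc (gauss a) (s *: eta) p -
    h * (\sum_j eta 0 j * Josc (fun x => x 0 j * gauss a x) (s *: eta) (p + pi / 2)) =
  Rint (fun t => gauss a t * (cos (dotv (s *: eta) t + p + h * dotv eta t) - cos (dotv (s *: eta) t + p)
     + h * dotv eta t * sin (dotv (s *: eta) t + p))).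
  rewrite mulr_sumr.
  rewrite (eq_bigr (fun j => Rint (fun t => h * (eta 0 j *
    ((t 0 j * gauss a t) * cos (dotv (s *: eta) t + (p + pi / 2))))))); last first.
    by move=> j _; rewrite [RHS]RintZ; [rewrite RintZ|apply: domZ].
  rewrite -Rint_sum; last by move=> j; do 2 apply: domZ; exact: ds.
  have eN F : dom F -> - Rint F = Rint (fun t : V => -1 * F t) by move=> dF; rewrite RintZ// mulN1r.
  rewrite /Josc (eN _ (dom_osc _ _ dg)) eN; last by apply: dom_sum => j; do 2 apply: domZ; exact: ds.
  have d1 : dom (fun t => gauss a t * cos (dotv ((s + h) *: eta) t + p)) by exact: dom_osc.
  have d2 : dom (fun t => -1 * (gauss a t * cos (dotv (s *: eta) t + p))) by apply: domZ; exact: dom_osc.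
  rewrite -RintD// -RintD; last 2 first.
  - exact: domD.
  - by apply: domZ; apply: dom_sum => j; do 2 apply: domZ; exact: ds.
  apply: eq_Rint => t.
  have -> : dotv ((s + h) *: eta) t + p = dotv (s *: eta) t + p + h * dotv eta t.
    rewrite scalerDl dotvDl addrAC; congr (_ + _).
    by rewrite /dotv mulr_sumr; apply: eq_bigr => j _; rewrite mxE mulrA.
  rewrite (eq_bigr (fun j => (eta 0 j * t 0 j) * (h * gauss a t * - sin (dotv (s *: eta) t + p)))); last first.
    by move=> j _; rewrite addrA cosDpihalf; ring.
  by rewrite -mulr_suml -/(dotv eta t); ring.
rewrite (_ : C * B ^+ 2 * Iw ^+ k * h ^+ 2 = C * B ^+ 2 * h ^+ 2 * Iw ^+ k); last by ring.
have cdot e : continuous (fun t : V => dotv e t) by exact: continuous_dotv.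
have csin e : continuous (fun t : V => dotv e t + p) by apply: ctsD => //; exact: ctsC.
apply: Rint_bound.
  apply: ctsM; first exact: gauss_continuous.
  apply: ctsD; first apply: ctsD.
  - apply: (cts_comp (f := fun t : V => dotv (s *: eta) t + p + h * dotv eta t)); last exact: continuous_cos.
    by apply: ctsD => //; apply: ctsM => //; exact: ctsC.
  - by apply: ctsN; apply: (cts_comp (csin _)); exact: continuous_cos.
  - apply: ctsM; first by apply: ctsM => //; exact: ctsC.
    by apply: (cts_comp (csin _)); exact: continuous_sin.
move=> t; rewrite normrM [`|gauss a t|]ger0_norm ?(ltW (gauss_gt0 _ _))//.
have W0 := W_gt0 t.
have hb : (h * dotv eta t) ^+ 2 <= h ^+ 2 * (B ^+ 2 * (W t)^-1 ^+ 2).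
  rewrite exprMn ler_wpM2l ?sqr_ge0// -exprMn -[leLHS]real_normK ?num_real//.
  apply: lerXn2r; rewrite ?nnegrE//; last exact: dotv_W.
  by rewrite mulr_ge0 ?invr_ge0 ?(ltW W0)// sumr_ge0.
have ht := le_trans (cos_taylor (dotv (s *: eta) t + p) (h * dotv eta t)) hb.
rewrite (le_trans (ler_pM (ltW (gauss_gt0 _ _)) (normr_ge0 _) (hC t) ht))//.
rewrite le_eqVlt; apply/orP; left; apply/eqP.
have : W t * (W t)^-1 = 1 by rewrite divff// gt_eqF.
by move: (W t)^-1 => z hz; transitivity (C * B ^+ 2 * h ^+ 2 * (W t * (W t * z) ^+ 2)); [ring|rewrite hz; ring].
Qed.

Definition cgauss a : R := Rint (gauss a).

(* Along the line [s eta] the integral satisfies [J' = - (|eta|^2 / a) s J]. *)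
Lemma Josc_gauss a eta p : 0 < a ->
  Josc (gauss a) eta p = cgauss a * gauss a^-1 eta * cos p.
Proof.
move=> a0; pose b := dotv eta eta / a.
(* [gs (- b)] is the integrating factor [exp (b s^2 / 2)], so [G] is constant. *)
pose G := (fun s : R => Josc (gauss a) (s *: eta) p) * (gs (- b)).
have dG (s : R) : is_derive s 1 G 0.
  have h := is_deriveM (Josc_line_derive eta p s a0) (is_derive_gs (- b) s).
  by apply: (is_derive_eq h); rewrite /GRing.scale /= -/b; ring.
have : `|G 1 - G 0| <= 0 * (1 - 0).
  by apply: (@segment_lipschitz _ G (fun=> 0)) => // x _; rewrite normr0.
rewrite mul0r normr_le0 subr_eq0 => /eqP.
have -> : G 1 = Josc (gauss a) eta p * gs (- b) 1 by rewrite /G -[in RHS](scale1r eta).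
have -> : G 0 = Josc (gauss a) 0 p * gs (- b) 0 by rewrite /G -[in RHS](scale0r eta).
have -> : gs (- b) 0 = 1 by rewrite /gs expr0n /= mulr0 oppr0 expR0.
rewrite mulr1.
have -> : Josc (gauss a) 0 p = cos p * cgauss a.
  rewrite /cgauss -RintZ; last exact: gauss_dom.
  apply: eq_Rint => t; rewrite mulrC; congr (cos _ * _).
  by rewrite /dotv big1 ?add0r// => j _; rewrite mxE mul0r.
have -> : gs (- b) 1 = (gauss a^-1 eta)^-1.
  rewrite gauss_exp -expRN /gs expr1n; congr expR; rewrite /b; field; rewrite gt_eqF//.
have g0 : gauss a^-1 eta != 0 by rewrite gt_eqF// gauss_gt0.
by move=> h; rewrite -[LHS](divfK g0) h; ring.
Qed.

Lemma iRint_gs a s x c : 0 < a -> uniq s ->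
  iRint s (fun y => c * \prod_(i <- s) gs a (y 0 i)) x = c * (\int[mu]_t gs a t) ^+ size s.
Proof.
move=> a0; elim: s c x => [|i s IH] c x /= us; first by rewrite big_nil.
case/andP: us => is_ us.
have [C C0 b] := gs_bound 1 a0.
transitivity (\int[mu]_t ((c * (\int[mu]_t gs a t) ^+ size s) * gs a t)).
  apply: eq_Rintegral => t _; rewrite mulrAC -(IH _ (upd x i t))//.
  apply: iRint_eq_off => y hy.
  by rewrite big_cons mulrA hy// upd_id.
rewrite RintegralZl//; first by rewrite exprS; ring.
apply: (@continuous_w1_integrable _ _ C); first exact: gs_continuous.
by move=> t; rewrite ger0_norm ?(ltW (gs_gt0 _ _))//; have := b t; rewrite expr1.
Qed.

Lemma cgauss_gt0 a : 0 < a -> 0 < cgauss a.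
Proof.
move=> a0; have := @iRint_gs a (enum 'I_k) 0 1 a0 (enum_uniq _).
rewrite mul1r => h; rewrite /cgauss /Rint.
rewrite (_ : iRint _ _ _ = (\int[mu]_t gs a t) ^+ size (enum 'I_k)).
  by rewrite exprn_gt0// gs_integral_gt0.
rewrite -h; congr (iRint _ _ _); apply/funext => y.
by rewrite mul1r big_enum.
Qed.

Definition mode a om x : R[i] := cexp (dotv om x) * (gauss a x)%:C%C.

Lemma cosBpihalf (t : R) : cos (t - pi / 2) = sin t.
Proof. by rewrite -[in RHS](subrK (pi / 2) t) sinDpihalf. Qed.

Lemma Cint_mode a om : 0 < a -> Cint (mode a om) = (cgauss a * gauss a^-1 om)%:C%C.
Proof.
move=> a0; apply: complex_ext; rewrite ?creCint ?cimCint ?cre_real ?cim_real.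
  transitivity (Josc (gauss a) om 0).
    by apply: eq_Rint => t; rewrite creM cre_real cim_real mulr0 subr0 addr0 mulrC.
  by rewrite Josc_gauss// cos0 mulr1.
transitivity (Josc (gauss a) om (- (pi / 2))).
  by apply: eq_Rint => t; rewrite cimM cre_real cim_real mulr0 add0r cosBpihalf mulrC.
by rewrite Josc_gauss// cosN cos_pihalf mulr0.
Qed.

Lemma mode_domc a om : 0 < a -> domc (mode a om).
Proof.
move=> a0; have [cg [C bg]] := gauss_dom a0; apply/domcP; split.
  by apply: ccontM; [apply: ccont_cexp; exact: continuous_dotv|exact: ccont_real].
by exists C => x; rewrite cmodM cmod_cexp mul1r cmod_real.
Qed.

Lemma fourier_mode a om xi : 0 < a ->
  fourier (mode a om) xi = (cgauss a * gauss a^-1 (xi - om))%:C%C.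
Proof.
move=> a0; rewrite -(gaussN _ (xi - om)) opprB -Cint_mode//.
by apply: eq_Cint => x; rewrite /mode mulrA -cexpD dotvDl dotvNl addrC.
Qed.

(** After translation by [om] both transforms are explicit Gaussian integrals. The constant is kept
    as a product of two such integrals, which is visibly positive. *)
Lemma fourier_inv_mode a om x : 0 < a ->
  Cint (fun xi => cexp (dotv x xi) * fourier (mode a om) xi) =
  (cgauss a * cgauss a^-1)%:C%C * mode a om x.
Proof.
move=> a0; have a0' : 0 < a^-1 by rewrite invr_gt0.
rewrite -(@Cint_translate _ om); last first.
  rewrite (_ : (fun xi => _) = fun xi => (cgauss a)%:C%C * (mode a^-1 x (xi - om) * cexp (dotv x om))).
    apply: domcZ; apply: (@domc_mul_bounded _ _ _ _ 1).
    - by split; [exact: (dom_shift _ (mode_domc x a0').1)|exact: (dom_shift _ (mode_domc x a0').2)].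
    - exact: ccont_cst.
    - by move=> y; rewrite cmod_cexp.
  apply/funext => xi; rewrite fourier_mode// rmorphM /mode mulrCA; congr (_ * _).
  rewrite -mulrA [X in _ = _ * X]mulrC mulrA -cexpD; congr (cexp _ * _).
  by rewrite [in RHS]dotvC dotvDl dotvNl dotvC [dotv om x]dotvC subrK.
transitivity (Cint (fun xi => ((cgauss a)%:C%C * cexp (dotv x om)) * mode a^-1 x xi)).
  apply: eq_Cint => xi; rewrite fourier_mode// addrK rmorphM /mode.
  have -> : dotv x (xi + om) = dotv x om + dotv x xi by rewrite dotvC dotvDl !(dotvC _ x) addrC.
  by rewrite cexpD; ring.
rewrite CintZ; last exact: mode_domc.
rewrite Cint_mode// invrK /mode (dotvC om x) !rmorphM /=; ring.
Qed.

End gaussian_space.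

(** * Rudin-Shapiro sums *)

Section rudin_shapiro.
Context {R : realType}.
Implicit Types (y p q t : R) (b : bool).

(* Coefficients of the Rudin-Shapiro polynomials: [P_(n+1) = P_n + z^(2^n) Q_n] for
   [b = false] and [Q_(n+1) = P_n - z^(2^n) Q_n] for [b = true]. *)
Fixpoint rs b n k : R :=
  if n is n'.+1 then
    if (k < 2 ^ n')%N then rs false n' k else (-1) ^+ b * rs true n' (k - 2 ^ n')%N
  else 1.

Lemma rs_sqr b n k : rs b n k ^+ 2 = 1.
Proof.
elim: n b k => [|n IH] b k /=; first by rewrite expr1n.
by case: ifP => _; rewrite ?exprMn IH// sqrr_sign mulr1.
Qed.

Lemma rs_norm b n k : `|rs b n k| = 1.
Proof.
have := rs_sqr b n k; rewrite -real_normK ?num_real// => /eqP.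
by rewrite sqrp_eq1// => /eqP.
Qed.

(** Truncation at [M] terms prepares Abel summation. The phases [0] and [pi / 2] give the real part
    and minus the imaginary part of the truncated polynomial at [exp (i y)]. *)
Definition rsT b n M y p : R := \sum_(0 <= k < M) rs b n k * cos (k%:R * y + p).

Lemma rsT_rot b n M y q : rsT b n M y q = rsT b n M y 0 * cos q + rsT b n M y (pi / 2) * sin q.
Proof.
rewrite /rsT !mulr_suml -big_split /=; apply: eq_bigr => k _.
by rewrite cosD addr0 cosDpihalf; ring.
Qed.

Lemma rsT_energy_phase b n M y q : rsT b n M y q ^+ 2 + rsT b n M y (q + pi / 2) ^+ 2 =
  rsT b n M y 0 ^+ 2 + rsT b n M y (pi / 2) ^+ 2.
Proof.
rewrite (rsT_rot _ _ _ _ q) (rsT_rot _ _ _ _ (q + _)) cosDpihalf sinDpihalf.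
have h := cos2Dsin2 q.
transitivity ((rsT b n M y 0 ^+ 2 + rsT b n M y (pi / 2) ^+ 2) * (cos q ^+ 2 + sin q ^+ 2)); first by ring.
by rewrite h mulr1.
Qed.

Lemma rsT_le b n M y p : (M <= 2 ^ n)%N -> rsT b n.+1 M y p = rsT false n M y p.
Proof.
move=> mixed_norm; apply: eq_big_nat => k /andP[_ kM] /=.
by rewrite (leq_trans kM mixed_norm).
Qed.

Lemma rsT_gt b n M y p : rsT b n.+1 (2 ^ n + M) y p =
  rsT false n (2 ^ n) y p + (-1) ^+ b * rsT true n M y (p + (2 ^ n)%:R * y).
Proof.
rewrite /rsT (@big_cat_nat _ _ _ (2 ^ n)) ?leq_addr//=; congr (_ + _).
  by apply: eq_big_nat => k /andP[_ ->].
rewrite -{1}[(2 ^ n)%N]add0n big_addn addKn mulr_sumr; apply: eq_bigr => k _.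
rewrite ltnNge leq_addl /= addnK -mulrA; congr (_ * (_ * cos _)).
by rewrite natrD; ring.
Qed.

(* Parallelogram law: [|P_n|^2 + |Q_n|^2 = 2^(n+1)]. *)
Lemma rsT_energy n y p :
  rsT false n (2 ^ n) y p ^+ 2 + rsT false n (2 ^ n) y (p + pi / 2) ^+ 2 +
  (rsT true n (2 ^ n) y p ^+ 2 + rsT true n (2 ^ n) y (p + pi / 2) ^+ 2) = 2 * 2 ^+ n.
Proof.
elim: n p => [|n IH] p.
  rewrite /rsT expn0 !big_nat1 /= !mul1r !mul0r !add0r cosDpihalf sqrrN expr0.
  by have := cos2Dsin2 p; lra.
have e : (2 ^ n.+1 = 2 ^ n + 2 ^ n)%N by rewrite expnS mul2n addnn.
rewrite e !rsT_gt expr0 expr1 mul1r !mulN1r.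
have -> : p + pi / 2 + (2 ^ n)%:R * y = p + (2 ^ n)%:R * y + pi / 2 by rewrite addrAC.
have h0 := rsT_energy_phase false n (2 ^ n) y p.
have h0' := rsT_energy_phase false n (2 ^ n) y 0.
have h1 := rsT_energy_phase true n (2 ^ n) y (p + (2 ^ n)%:R * y).
have := IH 0; rewrite add0r [2 ^+ n.+1]exprS.
move: h0 h1.
set a := rsT _ _ _ _ p; set a' := rsT _ _ _ _ (p + pi / 2).
set c := rsT true _ _ _ (p + _); set c' := rsT true _ _ _ (p + _ + pi / 2).
set u := rsT _ _ _ _ 0 ^+ 2 + _; set v := rsT true _ _ _ 0 ^+ 2 + _ => hu hv huv.
transitivity (2 * (a ^+ 2 + a' ^+ 2) + 2 * (c ^+ 2 + c' ^+ 2)); first by ring.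
by rewrite hu hv -huv; ring.
Qed.

Definition r2 : R := Num.sqrt 2.

Lemma r2_sqr : r2 ^+ 2 = 2. Proof. by rewrite sqr_sqrtr. Qed.
Lemma r2_gt0 : 0 < r2. Proof. by rewrite sqrtr_gt0. Qed.
Lemma r2_ge : 5 / 4 <= r2.
Proof.
have h : 0 <= 5 / 4 :> R by rewrite divr_ge0.
by rewrite -[leLHS](ger0_norm h) -sqrtr_sqr ler_wsqrtr// expr2; lra.
Qed.

Lemma rsT_full b n y p : `|rsT b n (2 ^ n) y p| <= r2 ^+ n.+1.
Proof.
rewrite -(@ler_pXn2r _ 2)// ?nnegrE ?exprn_ge0 ?(ltW r2_gt0)// real_normK ?num_real//.
rewrite -exprM mulnC exprM r2_sqr [2 ^+ n.+1]exprS -(rsT_energy n y p).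
have h b' q := sqr_ge0 (rsT b' n (2 ^ n) y q).
have h0 := h false p; have h1 := h false (p + pi / 2).
have h2 := h true p; have h3 := h true (p + pi / 2).
by case: b; lra.
Qed.

(** A partial sum reaching past the middle is a full sum of half length plus a partial sum of half
    length. The constant [5] closes the induction because [r2 + 5 <= 5 * r2], that is
    [5 / 4 <= r2]. *)
Lemma rsT_partial b n M y p : (M <= 2 ^ n)%N -> `|rsT b n M y p| <= 5 * r2 ^+ n.
Proof.
have g1 := r2_ge.
elim: n b M p => [|n IH] b M p.
  rewrite expn0 leq_eqVlt ltnS leqn0 => /orP[] /eqP ->; rewrite /rsT ?big_nat1 ?big_geq//; last first.
    by rewrite normr0 expr0 mulr1.
  rewrite /= mul1r expr0 mulr1 (@le_trans _ _ 1)//; last by rewrite ler1n.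
  by rewrite ler_norml cos_geN1 cos_le1.
have rn : 0 <= r2 ^+ n by rewrite exprn_ge0// ltW// r2_gt0.
move=> hM; have [mixed_norm|nM] := leqP M (2 ^ n).
  rewrite rsT_le// (le_trans (IH _ _ _ mixed_norm))// exprS ler_wpM2l// ler_peMl//; lra.
rewrite -(subnKC (ltnW nM)) rsT_gt (le_trans (ler_normD _ _))// normrM normr_sign mul1r.
have h1 := rsT_full false n y p.
have h2 : `|rsT true n (M - 2 ^ n) y (p + (2 ^ n)%:R * y)| <= 5 * r2 ^+ n.
  by apply: IH; rewrite leq_subLR addnn -mul2n -expnS.
rewrite (le_trans (lerD h1 h2))// exprS -mulrDl mulrA ler_wpM2r//; lra.
Qed.

(** Summation by parts: the increments of the increasing weights telescope to the last weight. The
    weights will be the powers of the frequencies produced by differentiation. *)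
Lemma abel_bound (w z : nat -> R) (B : R) (M : nat) :
  (forall k, 0 <= w k) -> (forall k, w k <= w k.+1) ->
  (forall m, (m <= M.+1)%N -> `|\sum_(0 <= k < m) z k| <= B) ->
  `|\sum_(0 <= k < M.+1) w k * z k| <= 2 * w M * B.
Proof.
move=> w0 wm hB.
(* Subtracting the last weight times the full sum gives a statement that passes from [M] to
   [M.+1]. *)
suff H : `|\sum_(0 <= k < M.+1) w k * z k - w M * \sum_(0 <= k < M.+1) z k| <= B * w M.
  rewrite -[X in `|X|](subrK (w M * \sum_(0 <= k < M.+1) z k)).
  rewrite (le_trans (ler_normD _ _))// normrM [`|w M|]ger0_norm//.
  have := lerD H (ler_wpM2l (w0 M) (hB M.+1 (leqnn _))).
  by rewrite (_ : B * w M + w M * B = 2 * w M * B)//; ring.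
elim: M hB => [|M IH] hB.
  by rewrite !big_nat1 subrr normr0 mulr_ge0// (le_trans _ (hB 0%N _)).
rewrite !(@big_nat_recr _ _ _ M.+1)//=.
have {}IH := IH (fun m hm => hB m (leqW hm)).
set A := \sum_(0 <= i < M.+1) w i * z i in IH *; set Z := \sum_(0 <= i < M.+1) z i in IH *.
rewrite (_ : _ - _ = (A - w M * Z) - (w M.+1 - w M) * Z); last by ring.
rewrite (le_trans (ler_normB _ _))// normrM [`|w M.+1 - _|]ger0_norm ?subr_ge0//.
have := lerD IH (ler_wpM2l (_ : 0 <= w M.+1 - w M) (hB M.+1 (leqW (leqnn _)))).
rewrite subr_ge0 => /(_ (wm M)).
by rewrite (_ : B * w M + (w M.+1 - w M) * B = B * w M.+1)//; ring.
Qed.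

(* The [l]-th derivative of the flat sum [2^(-n/2) sum_k eps_k cos ((k + 1) L t)]. *)
Definition rsA n (L : R) l t : R :=
  r2 ^- n * \sum_(k < 2 ^ n) rs false n k * ((k.+1%:R * L) ^+ l * cos (k.+1%:R * L * t + l%:R * (pi / 2))).

Lemma is_derive_rsA n (L : R) l t : is_derive t 1 (rsA n L l) (rsA n L l.+1 t).
Proof.
rewrite (_ : rsA n L l = r2 ^- n \*: \sum_(k < 2 ^ n) ((rs false n k * (k.+1%:R * L) ^+ l) \*:
    (fun t => cos (k.+1%:R * L * t + l%:R * (pi / 2))))); last first.
  apply/funext => u; rewrite /rsA /= /GRing.scale /= fct_sumE; congr (_ * _).
  by apply: eq_bigr => k _; rewrite /GRing.scale /= mulrA.
rewrite /rsA; apply: is_deriveZ.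
have d (k : 'I_(2 ^ n)) := @is_deriveZ _ _ _ _ (rs false n k * (k.+1%:R * L) ^+ l) t 1 _
  (is_derive_cosD (k.+1%:R * L) (l%:R * (pi / 2)) t).
apply: (is_derive_eq (is_derive_sum d)).
apply: eq_bigr => k _; rewrite /GRing.scale /= exprSr.
rewrite (_ : l.+1%:R * (pi / 2) = l%:R * (pi / 2) + pi / 2); last by rewrite -natr1; ring.
by rewrite addrA; ring.
Qed.

(** Abel summation against partial sums of size [5 * r2 ^+ n] gives the factor [10]; the last weight
    is the top frequency to the power [l]. *)
Lemma rsA_bound n (L : R) l t : 0 <= L -> `|rsA n L l t| <= 10 * (2 ^+ n * L) ^+ l.
Proof.
move=> L0; have rn : 0 < r2 ^+ n by rewrite exprn_gt0// r2_gt0.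
rewrite /rsA normrM normfV [`|r2 ^+ n|]ger0_norm ?(ltW rn)// [leLHS]mulrC ler_pdivrMr//.
have [M hM] : exists M, (2 ^ n = M.+1)%N by exists (2 ^ n).-1; rewrite prednK// expn_gt0.
have := @abel_bound (fun k => (k.+1%:R * L) ^+ l) (fun k => rs false n k * cos (k%:R * (L * t) + (L * t + l%:R * (pi / 2)))) (5 * r2 ^+ n) M.
rewrite -hM => H.
rewrite -(big_mkord xpredT (fun k => rs false n k * ((k.+1%:R * L) ^+ l * cos (k.+1%:R * L * t + l%:R * (pi / 2))))).
rewrite (eq_bigr (fun k => (k.+1%:R * L) ^+ l * (rs false n k * cos (k%:R * (L * t) + (L * t + l%:R * (pi / 2)))))); last first.
  move=> k _; rewrite mulrCA; congr (_ * (_ * cos _)); rewrite -natr1; ring.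
rewrite (le_trans (H _ _ _))//.
- by move=> k; rewrite exprn_ge0// mulr_ge0.
- move=> k; apply: lerXn2r; rewrite ?nnegrE ?mulr_ge0//.
  by rewrite ler_wpM2r// ler_nat.
- by move=> m; exact: rsT_partial.
- rewrite natrX le_eqVlt; apply/orP; left; apply/eqP; ring.
Qed.

End rudin_shapiro.

(** * A smooth cutoff with all its derivatives *)

Section cutoff.
Context {R : realType}.
Implicit Types (f g : R -> R).

(** The flat function [exp (- 1 / t)] and its multiples by powers of [1 / t], a family whose linear
    span is closed under differentiation. *)
Definition theta k (t : R) : R := if 0 < t then t^-1 ^+ k * expR (- t^-1) else 0.

Lemma is_derive_inv (t : R) : t != 0 -> is_derive t 1 (fun u : R => u^-1) (- t^-1 ^+ 2).
Proof.
move=> t0; have d : derivable (id : R -> R) t 1 by exact: derivable_id.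
split; first exact: (@derivableV _ _ id t 1 t0 d).
by rewrite (@deriveV _ _ id t 1 t0 d) derive_id /GRing.scale /= mulr1 exprVn.
Qed.

Lemma powexp_bound k : exists2 C : R, 0 <= C & forall y, 0 < y -> y ^+ k * expR (- y) <= C.
Proof.
have [->|k0] := posnP k.
  by exists 1 => // y y0; rewrite expr0 mul1r -expR0 ler_expR oppr_le0 ltW.
have k0' : 0 < k%:R :> R by rewrite ltr0n.
exists (k%:R ^+ k); first by rewrite exprn_ge0// ltW.
move=> y y0; rewrite expRN ler_pdivrMr ?expR_gt0//.
have -> : expR y = expR (y / k%:R) ^+ k by rewrite -expRM_natl mulrC divfK// gt_eqF.
rewrite -exprMn; apply: lerXn2r; rewrite ?nnegrE ?mulr_ge0 ?expR_ge0 ?(ltW k0') ?(ltW y0)//.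
rewrite mulrC -ler_pdivrMr//; have := expR_ge1Dx (y / k%:R); lra.
Qed.

Lemma is_derive_theta k (t : R) : is_derive t 1 (theta k) (theta k.+2 t - k%:R * theta k.+1 t).
Proof.
have [t0|t0|->] := ltgtP t 0.
- rewrite /theta ltNge (ltW t0) /= mulr0 subr0.
  apply: (near_eq_is_derive (f := cst 0)); near=> u.
  by rewrite ifN// -leNgt ltW//; near: u; exact: lt_nbhsl.
- rewrite /theta t0.
  apply: (near_eq_is_derive (f := (fun y : R => y ^+ k * expR (- y)) \o (fun u => u^-1))).
    by near=> u; rewrite ifT//; near: u; exact: lt_nbhsr.
  have dF (y : R) : is_derive y 1 (fun y : R => y ^+ k * expR (- y)) (y ^+ k * - expR (- y) + expR (- y) * (k%:R * y ^+ k.-1)).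
    have d1 : is_derive y 1 (fun u : R => u ^+ k) (k%:R * y ^+ k.-1).
      by split; [exact: exprn_derivable|rewrite exp_derive /GRing.scale /= mulr1].
    have d2 : is_derive y 1 (fun y : R => expR (- y)) (- expR (- y)).
      have h := @is_derive1_comp R expR -%R y _ _ (is_derive_expR _) (is_deriveNid _ _).
      by apply: (is_derive_eq h); rewrite mulrN1.
    exact: (is_derive_eq (is_deriveM d1 d2)).
  apply: (is_derive_eq (is_derive1_comp (dF _) (is_derive_inv _))); first by rewrite gt_eqF.
  by case: k {dF} => [|k] /=; rewrite ?exprS ?expr0; ring.
- rewrite {2 3}/theta ltxx mulr0 subr0.
  (* The two extra powers of [1 / h] yield the quadratic bound at the origin. *)
  have [C C0 hC] := powexp_bound k.+2.
  apply: (@is_derive_quadratic _ _ _ _ C) => h.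
  rewrite add0r {2}/theta ltxx !subr0 mulr0 subr0 /theta.
  case: ifPn => h0; last by rewrite normr0 mulr_ge0 ?sqr_ge0.
  have hi : 0 < h^-1 by rewrite invr_gt0.
  rewrite ger0_norm ?mulr_ge0 ?exprn_ge0 ?expR_ge0 ?(ltW hi)//.
  have := ler_wpM2r (sqr_ge0 h) (hC _ hi).
  suff -> : h^-1 ^+ k.+2 * expR (- h^-1) * h ^+ 2 = h^-1 ^+ k * expR (- h^-1) by [].
  have e : h^-1 * h = 1 by rewrite mulVf// gt_eqF.
  transitivity (h^-1 ^+ k * expR (- h^-1) * (h^-1 * h) ^+ 2); first by rewrite !exprS; ring.
  by rewrite e expr1n mulr1.
Unshelve. all: by end_near. Qed.

(** Differentiability of order [n] by mere existence of successive derivatives, so that closure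
    under products, inverses and affine substitution is proved by induction without formulas for
    higher derivatives. *)
Fixpoint Ck n f : Prop :=
  if n is n'.+1 then exists g, (forall t : R, is_derive t 1 f (g t)) /\ Ck n' g else True.

Lemma Ck_le n f : Ck n.+1 f -> Ck n f.
Proof. by elim: n f => [//|n IH] f [g [dg cg]]; exists g; split => //; exact: IH. Qed.

Lemma Ck_cst n c : Ck n (fun=> c).
Proof. by elim: n c => //= n IH c; exists (fun=> 0); split => // t; exact: is_derive_cst. Qed.

Lemma CkD n f g : Ck n f -> Ck n g -> Ck n (fun t => f t + g t).
Proof.
elim: n f g => //= n IH f g [f' [df cf]] [g' [dg cg]].
by exists (fun t => f' t + g' t); split; [move=> t; exact: is_deriveD|exact: IH].
Qed.

Lemma CkM n f g : Ck n f -> Ck n g -> Ck n (fun t => f t * g t).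
Proof.
elim: n f g => // n IH f g cf cg.
have [f' [df cf']] := cf; have [g' [dg cg']] := cg.
exists (fun t => f t * g' t + g t * f' t); split; first by move=> t; exact: is_deriveM.
by apply: CkD; apply: IH => //; exact: Ck_le.
Qed.

Lemma Ck_affine n f a b : Ck n f -> Ck n (fun t => f (a * t + b)).
Proof.
elim: n f => // n IH f [g [dg cg]]; exists (fun t => g (a * t + b) * a); split; last first.
  by apply: CkM; [exact: IH|exact: Ck_cst].
move=> t; have h1 : is_derive t 1 (fun u : R => a * u + b) a.
  have h : is_derive t 1 ((a \*: (id : R -> R)) + cst b) (a *: 1 + 0) by apply: is_deriveD.
  by apply: (is_derive_eq h); rewrite /GRing.scale /= mulr1 addr0.
exact: (@is_derive1_comp R f (fun u => a * u + b) t _ _ (dg _) h1).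
Qed.

Lemma CkV n f : (forall t, f t != 0) -> Ck n f -> Ck n (fun t => (f t)^-1).
Proof.
move=> f0; elim: n => // n IH cf; have [g [dg cg]] := cf.
exists (fun t => (-1 * g t) * ((f t)^-1 * (f t)^-1)); split; last first.
  apply: CkM; first by apply: CkM => //; exact: Ck_cst.
  by apply: CkM; apply: IH; exact: Ck_le.
move=> t; have h := @is_derive1_comp R (fun u => u^-1) f t _ _ (is_derive_inv (f0 t)) (dg t).
by apply: (is_derive_eq h); rewrite expr2; ring.
Qed.

Lemma Ck_theta n k : Ck n (theta k).
Proof.
elim: n k => // n IH k; exists (fun t => theta k.+2 t + (- k%:R) * theta k.+1 t); split.
  by move=> t; apply: (is_derive_eq (is_derive_theta k t)); rewrite mulNr.
by apply: CkD => //; apply: CkM => //; exact: Ck_cst.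
Qed.

(** Derivatives are unique, so the witnesses given for different [n] all agree with the iterated
    derivative. *)
Lemma Ck_family f : (forall n, Ck n f) ->
  exists phi : nat -> R -> R, phi 0%N = f /\ forall l (t : R), is_derive t 1 (phi l) (phi l.+1 t).
Proof.
move=> cf; exists (fun l => f^`(l)%classic); split => // l t.
suff H m h : (forall n, Ck n h) -> (forall n, Ck n h^`(m)%classic).
  have [g [dg _]] := H l f cf 1%N.
  by apply: (is_derive_eq (dg t)); rewrite derive1nS derive1E; have /@derive_val -> := dg t.
elim: m h => [//|m IH] h ch n; rewrite derive1Sn; apply: IH => n'.
have [g [dg cg]] := ch n'.+1.
suff -> : h^`()%classic = g by [].
by apply/funext => u; rewrite derive1E; have /@derive_val -> := dg u.
Qed.

Definition step t : R := theta 0 t * (theta 0 t + theta 0 (1 - t))^-1.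

Lemma theta_ge0 k t : 0 <= theta k t.
Proof.
rewrite /theta; case: ifPn => // t0; rewrite mulr_ge0 ?expR_ge0// exprn_ge0// invr_ge0 ltW//.
Qed.

Lemma theta_gt0 k t : 0 < t -> 0 < theta k t.
Proof. by move=> t0; rewrite /theta t0 mulr_gt0 ?expR_gt0// exprn_gt0// invr_gt0. Qed.

Lemma theta_le0 k t : t <= 0 -> theta k t = 0.
Proof. by rewrite /theta ltNge => ->. Qed.

Lemma step_den t : 0 < theta 0 t + theta 0 (1 - t).
Proof.
have [t0|t0] := ltP 0 t; first by rewrite ltr_pwDl ?theta_gt0 ?theta_ge0.
by rewrite ltr_wpDl ?theta_ge0// theta_gt0//; lra.
Qed.

Lemma step0 t : t <= 0 -> step t = 0.
Proof. by move=> t0; rewrite /step theta_le0// mul0r. Qed.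

Lemma step1 t : 1 <= t -> step t = 1.
Proof.
move=> t1; rewrite /step (@theta_le0 _ (1 - t)); last by lra.
by rewrite addr0 divff// gt_eqF// theta_gt0//; lra.
Qed.

Lemma Ck_step n : Ck n step.
Proof.
apply: CkM; first exact: Ck_theta.
apply: CkV; first by move=> t; rewrite gt_eqF// step_den.
apply: CkD; first exact: Ck_theta.
rewrite (_ : (fun t => _) = fun t => theta 0 (-1 * t + 1)); first exact: Ck_affine (Ck_theta _ _).
by apply/funext => t; rewrite mulN1r addrC.
Qed.

Lemma cutoff_exists : exists chi : nat -> R -> R,
  [/\ forall l (t : R), is_derive t 1 (chi l) (chi l.+1 t),
      forall t, 7 / 8 <= t <= 9 / 8 -> chi 0%N t = 1,
      forall l t, (t <= 3 / 4) || (5 / 4 <= t) -> chi l t = 0 &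
      forall l, exists C, forall t, `|chi l t| <= C].
Proof.
(* The first factor rises between [13/16] and [7/8], the second falls between [9/8] and [19/16]. The
   margin to [3/4] and [5/4] puts the closed outer region inside open sets where [f] vanishes, hence
   all its derivatives too. *)
pose f (t : R) := step (16 * t + -13) * step (- 16 * t + 19).
have [phi [phi0 dphi]] : exists phi : nat -> R -> R, phi 0%N = f /\ forall l (t : R), is_derive t 1 (phi l) (phi l.+1 t).
  by apply: Ck_family => n; apply: CkM; apply: Ck_affine; exact: Ck_step.
have z1 l : forall t, t < 13 / 16 -> phi l t = 0.
  elim: l => [|l IH] t ht; first by rewrite phi0 /f step0 ?mul0r//; lra.
  have /@derive_val <- := dphi l t; rewrite -(derive_cst (0 : R) t (1 : R)).
  apply: near_eq_derive; near=> u; apply: IH; near: u; exact: lt_nbhsl.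
have z2 l : forall t, 19 / 16 < t -> phi l t = 0.
  elim: l => [|l IH] t ht; first by rewrite phi0 /f [X in _ * X]step0 ?mulr0//; lra.
  have /@derive_val <- := dphi l t; rewrite -(derive_cst (0 : R) t (1 : R)).
  apply: near_eq_derive; near=> u; apply: IH; near: u; exact: lt_nbhsr.
have z l t : (t <= 3 / 4) || (5 / 4 <= t) -> phi l t = 0.
  by case/orP => h; [apply: z1|apply: z2]; lra.
exists phi; split => //.
  by move=> t /andP[h1 h2]; rewrite phi0 /f !step1 ?mulr1//; lra.
move=> l; have cl : continuous (phi l).
  by move=> t; apply: differentiable_continuous; apply/derivable1_diffP; have [] := dphi l t.
have cn : {within `[3 / 4 : R, 5 / 4], continuous (fun t => `|phi l t|)}.
  apply: continuous_subspaceT => t; apply: (continuous_comp (cl t)); exact: norm_continuous.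
have [|c _ hc] := EVT_max _ cn; first by lra.
exists `|phi l c| => t.
have [h|h] := boolP ((t <= 3 / 4) || (5 / 4 <= t)); first by rewrite z// normr0.
by apply: hc; move: h; rewrite negb_or -!ltNge in_itv/= => /andP[h1 h2]; rewrite !ltW.
Unshelve. all: by end_near. Qed.

End cutoff.

(** * The symbol *)

Section symbol_construction.
Context {R : realType}.

Lemma enorm_ge k (x : 'rV[R]_k) i : `|x 0 i| <= enorm x.
Proof.
rewrite -sqrtr_sqr /enorm ler_wsqrtr// /dotv (bigD1 i)//= expr2 lerDl sumr_ge0// => j _.
by rewrite -expr2 sqr_ge0.
Qed.

Lemma enorm_le k (x : 'rV[R]_k) B : 0 <= B -> (forall i, `|x 0 i| <= B) -> enorm x <= k%:R * B.
Proof.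
move=> B0 h; have kB : 0 <= k%:R * B by rewrite mulr_ge0.
rewrite -[leRHS](ger0_norm kB) -sqrtr_sqr ler_wsqrtr//.
apply: (@le_trans _ _ (\sum_(j < k) B * B)).
  apply: ler_sum => j _; rewrite (le_trans (ler_norm _))// normrM ler_pM//.
have BB : 0 <= B * B by rewrite mulr_ge0.
have kk : (k%:R : R) <= k%:R * k%:R by rewrite -natrM ler_nat; case: (k) => // k'; rewrite leq_pmull.
rewrite sumr_const card_ord -[leLHS]mulr_natl.
by rewrite (_ : (k%:R * B) ^+ 2 = k%:R * k%:R * (B * B)) ?ler_wpM2r//; ring.
Qed.

(** The exponent of a symbol estimate may have either sign: [c1] serves [e >= 0], [c2] serves
    [e < 0], and the sum of the two constants covers both. *)
Lemma powR_comparable (u v c1 c2 e : R) : 0 < u -> 0 < c1 -> 0 < c2 ->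
  c1 * u <= v -> v <= c2 * u -> powR u e <= (powR c1 (- e) + powR c2 (- e)) * powR v e.
Proof.
move=> u0 c10 c20 h1 h2.
have v0 : 0 < v by apply: lt_le_trans h1; rewrite mulr_gt0.
have key c : 0 < c -> powR (c * u) e <= powR v e -> powR u e <= powR c (- e) * powR v e.
  move=> c0; rewrite powRM ?(ltW c0) ?(ltW u0)// => h.
  have := ler_wpM2l (powR_ge0 c (- e)) h.
  rewrite mulrA -powRD; last by rewrite (gt_eqF c0) implybT.
  by rewrite addNr powRr0 mul1r.
rewrite mulrDl; have [e0|e0] := leP 0 e.
  rewrite (le_trans (key c1 c10 _)) ?lerDl ?mulr_ge0 ?powR_ge0//.
  by apply: ge0_ler_powR; rewrite ?nnegrE ?(ltW v0)// mulr_ge0// ltW.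
rewrite (le_trans (key c2 c20 _)) ?lerDr ?mulr_ge0 ?powR_ge0//.
rewrite -(opprK e) !(powRN _ (- e)) lef_pV2 ?posrE ?powR_gt0 ?mulr_gt0//.
by apply: ge0_ler_powR; rewrite ?nnegrE ?oppr_ge0 ?(ltW v0) ?(ltW e0)// ltW// mulr_gt0.
Qed.

Lemma prod_count (I : finType) (x : R) (s : seq I) : \prod_i x ^+ count_mem i s = x ^+ size s.
Proof.
elim: s => [|a s IH] /=; first by rewrite big1.
under eq_bigr do rewrite exprD.
rewrite big_split /= IH exprS; congr (_ * _).
by rewrite (bigD1 a)//= eqxx big1 ?mulr1// => i ia; rewrite eq_sym (negbTE ia).
Qed.

Section symbol.
Variables (n : nat) (i0 : 'I_n) (m delta eps : R) (chi : nat -> R -> R).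
Hypothesis eps_delta : eps < delta.
Hypothesis chi_derive : forall l (t : R), is_derive t 1 (chi l) (chi l.+1 t).
Hypothesis chi_supp : forall l t, (t <= 3 / 4) || (5 / 4 <= t) -> chi l t = 0.
Hypothesis chi_bound : forall l, exists C : R, forall t, `|chi l t| <= C.

(* At scale [2^j] the [x]-dependence uses [2^Nexp ~ 2^((delta - eps) j)] frequencies
   with spacing [Lfreq = 2^(eps j)], so all of them lie below [2^(delta j)]. *)
Definition Nexp (j : nat) : nat := Num.truncn ((delta - eps) * j%:R).
Definition Lfreq (j : nat) : R := powR 2 (eps * j%:R).

Lemma Lfreq_gt0 j : 0 < Lfreq j. Proof. exact: powR_gt0. Qed.

Lemma NL_le j : 2 ^+ Nexp j * Lfreq j <= powR 2 (delta * j%:R).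
Proof.
have -> : 2 ^+ Nexp j = powR 2 (Nexp j)%:R :> R by rewrite powR_mulrn.
rewrite /Lfreq -powRD ?pnatr_eq0 ?implybT//.
apply: ler_powR; first by rewrite ler1n.
have h : 0 <= (delta - eps) * j%:R by rewrite mulr_ge0// subr_ge0 ltW.
by have := truncn_le ((delta - eps) * j%:R); rewrite h -/(Nexp j); lra.
Qed.

Definition dil (j : nat) l (t : R) : R := (2 ^- j) ^+ l * chi l (2 ^- j * t).

Lemma is_derive_dil j l (t : R) : is_derive t 1 (dil j l) (dil j l.+1 t).
Proof.
have h1 : is_derive t 1 (fun u : R => 2 ^- j * u) (2 ^- j).
  have h : is_derive t 1 (2 ^- j \*: (id : R -> R)) (2 ^- j *: 1) by apply: is_deriveZ.
  by apply: (is_derive_eq h); rewrite /GRing.scale /= mulr1.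
have h2 := @is_derive1_comp R (chi l) _ t _ _ (chi_derive _ _) h1.
have h3 := @is_deriveZ _ _ _ _ ((2 ^- j) ^+ l) t 1 _ h2.
by apply: (is_derive_eq h3); rewrite /dil /GRing.scale /= exprSr; ring.
Qed.

(** Treating the [x] and [xi] variables alike makes each term of the symbol a pure tensor in [n + n]
    variables, so [pderiv_tensor] computes all mixed derivatives at once. *)
Definition sphi j (i : 'I_(n + n)) l (t : R) : R :=
  match fintype.split i with inl _ => rsA (Nexp j) (Lfreq j) l t | inr _ => dil j l t end.

Lemma is_derive_sphi j i l (t : R) : is_derive t 1 (sphi j i l) (sphi j i l.+1 t).
Proof.
rewrite /sphi; case: (fintype.split i) => _; last exact: is_derive_dil.
exact: is_derive_rsA.
Qed.

Definition amp (j : nat) : R := powR 2 (m * j%:R).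

Definition sterm j (z : 'rV[R]_(n + n)) : R := amp j * \prod_i sphi j i 0 (z 0 i).

Lemma pderiv_sterm j s : pderiv s (sterm j) =
  (fun z => amp j * \prod_i sphi j i (count_mem i s) (z 0 i)).
Proof.
rewrite /sterm pderivZ; last exact: smooth_tensor (is_derive_sphi j).
by rewrite (pderiv_tensor (is_derive_sphi j)).
Qed.

Lemma smooth_sterm j : smooth (sterm j).
Proof. by apply: smoothZ; exact: smooth_tensor (is_derive_sphi j). Qed.

Definition tail_index (t : R) : nat := (Num.truncn (2 * `|t|)).+1.

(* For each [z] at most one dyadic scale contributes; the truncation makes the sum finite. *)
Definition ssum (z : 'rV[R]_(n + n)) : R :=
  \sum_(0 <= j < tail_index (z 0 (rshift n i0))) sterm j z.

Definition symb (x xi : 'rV[R]_n) : R[i] := (ssum (row_mx x xi))%:C%C.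

Lemma dil_supp j l t : (2 ^- j * t <= 3 / 4) || (5 / 4 <= 2 ^- j * t) -> dil j l t = 0.
Proof. by move=> h; rewrite /dil chi_supp// mulr0. Qed.

Lemma sphi_l j i l t : sphi j (lshift n i) l t = rsA (Nexp j) (Lfreq j) l t.
Proof. by rewrite /sphi (unsplitK (inl _ i)). Qed.

Lemma sphi_r j i l t : sphi j (rshift n i) l t = dil j l t.
Proof. by rewrite /sphi (unsplitK (inr _ i)). Qed.

Lemma pderiv_sterm_supp j s (z : 'rV[R]_(n + n)) (i : 'I_n) :
  (2 ^- j * z 0 (rshift n i) <= 3 / 4) || (5 / 4 <= 2 ^- j * z 0 (rshift n i)) ->
  pderiv s (sterm j) z = 0.
Proof.
move=> h; rewrite pderiv_sterm (bigD1 (rshift n i))//= sphi_r dil_supp//.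
by rewrite mul0r mulr0.
Qed.

(** The crude bound [j <= 2 ^ j] is enough to discard all large scales. *)
Lemma dyadic_small j (t : R) : 2 * t <= j%:R -> 2 ^- j * t <= 3 / 4.
Proof.
move=> h; rewrite mulrC ler_pdivrMr ?exprn_gt0//.
have : (j%:R : R) <= 2 ^+ j by rewrite -natrX ler_nat ltnW// ltn_expl.
have : 0 <= 2 ^+ j :> R by rewrite exprn_ge0.
lra.
Qed.

Lemma sum_stable (f : nat -> R) a b : (forall j, (a <= j)%N -> f j = 0) ->
  (forall j, (b <= j)%N -> f j = 0) -> \sum_(0 <= j < a) f j = \sum_(0 <= j < b) f j.
Proof.
wlog ab : a b / (a <= b)%N.
  by move=> H fa fb; case/orP: (leq_total a b) => h; [|symmetry]; exact: H.
move=> fa _; rewrite [RHS](big_cat_nat (n := a))//= [X in _ + X]big1_seq ?addr0// => j.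
by rewrite mem_index_iota => /andP[_ /andP[+ _]]; exact: fa.
Qed.

(** On a half space the truncation depending on [z] is replaced by a fixed one, which exhibits
    [ssum] locally as a finite sum of smooth terms. *)
Lemma ssum_local K (z : 'rV[R]_(n + n)) : 2 * z 0 (rshift n i0) <= K%:R ->
  ssum z = \sum_(j < K) sterm j z.
Proof.
move=> hK; rewrite -(big_mkord xpredT (fun j => sterm j z)); apply: sum_stable => j hj.
  apply: (@pderiv_sterm_supp j [::] z i0); rewrite dyadic_small//.
  rewrite (le_trans (ler_wpM2l _ (ler_norm _)))//.
  rewrite (@le_trans _ _ (tail_index (z 0 (rshift n i0)))%:R)//; last by rewrite ler_nat.
  by rewrite ltW// truncnS_gt.
apply: (@pderiv_sterm_supp j [::] z i0); rewrite dyadic_small//.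
by rewrite (le_trans hK)// ler_nat.
Qed.

Lemma open_half (c : R) : open [set z : 'rV[R]_(n + n) | z 0 (rshift n i0) < c].
Proof.
have -> : [set z : 'rV[R]_(n + n) | z 0 (rshift n i0) < c] =
    (fun z : 'rV[R]_(n + n) => z 0 (rshift n i0)) @^-1` [set t | t < c] by [].
apply: open_comp; last exact: open_lt.
by move=> z _; exact: coord_continuous.
Qed.

Definition locidx (z : 'rV[R]_(n + n)) : nat := (Num.truncn (2 * (`|z 0 (rshift n i0)| + 1))).+1.

Lemma locidxP (z y : 'rV[R]_(n + n)) : y 0 (rshift n i0) < `|z 0 (rshift n i0)| + 1 ->
  2 * y 0 (rshift n i0) <= (locidx z)%:R.
Proof.
move=> h; have := truncnS_gt (2 * (`|z 0 (rshift n i0)| + 1)); rewrite -/(locidx z); lra.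
Qed.

Lemma ssum_smooth : smooth ssum.
Proof.
apply: smooth_local => z.
exists [set y : 'rV[R]_(n + n) | y 0 (rshift n i0) < `|z 0 (rshift n i0)| + 1].
exists (fun z' => \sum_(j < locidx z) sterm j z'); split.
- exact: open_half.
- by rewrite /=; have := ler_norm (z 0 (rshift n i0)); lra.
- by apply: smooth_sum => j; exact: smooth_sterm.
- by move=> y hy; apply: ssum_local; exact: locidxP.
Qed.

Lemma pderiv_ssum s (z : 'rV[R]_(n + n)) : pderiv s ssum z = \sum_(j < locidx z) pderiv s (sterm j) z.
Proof.
have := @pderiv_local _ _ [set y : 'rV[R]_(n + n) | y 0 (rshift n i0) < `|z 0 (rshift n i0)| + 1]
  ssum (fun z' => \sum_(j < locidx z) sterm j z') s (@open_half _).
move=> /(_ (fun y hy => ssum_local (locidxP hy))) ->; last first.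
  by rewrite /=; have := ler_norm (z 0 (rshift n i0)); lra.
by rewrite pderiv_sum// => j; exact: smooth_sterm.
Qed.

Definition in_supp j (z : 'rV[R]_(n + n)) := 3 / 4 < 2 ^- j * z 0 (rshift n i0) < 5 / 4.

Lemma supp_uniq j j' (z : 'rV[R]_(n + n)) : in_supp j z -> in_supp j' z -> j = j'.
Proof.
wlog jj : j j' / (j < j')%N.
  move=> H h h'; case: (ltngtP j j') => // l; first exact: H.
  by symmetry; exact: H.
move=> /andP[h1 h2] /andP[h3 h4]; exfalso; move: h2 h3; set t := z 0 _ => h2 h3.
have p : 0 < 2 ^+ j :> R by rewrite exprn_gt0.
have p' : 0 < 2 ^+ j' :> R by rewrite exprn_gt0.
move: h2 h3; rewrite mulrC ltr_pdivrMr// [_ * t]mulrC ltr_pdivlMr// => h2 h3.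
have : 2 * 2 ^+ j <= 2 ^+ j' :> R by rewrite -exprS ler_eXn2l// ltr1n.
lra.
Qed.

(** The Rudin-Shapiro factors pay [2^(delta j)] for each derivative in [x], the dilated cutoffs gain
    [2^(-j)] for each derivative in [xi]. *)
Lemma pderiv_sterm_bound (a b : seq 'I_n) : exists2 C, 0 <= C & forall j (z : 'rV[R]_(n + n)),
  `|pderiv (map (@rshift n n) a ++ map (@lshift n n) b) (sterm j) z| <=
    C * (amp j * powR 2 (delta * j%:R) ^+ size b * (2 ^- j) ^+ size a).
Proof.
have /choice[Cc hC] : forall l, exists C : R, forall t, `|chi l t| <= C := chi_bound.
have C0 l : 0 <= Cc l by exact: le_trans (normr_ge0 _) (hC l 0).
exists (10 ^+ n * \prod_(i < n) Cc (count_mem i a)).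
  by rewrite mulr_ge0 ?exprn_ge0// prodr_ge0.
move=> j z; rewrite pderiv_sterm normrM [`|amp j|]ger0_norm ?powR_ge0//.
rewrite normr_prod big_split_ord /=.
have cl (i : 'I_n) : count_mem (lshift n i) (map (@rshift n n) a ++ map (@lshift n n) b) = count_mem i b.
  rewrite count_cat !count_map [X in (X + _)%N](_ : _ = 0%N) ?add0n.
    by apply: eq_count => i' /=; rewrite (inj_eq (@lshift_inj _ _)).
  by rewrite (eq_count (a2 := pred0)) ?count_pred0// => i' /=; rewrite eq_rlshift.
have cr (i : 'I_n) : count_mem (rshift n i) (map (@rshift n n) a ++ map (@lshift n n) b) = count_mem i a.
  rewrite count_cat !count_map [X in (_ + X)%N](_ : _ = 0%N) ?addn0.
    by apply: eq_count => i' /=; rewrite (inj_eq (@rshift_inj _ _)).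
  by rewrite (eq_count (a2 := pred0)) ?count_pred0// => i' /=; rewrite eq_lrshift.
have h1 : \prod_(i < n) `|sphi j (lshift n i) (count_mem (lshift n i) (map (@rshift n n) a ++ map (@lshift n n) b)) (z 0 (lshift n i))|
   <= 10 ^+ n * powR 2 (delta * j%:R) ^+ size b.
  rewrite -(prod_count _ b) -[n in 10 ^+ n]card_ord -prodr_const -big_split /=.
  apply: ler_prod => i _; rewrite normr_ge0 /= cl sphi_l.
  apply: (le_trans (rsA_bound _ _ _ (ltW (Lfreq_gt0 j)))); rewrite ler_wpM2l//.
  apply: lerXn2r; rewrite ?nnegrE ?powR_ge0 ?mulr_ge0 ?exprn_ge0 ?(ltW (Lfreq_gt0 j))//.
  exact: NL_le.
have h2 : \prod_(i < n) `|sphi j (rshift n i) (count_mem (rshift n i) (map (@rshift n n) a ++ map (@lshift n n) b)) (z 0 (rshift n i))|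
   <= (\prod_(i < n) Cc (count_mem i a)) * (2 ^- j) ^+ size a.
  rewrite -(prod_count _ a) -big_split /=.
  apply: ler_prod => i _; rewrite normr_ge0 /= cr sphi_r /dil normrM mulrC ler_pM//.
  by rewrite ger0_norm// exprn_ge0// invr_ge0 exprn_ge0.
rewrite [leRHS](_ : _ = amp j * ((10 ^+ n * powR 2 (delta * j%:R) ^+ size b) *
  ((\prod_(i < n) Cc (count_mem i a)) * (2 ^- j) ^+ size a))); last by ring.
by apply: ler_wpM2l; [exact: powR_ge0|apply: ler_pM => //; exact: prodr_ge0].
Qed.

Lemma symb_class : symbol_class m 1 delta symb.
Proof.
have E : (fun z : 'rV[R]_(n + n) => cre (sym2 symb z)) = ssum.
  by apply/funext => z; rewrite /sym2 /symb cre_real hsubmxK.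
have E2 : (fun z : 'rV[R]_(n + n) => cim (sym2 symb z)) = fun=> 0 by apply/funext => z.
split; first by split; [rewrite E; exact: ssum_smooth|rewrite E2; exact: smooth_cst].
move=> a b; have [C C0 hC] := pderiv_sterm_bound a b.
pose e : R := m - 1 * (size a)%:R + delta * (size b)%:R.
(* On the support of the term [j] every coordinate of [xi] is below [5/4 * 2^j], whence
   [1 + enorm xi <= c2 * 2^j]; the lower constant [3 / 4] comes from the coordinate [i0] alone. *)
pose c2 : R := 1 + n%:R * (5 / 4).
exists (C * (powR (3 / 4) (- e) + powR c2 (- e))) => x xi.
rewrite -/e.
have c20 : 0 < c2 by rewrite ltr_wpDr// mulr_ge0.
set s := map _ a ++ map _ b.
have -> : cmod (cpderiv s (sym2 symb) (row_mx x xi)) = `|pderiv s ssum (row_mx x xi)|.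
  rewrite /cpderiv E E2 pderiv_cst /cmod /cre /cim /=.
  by rewrite (_ : (if s is [::] then 0 else 0) = 0) ?expr0n ?addr0 ?sqrtr_sqr//; case: s.
set z := row_mx x xi.
have B0 : 0 <= C * (powR (3 / 4) (- e) + powR c2 (- e)) * powR (1 + enorm xi) e.
  by rewrite !mulr_ge0 ?addr_ge0 ?powR_ge0.
have zr i : z 0 (rshift n i) = xi 0 i by rewrite row_mxEr.
rewrite pderiv_ssum.
have [[j hj]|hn] := pselect (exists j : 'I_(locidx z), forall i, 3 / 4 < 2 ^- j * z 0 (rshift n i) < 5 / 4).
  rewrite (bigD1 j)//= [X in _ + X]big1 ?addr0; last first.
    move=> j' jj'; apply: (@pderiv_sterm_supp _ _ _ i0); apply: contraNT jj'.
    rewrite negb_or -!ltNge => h; apply/eqP/val_inj/esym.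
    exact: (supp_uniq (hj i0) h).
  apply: (le_trans (hC j z)); rewrite -[leRHS]mulrA; apply: ler_wpM2l => //.
  have p : 0 < 2 ^+ j :> R by rewrite exprn_gt0.
  have -> : amp j * powR 2 (delta * j%:R) ^+ size b * (2 ^- j) ^+ size a = powR (2 ^+ j) e.
    have e0 : 2 ^+ j = powR 2 j%:R :> R by rewrite powR_mulrn.
    have e1 : powR 2 (delta * j%:R) ^+ size b = powR 2 (delta * j%:R * (size b)%:R).
      by rewrite [RHS]powRrM powR_mulrn ?powR_ge0.
    have e2 : (2 ^- j) ^+ size a = powR 2 (- j%:R * (size a)%:R) :> R.
      by rewrite [RHS]powRrM powRN -e0 powR_mulrn// invr_ge0 exprn_ge0.
    have D (u v : R) : powR 2 u * powR 2 v = powR 2 (u + v) :> R.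
      by rewrite powRD// pnatr_eq0 implybT.
    rewrite e1 e2 e0 -powRrM /amp !D; congr (powR _ _); rewrite /e; ring.
  have hb i : 3 / 4 * 2 ^+ j < xi 0 i /\ xi 0 i < 5 / 4 * 2 ^+ j.
    have := hj i; rewrite zr [2 ^- j * _]mulrC ltr_pdivlMr// ltr_pdivrMr// => /andP[]//.
  have eg : 3 / 4 * 2 ^+ j <= 1 + enorm xi.
    have [h1 _] := hb i0; have h2 := ler_norm (xi 0 i0); have := enorm_ge xi i0.
    lra.
  apply: powR_comparable => //.
  have : enorm xi <= n%:R * (5 / 4 * 2 ^+ j).
    apply: enorm_le => [|i]; first by rewrite mulr_ge0// ltW.
    have [h1 h2] := hb i; rewrite ger0_norm ltW// (lt_trans _ h1)// mulr_gt0.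
  have : 1 <= 2 ^+ j :> R by rewrite exprn_ege1// ler1n.
  rewrite /c2 mulrDl mul1r mulrA; lra.
(* Without a scale common to all coordinates, every term contains a vanishing cutoff factor. *)
rewrite big1 ?normr0// => j _.
have [i hi] : exists i, ~ (3 / 4 < 2 ^- j * z 0 (rshift n i) < 5 / 4).
  by apply/existsNP => h; apply: hn; exists j.
apply: (@pderiv_sterm_supp _ _ _ i); apply: contrapT => h; apply: hi.
by move/negP: h; rewrite negb_or -!ltNge.
Qed.

End symbol.
End symbol_construction.

(** * Action of the operator on modulated Gaussians *)

Section action_on_modes.
Context {R : realType}.

Section pdo.
Variables (n : nat) (i0 : 'I_n) (m delta eps : R) (chi : nat -> R -> R).
Hypothesis eps_delta : eps < delta.
Hypothesis chi_derive : forall l (t : R), is_derive t 1 (chi l) (chi l.+1 t).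
Hypothesis chi_one : forall t, 7 / 8 <= t <= 9 / 8 -> chi 0 t = 1.
Hypothesis chi_supp : forall l t, (t <= 3 / 4) || (5 / 4 <= t) -> chi l t = 0.
Hypothesis chi_bound : forall l, exists C : R, forall t, `|chi l t| <= C.

Local Notation V := 'rV[R]_n.
Local Notation sy := (symb i0 m delta eps chi).
Local Notation cg := (cgauss (k := n)).
Local Notation ss := (ssum i0 m delta eps chi).

Definition ampl j (x : V) : R := \prod_i rsA (Nexp delta eps j) (Lfreq eps j) 0 (x 0 i).

Lemma sterm_row j (x xi : V) : sterm m delta eps chi j (row_mx x xi) =
  amp m j * (ampl j x * \prod_i dil chi j 0 (xi 0 i)).
Proof.
rewrite /sterm big_split_ord /=; congr (_ * (_ * _)); apply: eq_bigr => i _.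
  by rewrite sphi_l row_mxEl.
by rewrite sphi_r row_mxEr.
Qed.

Lemma ssum_plateau j (x xi : V) : (forall i, 7 / 8 <= 2 ^- j * xi 0 i <= 9 / 8) ->
  ss (row_mx x xi) = amp m j * ampl j x.
Proof.
move=> h; set z := row_mx x xi.
have zr i : z 0 (rshift n i) = xi 0 i by rewrite row_mxEr.
have hj : in_supp i0 j z by rewrite /in_supp zr; have := h i0; lra.
(* The truncation is enlarged so that [j] is among the indices. *)
rewrite (@ssum_local _ _ i0 m delta eps chi chi_derive chi_supp (locidx i0 z + j.+1)); last first.
  have : 2 * z 0 (rshift n i0) <= (locidx i0 z)%:R.
    by apply: locidxP; have := ler_norm (z 0 (rshift n i0)); lra.
  by move=> /le_trans; apply; rewrite ler_nat leq_addr.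
have jK : (j < locidx i0 z + j.+1)%N by rewrite addnS ltnS leq_addl.
rewrite (bigD1 (Ordinal jK))//= [X in _ + X]big1 ?addr0.
  rewrite sterm_row big1 ?mulr1// => i _.
  by rewrite /dil expr0 mul1r chi_one.
move=> j' jj'; apply: (@pderiv_sterm_supp _ _ m delta eps chi chi_derive chi_supp _ [::] z i0).
apply: contraNT jj'; rewrite negb_or -!ltNge => h'; apply/eqP/val_inj => /=.
exact: (supp_uniq h' hj).
Qed.

Lemma ampl_bound j x : `|ampl j x| <= 10 ^+ n.
Proof.
rewrite normr_prod -[n in 10 ^+ n]card_ord -prodr_const; apply: ler_prod => i _.
rewrite normr_ge0 /=; have := rsA_bound (Nexp delta eps j) 0 (x 0 i) (ltW (Lfreq_gt0 eps j)).
by rewrite expr0 mulr1.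
Qed.

(** A natural number above [|m|], so that growth of the symbol is measured by integer powers of
    [W]. *)
Definition pord : nat := (Num.truncn `|m|).+1.

Lemma m_le_pord : `|m| <= pord%:R.
Proof. exact/ltW/truncnS_gt. Qed.

Lemma powR_pord (u : R) : 1 <= u -> powR u m <= u ^+ pord.
Proof.
move=> u1; rewrite -powR_mulrn ?(le_trans ler01)//.
by apply: ler_powR => //; exact: le_trans (ler_norm _) m_le_pord.
Qed.

Lemma W_inv_ge1 k (x : 'rV[R]_k) : 1 <= (W x)^-1.
Proof. by rewrite invf_ge1 ?W_gt0// W_le1. Qed.

Lemma ssum_bound : exists2 C, 0 <= C & forall x xi : V,
  `|ss (row_mx x xi)| <= C * (W xi)^-1 ^+ pord.
Proof.
have [_ /(_ [::] [::])[C hC]] := symb_class i0 m eps_delta chi_derive chi_supp chi_bound.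
exists (`|C| * (1 + n%:R) ^+ pord); first by rewrite mulr_ge0// exprn_ge0// addr_ge0.
move=> x xi; have := hC x xi; rewrite /= mulr0 subr0 mulr0 addr0.
have -> : cmod (cpderiv [::] (sym2 sy) (row_mx x xi)) = `|ss (row_mx x xi)|.
  by rewrite /cpderiv /= /sym2 /symb hsubmxK /cmod /cre /cim /= expr0n addr0 sqrtr_sqr.
move=> /le_trans; apply; rewrite (le_trans (ler_wpM2r (powR_ge0 _ _) (ler_norm C)))//.
rewrite -mulrA ler_wpM2l//.
have e1 : 1 <= 1 + enorm xi by rewrite lerDl sqrtr_ge0.
rewrite (le_trans (powR_pord e1))// -exprMn; apply: lerXn2r.
- by rewrite nnegrE (le_trans _ e1).
- by rewrite nnegrE mulr_ge0 ?addr_ge0// invr_ge0 ltW// W_gt0.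
have : enorm xi <= n%:R * (W xi)^-1.
  by apply: enorm_le => [|i]; [rewrite invr_ge0 ltW// W_gt0|exact: coord_W].
by have := W_inv_ge1 xi; rewrite mulrDl mul1r; lra.
Qed.

Lemma cvg_row_mx (x_ y_ : nat -> V) (x y : V) : x_ k @[k --> \oo] --> x ->
  y_ k @[k --> \oo] --> y -> row_mx (x_ k) (y_ k) @[k --> \oo] --> row_mx x y.
Proof.
move=> hx hy; apply: cvg_rV => j; rewrite -(splitK j); case: (fintype.split j) => i /=.
  by under eq_cvg do rewrite row_mxEl; rewrite row_mxEl; exact: cvg_rV_coord.
by under eq_cvg do rewrite row_mxEr; rewrite row_mxEr; exact: cvg_rV_coord.
Qed.

Lemma ss_continuous : continuous ss.
Proof. exact/smooth_continuous/(ssum_smooth i0 m delta eps chi_derive chi_supp). Qed.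

Lemma ss_seqcvg (x_ y_ : nat -> V) (x y : V) : x_ k @[k --> \oo] --> x ->
  y_ k @[k --> \oo] --> y -> ss (row_mx (x_ k) (y_ k)) @[k --> \oo] --> ss (row_mx x y).
Proof.
move=> hx hy; have h := @ss_continuous (row_mx x y).
exact: (cvg_comp _ _ (cvg_row_mx hx hy) h).
Qed.

Lemma ss_xi_continuous x : continuous (fun xi : V => ss (row_mx x xi)).
Proof.
move=> xi; apply: seq_continuous_at => u hu; apply: ss_seqcvg => //; exact: cvg_cst.
Qed.

Lemma mode_hat_bound a om M : 0 < a -> exists2 C, 0 <= C & forall xi : V,
  gauss a^-1 (xi - om) <= C * W xi ^+ M.
Proof.
move=> a0; have a0' : 0 < a^-1 by rewrite invr_gt0.
have [C C0 hC] := gauss_bound (k := n) M a0'.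
exists (C * (\prod_i (2 * (1 + (- om) 0 i ^+ 2))) ^+ M).
  rewrite mulr_ge0// exprn_ge0// prodr_ge0// => i _.
  by rewrite mulr_ge0// addr_ge0// sqr_ge0.
move=> xi; rewrite (le_trans (hC _))// -mulrA ler_wpM2l// -exprMn.
apply: lerXn2r; rewrite ?nnegrE ?(ltW (W_gt0 _))//; last exact: W_add.
rewrite mulr_ge0 ?(ltW (W_gt0 _))// prodr_ge0// => i _.
by rewrite mulr_ge0// addr_ge0// sqr_ge0.
Qed.

Definition pint a om (x xi : V) : R[i] := cexp (dotv x xi) * sy x xi * fourier (mode a om) xi.

Lemma pintE a om x xi : 0 < a -> pint a om x xi =
  cexp (dotv x xi) * (ss (row_mx x xi) * (cg a * gauss a^-1 (xi - om)))%:C%C.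
Proof. by move=> a0; rewrite /pint fourier_mode// /symb -mulrA -rmorphM. Qed.

Lemma pint_bound a om : 0 < a -> exists2 C, 0 <= C & forall x xi, cmod (pint a om x xi) <= C * W xi.
Proof.
(* [pord] powers of [W] cancel the growth of the symbol, one more makes the integrand integrable. *)
move=> a0; have [C1 C10 h1] := ssum_bound; have [C2 C20 h2] := mode_hat_bound om pord.+1 a0.
have c0 := cgauss_gt0 (k := n) a0.
exists (C1 * (cg a * C2)); first by rewrite !mulr_ge0// ltW.
move=> x xi; rewrite pintE// cmodM cmod_cexp mul1r cmod_real normrM.
rewrite [`|_ * gauss _ _|]ger0_norm ?mulr_ge0 ?(ltW c0) ?(ltW (gauss_gt0 _ _))//.
rewrite (le_trans (ler_pM _ _ (h1 x xi) (ler_wpM2l (ltW c0) (h2 xi))))//.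
  by rewrite mulr_ge0 ?(ltW c0) ?(ltW (gauss_gt0 _ _)).
rewrite le_eqVlt; apply/orP; left; apply/eqP.
have e : (W xi)^-1 ^+ pord * W xi ^+ pord = 1 by rewrite -exprMn mulVf ?expr1n// gt_eqF// W_gt0.
by rewrite exprS; transitivity (C1 * (cg a * C2) * W xi * ((W xi)^-1 ^+ pord * W xi ^+ pord));
  [ring|rewrite e mulr1].
Qed.

Lemma gauss_seqcvg a (y_ : nat -> V) (y : V) : 0 < a -> y_ k @[k --> \oo] --> y ->
  gauss a (y_ k) @[k --> \oo] --> gauss a y.
Proof.
move=> a0 hy; have h := @gauss_continuous _ _ a a0 y.
exact: (cvg_comp _ _ hy h).
Qed.

Lemma pint_ccont a om x : 0 < a -> ccont (pint a om x).
Proof.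
move=> a0; have a0' : 0 < a^-1 by rewrite invr_gt0.
rewrite (_ : pint a om x = fun xi => cexp (dotv x xi) *
  (ss (row_mx x xi) * (cg a * gauss a^-1 (xi - om)))%:C%C); last by apply/funext => xi; exact: pintE.
apply: ccontM; first by apply: ccont_cexp; exact: continuous_dotv.
apply: ccont_real; apply: ctsM; first exact: ss_xi_continuous.
apply: ctsM; first exact: ctsC.
exact: (cts_comp (@cts_addcst _ _ (- om)) (gauss_continuous a0')).
Qed.

Lemma pint_domc a om x : 0 < a -> domc (pint a om x).
Proof.
move=> a0; apply/domcP; split; first exact: pint_ccont.
by have [C _ h] := pint_bound om a0; exists C.
Qed.

Lemma pdo_mode_ccont a om : 0 < a -> ccont (pdo sy (mode a om)).
Proof.
move=> a0; have a0' : 0 < a^-1 by rewrite invr_gt0.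
apply: ccontM; first exact: ccont_cst.
have [C _ h] := pint_bound om a0.
apply: (@Cint_seqcvg_cont _ _ (pint a om) C) => //; first by move=> x; exact: pint_ccont.
move=> x_ y_ x y hx hy.
have hr : ss (row_mx (x_ k) (y_ k)) * (cg a * gauss a^-1 (y_ k - om)) @[k --> \oo] -->
    ss (row_mx x y) * (cg a * gauss a^-1 (y - om)).
  apply: cvgM; first exact: ss_seqcvg.
  apply: cvgM; first exact: cvg_cst.
  by apply: gauss_seqcvg => //; apply: cvgB => //; exact: cvg_cst.
have hd : dotv (x_ k) (y_ k) @[k --> \oo] --> dotv x y by exact: cvg_dotv.
split.
  under eq_cvg do rewrite pintE// creM cre_real cim_real mulr0 subr0.
  rewrite pintE// creM cre_real cim_real mulr0 subr0; apply: cvgM => //.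
  exact: (cvg_comp _ _ hd (@continuous_cos R _)).
under eq_cvg do rewrite pintE// cimM cre_real cim_real mulr0 add0r.
rewrite pintE// cimM cre_real cim_real mulr0 add0r; apply: cvgM => //.
exact: (cvg_comp _ _ hd (@continuous_sin R _)).
Qed.

Lemma fourier_sum (I : Type) (r : seq I) (b : I -> R) (om : I -> V) a xi : 0 < a ->
  fourier (fun x => \sum_(i <- r) (b i)%:C%C * mode a (om i) x) xi =
  \sum_(i <- r) (b i)%:C%C * fourier (mode a (om i)) xi.
Proof.
move=> a0; have dm i : domc (fun x => cexp (- dotv xi x) * mode a (om i) x).
  rewrite (_ : (fun x => _) = fun x => mode a (om i) x * cexp (- dotv xi x)); last first.
    by apply/funext => x; rewrite mulrC.
  apply: (@domc_mul_bounded _ _ _ _ 1); first exact: mode_domc.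
    by apply: ccont_cexp; apply: ctsN; exact: continuous_dotv.
  by move=> x; rewrite cmod_cexp.
rewrite /fourier (eq_bigr (fun i => Cint (fun x => (b i)%:C%C * (cexp (- dotv xi x) * mode a (om i) x)))).
  rewrite -Cint_sum; last by move=> i; exact: domcZ.
  by apply: eq_Cint => x; rewrite mulr_sumr; apply: eq_bigr => i _; rewrite mulrCA.
by move=> i _; rewrite CintZ.
Qed.

Lemma pdo_sum (I : Type) (r : seq I) (b : I -> R) (om : I -> V) a x : 0 < a ->
  pdo sy (fun x => \sum_(i <- r) (b i)%:C%C * mode a (om i) x) x =
  \sum_(i <- r) (b i)%:C%C * pdo sy (mode a (om i)) x.
Proof.
move=> a0; rewrite /pdo.
rewrite (eq_bigr (fun i => ((2 * pi) ^- n)%:C%C * Cint (fun xi => (b i)%:C%C * pint a (om i) x xi))).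
  rewrite -mulr_sumr -Cint_sum; last by move=> i; apply: domcZ; exact: pint_domc.
  congr (_ * _); apply: eq_Cint => xi; rewrite fourier_sum// mulr_sumr.
  by apply: eq_bigr => i _; rewrite /pint mulrCA.
by move=> i _; rewrite CintZ; [rewrite mulrCA|exact: pint_domc].
Qed.

(** Equal to [1] by Fourier inversion, but kept as it arises from the two Gaussian integrals. *)
Definition kap a : R := (2 * pi) ^- n * (cg a * cg a^-1).

Lemma kap_gt0 a : 0 < a -> 0 < kap a.
Proof.
move=> a0; rewrite /kap !mulr_gt0 ?cgauss_gt0 ?invr_gt0 ?exprn_gt0 ?mulr_gt0 ?pi_gt0//.
Qed.

(** If each [xi_i] is within [2^j / 16] of [om_i], then [xi] lies on the plateau, because
    [1/16 + 1/16 = 1/8], and the difference vanishes. Otherwise [W (xi - om)] is of order at most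
    [2^(-2j)], and the Gaussian supplies as many powers of it as needed. *)
Lemma pdo_mode_err_bound a K : 0 < a -> exists2 C, 0 <= C & forall j (om x xi : V),
  (forall i, `|om 0 i - 2 ^+ j| <= 2 ^+ j / 16) ->
  `|(ss (row_mx x xi) - amp m j * ampl j x) * gauss a^-1 (xi - om)| <= C * (2 ^- j) ^+ K * W (xi - om).
Proof.
move=> a0; have a0' : 0 < a^-1 by rewrite invr_gt0.
have n0 : (0 < n)%N by case: (n) i0 => [[]|].
(* Of the [Q] factors of order [2^(-2j)], [n * M] offset the growth [(2^j)^(2nM)] of the symbol
   bound and [K] give the rate. *)
pose M := pord; pose Q := (n * M + K)%N.
have [C1 C10 h1] := ssum_bound; have [C2 C20 h2] := gauss_bound (k := n) (M + 1 + Q) a0'.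
pose B := C1 * (2 ^+ n * 5 ^+ n) ^+ M + 10 ^+ n.
have B0 : 0 <= B by rewrite addr_ge0// mulr_ge0// !exprn_ge0// mulr_ge0// exprn_ge0.
exists (B * C2 * (16 * 16) ^+ Q); first by rewrite !mulr_ge0// exprn_ge0.
move=> j om x xi hom.
set w := W (xi - om); have w0 : 0 < w by exact: W_gt0.
have t0 : 0 < 2 ^+ j :> R by rewrite exprn_gt0.
have t1 : 1 <= 2 ^+ j :> R by rewrite exprn_ege1// ler1n.
pose u : R := 2 ^- j; have ut : u * 2 ^+ j = 1 by rewrite mulVf// gt_eqF.
have u0 : 0 < u by rewrite invr_gt0.
have [hin|] := pselect (forall i, `|xi 0 i - om 0 i| <= 2 ^+ j / 16).
  rewrite (@ssum_plateau j) ?subrr ?mul0r ?normr0 ?mulr_ge0 ?exprn_ge0 ?(ltW u0) ?(ltW w0)//.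
  move=> i; have : `|xi 0 i - 2 ^+ j| <= 2 ^+ j / 8.
    rewrite -(subrKA (om 0 i)) (le_trans (ler_normD _ _))//.
    by have := hin i; have := hom i; lra.
  rewrite ler_norml => /andP[l1 l2]; rewrite -/u.
  have := ler_wpM2l (ltW u0) l1; have := ler_wpM2l (ltW u0) l2.
  rewrite mulrBr ut mulrN !mulrA ut; lra.
move=> /existsNP[i /negP]; rewrite -ltNge => hout.
have ws : w <= (16 * 16) * u ^+ 2.
  have w1i : w <= w1 (xi 0 i - om 0 i).
    rewrite /w /W (bigD1 i)//= !mxE ler_piMr ?(ltW (w1_gt0 _))//.
    by apply: prodr_ile1 => l _; rewrite w1_le1 ltW ?w1_gt0.
  rewrite (le_trans w1i)// /w1 invf_ple ?posrE; last 2 first.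
  - by rewrite ltr_wpDr// sqr_ge0.
  - by rewrite mulr_gt0// exprn_gt0.
  rewrite invfM -exprVn /u invrK.
  have : (2 ^+ j / 16) ^+ 2 <= (xi 0 i - om 0 i) ^+ 2.
    rewrite -[leRHS]real_normK ?num_real//; apply: lerXn2r; rewrite ?nnegrE ?(ltW hout)//.
  by rewrite exprMn !expr2; lra.
have wi1 : 1 <= w^-1 by exact: W_inv_ge1.
(* Peetre's inequality splits growth in [xi] into growth in [om], at most [5 * (2^j)^2] per
   coordinate, and growth in [xi - om]. *)
have wxi : (W xi)^-1 <= 2 ^+ n * 5 ^+ n * (2 ^+ j) ^+ (2 * n) * w^-1.
  have hW : (W om)^-1 <= 5 ^+ n * (2 ^+ j) ^+ (2 * n).
    rewrite /W -prodfV exprM -exprMn -[n in _ ^+ n]card_ord -prodr_const; apply: ler_prod => l _.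
    rewrite invr_ge0 (ltW (w1_gt0 _))//= /w1 invrK.
    have ho : `|om 0 l| <= 2 * 2 ^+ j.
      rewrite -(subrK (2 ^+ j) (om 0 l)) (le_trans (ler_normD _ _))// [`|2 ^+ j|]ger0_norm ?ltW//.
      by have := hom l; lra.
    have : `|om 0 l| ^+ 2 <= (2 * 2 ^+ j) ^+ 2.
      by apply: lerXn2r; rewrite ?nnegrE ?mulr_ge0 ?(ltW t0).
    have : 1 <= 2 ^+ j ^+ 2 :> R by rewrite exprn_ege1.
    by rewrite real_normK ?num_real// exprMn (expr2 2); lra.
  have hs := W_sub xi om.
  have e : W (om - xi) = w.
    by rewrite /w /W; apply: eq_bigr => l _; rewrite !mxE /w1 -sqrrN opprB.
  rewrite e in hs.
  have := ler_wpM2r (ltW (_ : 0 < (W xi)^-1 * (w^-1 * (W om)^-1))) hs.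
  rewrite !mulr_gt0 ?invr_gt0 ?W_gt0// => /(_ isT).
  rewrite (_ : w * W om * _ = (W xi)^-1 * ((w * w^-1) * (W om * (W om)^-1))); last by ring.
  rewrite (_ : 2 ^+ n * W xi * _ = 2 ^+ n * (W xi * (W xi)^-1) * (w^-1 * (W om)^-1)); last by ring.
  rewrite !divff ?gt_eqF ?W_gt0// !mulr1 => /le_trans; apply.
  rewrite -!mulrA ler_wpM2l ?exprn_ge0// mulrC mulrA.
  by rewrite ler_wpM2r ?invr_ge0 ?(ltW w0).
have hD : `|ss (row_mx x xi) - amp m j * ampl j x| <= B * (2 ^+ j) ^+ (2 * n * M) * w^-1 ^+ M.
  rewrite (le_trans (ler_normB _ _))// /B mulrDl mulrDl; apply: lerD.
    rewrite (le_trans (h1 x xi))// -!mulrA ler_wpM2l//.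
    rewrite exprM -!exprMn -/M; apply: lerXn2r; rewrite ?nnegrE ?invr_ge0 ?(ltW (W_gt0 _))//.
      by rewrite !mulr_ge0 ?exprn_ge0 ?invr_ge0 ?(ltW w0) ?(ltW t0).
    by rewrite [leRHS]mulrA exprMn.
  rewrite normrM mulrC -mulrA; apply: ler_pM => //; first exact: ampl_bound.
  rewrite ger0_norm ?powR_ge0//.
  have h3 : amp m j <= (2 ^+ j) ^+ M.
    rewrite /amp mulrC powRrM powR_mulrn//; exact: powR_pord.
  rewrite -[leLHS]mulr1; apply: ler_pM; rewrite ?powR_ge0 ?exprn_ege1//.
  rewrite (le_trans h3)// ler_weXn2l//.
  by rewrite leq_pmull// muln_gt0.
rewrite normrM [`|gauss _ _|]ger0_norm ?(ltW (gauss_gt0 _ _))//.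
rewrite (le_trans (ler_pM _ _ hD (h2 (xi - om))))// ?(ltW (gauss_gt0 _ _))// -/w.
have wQ : w ^+ Q <= ((16 * 16) * u ^+ 2) ^+ Q.
  by apply: lerXn2r; rewrite ?nnegrE ?(ltW w0)// mulr_ge0// exprn_ge0// ltW.
rewrite (_ : _ * (C2 * w ^+ (M + 1 + Q)) = B * C2 * (2 ^+ j) ^+ (2 * n * M) * w * (w^-1 ^+ M * w ^+ M) * w ^+ Q); last first.
  by rewrite !exprD expr1; ring.
rewrite -exprMn mulVf ?gt_eqF// expr1n mulr1.
have cc : 0 <= B * C2 * (2 ^+ j) ^+ (2 * n * M) * w.
  by rewrite !mulr_ge0 ?exprn_ge0 ?(ltW w0)// ltW.
rewrite (le_trans (ler_wpM2l cc wQ))// exprMn.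
have e2 : (2 ^+ j) ^+ (2 * n * M) * (u ^+ 2) ^+ Q = (u ^+ K) ^+ 2.
  rewrite -[(u ^+ 2) ^+ Q]exprM /Q mulnDr exprD mulnA mulrA -exprMn [2 ^+ j * u]mulrC ut expr1n mul1r.
  by rewrite -exprM mulnC.
rewrite (_ : _ * ((16 * 16) ^+ Q * _) = B * C2 * (16 * 16) ^+ Q * w * ((2 ^+ j) ^+ (2 * n * M) * (u ^+ 2) ^+ Q)); last by ring.
rewrite e2 -/u.
rewrite (_ : B * C2 * (16 * 16) ^+ Q * u ^+ K * w = B * C2 * (16 * 16) ^+ Q * w * u ^+ K); last by ring.
apply: ler_wpM2l; first by rewrite !mulr_ge0 ?exprn_ge0 ?(ltW w0).
rewrite expr2 ler_piMr ?exprn_ge0 ?(ltW u0)// exprn_ile1 ?(ltW u0)//.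
by rewrite /u invf_le1.
Qed.

(** With the symbol frozen at its plateau value the integral is Fourier inversion. The rest is the
    integral of the difference, bounded by [pdo_mode_err_bound] after translation by [om]. *)
Lemma pdo_mode_err a K : 0 < a -> exists2 C, 0 <= C & forall j (om x : V),
  (forall i, `|om 0 i - 2 ^+ j| <= 2 ^+ j / 16) ->
  cmod (pdo sy (mode a om) x - (kap a * (amp m j * ampl j x))%:C%C * mode a om x) <= C * (2 ^- j) ^+ K.
Proof.
move=> a0; have a0' : 0 < a^-1 by rewrite invr_gt0.
have [C C0 hC] := pdo_mode_err_bound K a0.
have c0 := cgauss_gt0 (k := n) a0.
have p0 : 0 < (2 * pi) ^- n :> R by rewrite invr_gt0 exprn_gt0// mulr_gt0// pi_gt0.
exists ((2 * pi) ^- n * (2 * (cg a * C) * Iw ^+ n)).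
  by rewrite !mulr_ge0 ?exprn_ge0 ?Iw_ge0// ltW.
move=> j om x hom.
pose F (xi : V) := cexp (dotv x xi) *
  (cg a * ((ss (row_mx x xi) - amp m j * ampl j x) * gauss a^-1 (xi - om)))%:C%C.
have dm : domc (fun xi => cexp (dotv x xi) * fourier (mode a om) xi).
  rewrite (_ : (fun xi => _) = fun xi => (cg a * gauss a^-1 (xi - om))%:C%C * cexp (dotv x xi)); last first.
    by apply/funext => xi; rewrite fourier_mode// mulrC.
  apply: (@domc_mul_bounded _ _ _ _ 1); last by move=> xi; rewrite cmod_cexp.
    by split; [apply: domZ; exact: dom_shift (gauss_dom a0')|exact: dom0].
  by apply: ccont_cexp; exact: continuous_dotv.
have dF : F = fun xi => pint a om x xi + (- (amp m j * ampl j x)%:C%C) * (cexp (dotv x xi) * fourier (mode a om) xi).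
  by apply/funext => xi; rewrite /F pintE// fourier_mode// !(rmorphM, rmorphB) /=; ring.
have -> : pdo sy (mode a om) x - (kap a * (amp m j * ampl j x))%:C%C * mode a om x = ((2 * pi) ^- n)%:C%C * Cint F.
  rewrite dF CintD; [|exact: pint_domc|exact: domcZ].
  rewrite CintZ// fourier_inv_mode// mulrDr; congr (_ + _).
  by rewrite /kap !rmorphM /=; ring.
rewrite cmodM cmod_real ger0_norm ?(ltW p0)// -[leRHS]mulrA; apply: ler_wpM2l; first exact: ltW.
rewrite -(Cint_translate om); last first.
  by rewrite dF; apply: domcD; [exact: pint_domc|exact: domcZ].
rewrite (_ : 2 * _ * _ * _ = 2 * (cg a * C * (2 ^- j) ^+ K) * Iw ^+ n); last by ring.
apply: Cint_bound.
  have dcF : domc F by rewrite dF; apply: domcD; [exact: pint_domc|exact: domcZ].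
  have [cF _] := (domcP F).1 dcF.
  split; [exact: (cts_comp (@cts_addcst _ _ om) cF.1)|exact: (cts_comp (@cts_addcst _ _ om) cF.2)].
move=> xi; rewrite /F cmodM cmod_cexp mul1r cmod_real normrM ger0_norm ?(ltW c0)//.
rewrite -!mulrA; apply: ler_wpM2l; first exact: ltW.
by have := hC j om x (xi + om) hom; rewrite addrK -mulrA.
Qed.

End pdo.
End action_on_modes.

(** * Mixed norms and short-time Fourier transforms of modulated Gaussians *)

Section modulation_norm.
Context {R : realType} {n : nat}.
Notation mu := (@lebesgue_measure R).
Notation V := 'rV[R]_n.
Implicit Types (x y xi eta om : V) (a p q : R).

Definition mixed_norm p q (G : V -> V -> R) : \bar R :=
  poweR (Eint (fun xi => poweR (Eint (fun x => (powR (G x xi) p)%:E)) (q / p))) q^-1.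

Lemma Mnorm_mixed p q gam f : Mnorm p q gam f = mixed_norm p q (fun x xi => cmod (stft gam f x xi)).
Proof. by []. Qed.

Lemma Eint_ge0 (F : V -> \bar R) : (forall x, 0 <= F x)%E -> (0 <= Eint F)%E.
Proof. exact: iEint_ge0. Qed.

Lemma le_poweR (x y : \bar R) r : 0 <= r -> (0 <= x)%E -> (x <= y)%E -> (poweR x r <= poweR y r)%E.
Proof.
move=> r0 x0 xy; apply: gt0_ler_poweR => //; rewrite in_itv/= leey andbT//.
exact: le_trans x0 xy.
Qed.

Lemma mixed_norm_le p q (G H : V -> V -> R) : 0 < p -> 0 < q ->
  (forall x xi, 0 <= G x xi <= H x xi) -> (mixed_norm p q G <= mixed_norm p q H)%E.
Proof.
move=> p0 q0 GH; apply: le_poweR; first by rewrite invr_ge0 ltW.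
  by apply: Eint_ge0 => xi; exact: poweR_ge0.
apply: iEint_le => xi; first exact: poweR_ge0.
apply: le_poweR; first by rewrite divr_ge0 ?ltW.
  by apply: Eint_ge0 => x; rewrite lee_fin powR_ge0.
apply: iEint_le => x; first by rewrite lee_fin powR_ge0.
have /andP[h1 h2] := GH x xi.
by rewrite lee_fin ge0_ler_powR ?nnegrE ?(ltW p0)//; exact: le_trans h2.
Qed.

(** The roots are built into the function so that the powers [p] and [q] of the mixed norm turn it
    into plain tensor products. *)
Lemma mixed_norm_tensor p q C (phi psi : 'I_n -> R -> R) (A B : 'I_n -> R) : 0 < p -> 0 < q -> 0 <= C ->
  (forall i t, 0 <= phi i t) -> (forall i, measurable_fun setT (phi i)) ->
  (forall i, \int[mu]_t (phi i t)%:E = (A i)%:E)%E ->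
  (forall i t, 0 <= psi i t) -> (forall i, measurable_fun setT (psi i)) ->
  (forall i, \int[mu]_t (psi i t)%:E = (B i)%:E)%E ->
  mixed_norm p q (fun x xi => C * powR (\prod_i phi i (x 0 i)) p^-1 * powR (\prod_i psi i (xi 0 i)) q^-1) =
  (C * powR (\prod_i A i) p^-1 * powR (\prod_i B i) q^-1)%:E.
Proof.
move=> p0 q0 C0 f0 mf If g0 mg Ig.
have A0 : 0 <= \prod_i A i.
  apply: prodr_ge0 => i _; rewrite -lee_fin -If; apply: integral_ge0 => t _; rewrite lee_fin//.
have B0 : 0 <= \prod_i B i.
  apply: prodr_ge0 => i _; rewrite -lee_fin -Ig; apply: integral_ge0 => t _; rewrite lee_fin//.
have P0 x : 0 <= \prod_i phi i (x 0 i) by exact: prodr_ge0.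
have Q0 xi : 0 <= \prod_i psi i (xi 0 i) by exact: prodr_ge0.
have rK (r u : R) : 0 < r -> 0 <= u -> powR (powR u r^-1) r = u.
  by move=> r0 u0; rewrite -powRrM mulVf ?powRr1// gt_eqF.
rewrite /mixed_norm.
have E xi : poweR (Eint (fun x => (powR (C * powR (\prod_i phi i (x 0 i)) p^-1 * powR (\prod_i psi i (xi 0 i)) q^-1) p)%:E)) (q / p) =
   (powR C q * powR (\prod_i A i) (q / p) * \prod_i psi i (xi 0 i))%:E.
  rewrite (_ : Eint _ = Eint (fun x : V => ((powR C p * powR (powR (\prod_i psi i (xi 0 i)) q^-1) p) * \prod_i phi i (x 0 i))%:E)); last first.
    congr Eint; apply/funext => x; congr EFin.
    rewrite powRM ?mulr_ge0 ?powR_ge0// powRM ?powR_ge0// rK//; ring.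
  rewrite (Eint_tensor _ f0 mf If) ?mulr_ge0 ?powR_ge0//.
  rewrite poweR_EFin; congr EFin.
  rewrite powRM ?mulr_ge0 ?powR_ge0// powRM ?powR_ge0//.
  rewrite -!powRrM.
  have -> : p * (q / p) = q by rewrite mulrCA divff ?mulr1// gt_eqF.
  have -> : q^-1 * q = 1 by rewrite mulVf// gt_eqF.
  by rewrite powRr1//; ring.
rewrite (_ : Eint _ = Eint (fun xi : V => ((powR C q * powR (\prod_i A i) (q / p)) * \prod_i psi i (xi 0 i))%:E)); last first.
  by congr Eint; apply/funext => xi; exact: E.
rewrite (Eint_tensor _ g0 mg Ig) ?mulr_ge0 ?powR_ge0//.
rewrite poweR_EFin; congr EFin.
rewrite powRM ?mulr_ge0 ?powR_ge0// powRM ?powR_ge0// -!powRrM.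
rewrite mulfV ?gt_eqF// powRr1//; congr (_ * powR _ _ * _).
by rewrite mulrC mulrA mulVf ?mul1r// gt_eqF.
Qed.

Lemma iRint_ge0 s (F : V -> R) x : (forall x, 0 <= F x) -> 0 <= iRint s F x.
Proof.
move=> F0; elim: s x => [|i s IH] x /=; first exact: F0.
by apply: Rintegral_ge0 => t _; exact: IH.
Qed.

Lemma Rint_ge0 (F : V -> R) : (forall x, 0 <= F x) -> 0 <= Rint F.
Proof. exact: iRint_ge0. Qed.

Lemma le_Rint (F G : V -> R) : dom F -> dom G -> (forall x, F x <= G x) -> Rint F <= Rint G.
Proof.
move=> dF dG FG; have : 0 <= Rint (fun x => G x + -1 * F x).
  by apply: Rint_ge0 => x; rewrite mulN1r subr_ge0.
by rewrite RintD// ?RintZ// ?mulN1r ?subr_ge0//; exact: domZ.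
Qed.

Lemma coord_sqr_gauss_dom a (i : 'I_n) : 0 < a -> dom (fun x : V => x 0 i ^+ 2 * gauss a x).
Proof.
move=> a0; split.
  apply: ctsM; last exact: gauss_continuous.
  by under eq_fun do rewrite expr2; apply: ctsM; exact: continuous_coord.
have [C C0 h] := gauss_bound (k := n) 3 a0; exists C => x.
rewrite normrM [`|gauss a x|]ger0_norm ?(ltW (gauss_gt0 _ _))// normrX.
have hx : `|x 0 i| ^+ 2 <= (W x)^-1 ^+ 2.
  by apply: lerXn2r; rewrite ?nnegrE ?coord_W// invr_ge0 ltW// W_gt0.
rewrite (le_trans (ler_pM _ _ hx (h x)))// ?exprn_ge0// ?(ltW (gauss_gt0 _ _))//.
rewrite [W x ^+ 3]exprSr (_ : (W x)^-1 ^+ 2 * (C * (W x ^+ 2 * W x)) = C * W x * ((W x)^-1 * W x) ^+ 2); last by ring.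
by rewrite mulVf ?expr1n ?mulr1// gt_eqF// W_gt0.
Qed.

Lemma Rint_coord_sqr_gauss a i : 0 < a -> Rint (fun x => x 0 i ^+ 2 * gauss a x) = cgauss (k := n) a / a.
Proof.
move=> a0.
have d0 := gauss_dom (k := n) a0.
have d1 := coord_gauss_dom (k := n) i a0.
have d2 := coord_sqr_gauss_dom i a0.
pose F x := x 0 i * gauss a x.
have FE : F = fun x => \prod_j (if j == i then (fun t => t * gs a t) else gs a) (x 0 j).
  apply/funext => x; rewrite /F /gauss (bigD1 i)//= [in RHS](bigD1 i)//= eqxx mulrA; congr (_ * _).
  by apply: eq_bigr => j /negbTE ->.
have dF x : is_derive x (unitv i) F (gauss a x + - a * (x 0 i ^+ 2 * gauss a x)).
  have hd : is_derive (x 0 i) 1 (fun t => t * gs a t) (gs a (x 0 i) + - a * (x 0 i ^+ 2 * gs a (x 0 i))).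
    have h := is_deriveM (is_derive_id (x 0 i) (1 : R)) (is_derive_gs a (x 0 i)).
    by apply: (is_derive_eq h); rewrite /GRing.scale /=; ring.
  rewrite FE; have h := @is_derive_tensor R n (fun j => if j == i then (fun t => t * gs a t) else gs a)
    (fun j t => gs a t + - a * (t ^+ 2 * gs a t)) i x.
  rewrite eqxx in h; apply: (is_derive_eq (h hd)).
  rewrite (bigD1 i)//= eqxx; set P := \prod_(j < n | _) _.
  have -> : P = \prod_(j < n | j != i) gs a (x 0 j) by apply: eq_bigr => j /negbTE ->.
  have -> : gauss a x = gs a (x 0 i) * \prod_(j < n | j != i) gs a (x 0 j) by rewrite /gauss (bigD1 i).
  ring.
have DE : 'D_(unitv i) F = fun x => gauss a x + - a * (x 0 i ^+ 2 * gauss a x).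
  by apply/funext => x; have /@derive_val := dF x.
have dD : dom ('D_(unitv i) F) by rewrite DE; apply: domD => //; exact: domZ.
have [_ [C bD]] := dD.
have := @Rint_derive_eq0 R n F i C d1 (fun x => @ex_derive _ _ _ _ _ _ _ (dF x)) dD.1 bD.
rewrite DE RintD//; last exact: domZ.
rewrite RintZ// => /eqP; rewrite addr_eq0 mulNr opprK /cgauss => /eqP ->.
by rewrite mulrAC divff ?mul1r// gt_eqF.
Qed.

(* The contribution of [t] far from [0] is controlled by Chebyshev's inequality with the
   second moments of the Gaussian. *)
Lemma gauss_concentrates (c : V -> R) y0 : continuous c -> (exists B : R, forall x, `|c x| <= B) ->
  c y0 != 0 -> exists2 a, 0 < a & Rint (fun t => gauss a t * c (t + y0)) != 0.
Proof.
wlog c0 : c / 0 < c y0.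
  move=> H cc [B bc] cy; have [p|p|e] := ltgtP (c y0) 0; last by rewrite e eqxx in cy.
    have [||||a a0 ha] := H (fun x => - c x).
    - by rewrite oppr_gt0.
    - exact: ctsN.
    - by exists B => x; rewrite normrN.
    - by rewrite oppr_eq0.
    exists a => //; apply: contra ha => /eqP e.
    have d : dom (fun t => gauss a t * c (t + y0)).
      apply: (@dom_mul_bounded _ _ _ _ B) => //; first exact: gauss_dom.
      exact: (cts_comp (@cts_addcst _ _ y0) cc).
    rewrite (_ : Rint _ = -1 * Rint (fun t => gauss a t * c (t + y0))); first by rewrite e mulr0.
    by rewrite -RintZ//; apply: eq_Rint => t; ring.
  by apply: (H c) => //; exists B.
move=> cc [B bc] _.
have B0 : 0 <= B by exact: le_trans (normr_ge0 _) (bc 0).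
pose k := c y0 / 2; have k0 : 0 < k by rewrite divr_gt0.
have [r r0 hr] : exists2 r : R, 0 < r & forall t : V, (forall i, `|t 0 i| <= r) -> k <= c (t + y0).
  have /cvgrPdist_lt/(_ k k0) := cc y0; move=> /nbhs_normP[r /= r0 h].
  exists (r / 2); first by rewrite divr_gt0.
  move=> t ht; have /h : ball_ Num.norm y0 r (t + y0).
    rewrite /ball_ /= opprD addrCA subrr addr0 normrN.
    apply: (@le_lt_trans _ _ (r / 2)); last by lra.
    rewrite /Num.norm /= mx_normrE; apply: bigmax_le => [|[i j] _ /=]; first by lra.
    by rewrite ord1.
  by rewrite ltr_norml => /andP[_]; rewrite /k; lra.
pose D := (B + k) * (r ^+ 2)^-1.
have D0 : 0 <= D by rewrite mulr_ge0 ?addr_ge0 ?(ltW k0)// invr_ge0 exprn_ge0// (ltW r0).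
have low (t : V) : k - D * \sum_i t 0 i ^+ 2 <= c (t + y0).
  have [h|] := pselect (forall i, `|t 0 i| <= r).
    rewrite (le_trans _ (hr t h))// gerBl mulr_ge0// sumr_ge0// => i _; exact: sqr_ge0.
  move=> /existsNP[i /negP]; rewrite -ltNge => hi.
  have : B + k <= D * \sum_i t 0 i ^+ 2.
    rewrite /D -mulrA ler_peMr ?addr_ge0 ?(ltW k0)//.
    rewrite mulrC ler_pdivlMr ?exprn_gt0// mul1r (bigD1 i)//= -[leLHS]addr0; apply: lerD.
      rewrite -[leRHS]real_normK ?num_real//; apply: lerXn2r; rewrite ?nnegrE ?(ltW r0)//; exact: ltW.
    by apply: sumr_ge0 => j _; exact: sqr_ge0.
  by have := bc (t + y0); rewrite ler_norml => /andP[h _]; lra.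
pose a := D * n%:R / k + 1.
have a0 : 0 < a by rewrite ltr_wpDl// divr_ge0 ?(ltW k0)// mulr_ge0.
exists a => //; rewrite gt_eqF//.
have dg := gauss_dom (k := n) a0.
have dq (i : 'I_n) := coord_sqr_gauss_dom i a0.
apply: (@lt_le_trans _ _ (Rint (fun t => k * gauss a t + (- D) * \sum_i (t 0 i ^+ 2 * gauss a t)))); last first.
  apply: le_Rint.
  - by apply: domD; apply: domZ => //; exact: dom_sum.
  - apply: (@dom_mul_bounded _ _ _ _ B) => //.
    exact: (cts_comp (@cts_addcst _ _ y0) cc).
  - move=> t; have := ler_wpM2l (ltW (gauss_gt0 a t)) (low t).
    by apply: le_trans; rewrite -mulr_suml; lra.
rewrite RintD; [|exact: domZ|by apply: domZ; exact: dom_sum].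
rewrite RintZ// RintZ; last exact: dom_sum.
rewrite Rint_sum// (eq_bigr (fun=> cgauss (k := n) a / a)); last by move=> i _; rewrite Rint_coord_sqr_gauss.
rewrite sumr_const card_ord -[_ *+ n]mulr_natl -/(cgauss a).
have cg := cgauss_gt0 (k := n) a0.
rewrite (_ : k * _ + _ = cgauss (k := n) a / a * (k * a - D * n%:R)); last first.
  have e : cgauss (k := n) a / a * a = cgauss (k := n) a by rewrite divfK// gt_eqF.
  by rewrite -{1}e; ring.
rewrite mulr_gt0 ?divr_gt0// /a mulrDr mulr1 [k * _]mulrC divfK ?gt_eqF//.
by rewrite addrAC subrr add0r.
Qed.

(** At frequency [0] and position [- y0] the transform integrates a centered Gaussian against the
    conjugate of [gam (t + y0)]; a narrow Gaussian isolates whichever of the real and imaginary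
    parts is nonzero at [y0]. *)
Lemma Astft_nonvanishing (gam : V -> R[i]) : schwartz gam -> (exists x, gam x != 0) ->
  exists2 a, 0 < a & exists x0, Astft (gauss a) gam x0 0 != 0.
Proof.
move=> sg [y0 hy].
have [c1 c2] : continuous (fun x => cre (gam x)) /\ continuous (fun x => cim (gam x)).
  by have [[s1 s2] _] := sg; split; exact: smooth_continuous.
have [B hB] : exists B, forall x, cmod (gam x) <= B.
  have [C hC] := schwartz_W [::] sg; exists `|C| => x.
  rewrite (le_trans (hC x))// (le_trans (ler_wpM2r (ltW (W_gt0 x)) (ler_norm C)))//.
  by rewrite ler_piMr// W_le1.
have d0 (t : V) : dotv (0 : V) t = 0 by rewrite /dotv big1// => j _; rewrite mxE mul0r.
have sa a : 0 < a -> sbd (fun (_ : unit) x => W x * W x) (fun _ => gauss a : V -> R).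
  move=> a0; apply: (@sbd_le _ _ _ _ _ 1 _ _ (gauss_sbd (k := n) 2 a0)) => _ x.
  by rewrite exprn_ge0 ?(ltW (W_gt0 _))//= mul1r expr2.
have [h|h] := eqVneq (cre (gam y0)) 0.
  have h' : cim (gam y0) != 0.
    apply: contra hy => /eqP e; apply/eqP; apply: complex_ext; rewrite ?h ?e//.
  have [|a a0 ha] := gauss_concentrates c2 _ h'.
    by exists B => x; exact: le_trans (cim_le_cmod _) (hB x).
  exists a => //; exists (- y0); apply: contra ha => /eqP e.
  have := Astft_im sg (sa a a0) (- y0) 0; rewrite e /Josc.
  rewrite (eq_Rint (G := fun=> 0)); last by move=> t; rewrite d0 add0r cos_pihalf mulr0.
  rewrite Rint_cst0 add0r mulN1r => /eqP; rewrite -[cim 0]/(0 : R) eq_sym oppr_eq0 => /eqP e2.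
  apply/eqP; rewrite -[RHS]e2; apply: eq_Rint => t.
  by rewrite d0 addr0 cos0 mulr1 opprK.
have [|a a0 ha] := gauss_concentrates c1 _ h.
  by exists B => x; exact: le_trans (cre_le_cmod _) (hB x).
exists a => //; exists (- y0); apply: contra ha => /eqP e.
have := Astft_re sg (sa a a0) (- y0) 0; rewrite e /Josc.
rewrite [X in _ + X](eq_Rint (G := fun=> 0)); last by move=> t; rewrite d0 add0r cos_pihalf mulr0.
rewrite Rint_cst0 addr0 => e2.
apply/eqP; rewrite -[RHS]/(cre (0 : R[i])) e2; apply: eq_Rint => t.
by rewrite d0 addr0 cos0 mulr1 opprK.
Qed.

Lemma schwartz_of_sbd (f : V -> R[i]) :
  (forall M, sbd (fun (_ : unit) x => W x ^+ M) (fun _ x => cre (f x))) ->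
  (forall M, sbd (fun (_ : unit) x => W x ^+ M) (fun _ x => cim (f x))) -> schwartz f.
Proof.
move=> h1 h2; split; first by split; [exact: (h1 0%N).1 tt|exact: (h2 0%N).1 tt].
move=> l s; have [C1 b1] := (h1 (size l)).2 s; have [C2 b2] := (h2 (size l)).2 s.
exists (C1 + C2) => x.
have hc : cmod (cpderiv s f x) <= (C1 + C2) * W x ^+ size l.
  rewrite (le_trans (cmod_le_add _))// mulrDl; apply: lerD; [exact: b1 tt x|exact: b2 tt x].
have hl : `|\prod_(i <- l) x 0 i| <= (W x)^-1 ^+ size l.
  elim: l {hc b1 b2} => [|i l IH]; first by rewrite big_nil normr1 expr0.
  by rewrite big_cons normrM exprS ler_pM// coord_W.
rewrite (le_trans (ler_pM _ _ hl hc)) ?cmod_ge0//.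
have e : (W x)^-1 ^+ size l * W x ^+ size l = 1 by rewrite -exprMn mulVf ?expr1n// gt_eqF// W_gt0.
by rewrite mulrCA e mulr1.
Qed.

Lemma mode_sum_sbd (I : Type) (r : seq I) (b : I -> R) (om : I -> V) a p M : 0 < a ->
  sbd (fun (_ : unit) x => W x ^+ M) (fun _ x => \sum_(i <- r) b i * (cos (dotv (om i) x + p) * gauss a x)).
Proof.
move=> a0; have sc i : sbd (fun (_ : unit) x => W x ^+ M) (fun _ x => cos (dotv (om i) x + p) * gauss a x).
  apply: (@sbd_le _ _ _ (fun (_ : unit) x => 1 * W x ^+ M) _ 1).
    by move=> _ x; rewrite !mul1r exprn_ge0//=; apply: ltW; exact: W_gt0.
  apply: (@sbdM _ _ _ (fun (_ : unit) (_ : V) => 1) (fun (_ : unit) x => W x ^+ M)); last exact: gauss_sbd.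
  split=> [_|s]; first exact: smooth_cos.
  exists `|\prod_(j <- s) om i 0 j| => _ x; rewrite pderiv_cos normrM mulr1 ler_piMr//.
  by rewrite ler_norml cos_geN1 cos_le1.
elim: r => [|i r IH].
  have -> : (fun (_ : unit) (x : V) => \sum_(i <- [::]) b i * (cos (dotv (om i) x + p) * gauss a x)) = fun _ _ => 0.
    by apply/funext => _; apply/funext => x; rewrite big_nil.
  split=> [_|s]; first exact: smooth_cst.
  by exists 0 => _ x; rewrite pderiv_cst mul0r; case: s => [|? ?]; rewrite normr0.
have -> : (fun (_ : unit) (x : V) => \sum_(j <- i :: r) b j * (cos (dotv (om j) x + p) * gauss a x)) =
    fun _ x => b i * (cos (dotv (om i) x + p) * gauss a x) +
      \sum_(j <- r) b j * (cos (dotv (om j) x + p) * gauss a x).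
  by apply/funext => _; apply/funext => x; rewrite big_cons.
by apply: sbdD => //; exact: sbdZ (sc i).
Qed.

Lemma mode_sum_schwartz (I : Type) (r : seq I) (b : I -> R) (om : I -> V) a : 0 < a ->
  schwartz (fun x => \sum_(i <- r) (b i)%:C%C * mode a (om i) x).
Proof.
move=> a0; apply: schwartz_of_sbd => M.
  have -> : (fun (_ : unit) x => cre (\sum_(i <- r) (b i)%:C%C * mode a (om i) x)) =
      fun _ x => \sum_(i <- r) b i * (cos (dotv (om i) x + 0) * gauss a x).
    apply/funext => _; apply/funext => x; rewrite cre_sum; apply: eq_bigr => i _.
    by rewrite !creM !cimM !cre_real !cim_real mul0r mulr0 !subr0 addr0.
  exact: mode_sum_sbd.
have -> : (fun (_ : unit) x => cim (\sum_(i <- r) (b i)%:C%C * mode a (om i) x)) =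
    fun _ x => \sum_(i <- r) b i * (cos (dotv (om i) x + - (pi / 2)) * gauss a x).
  apply/funext => _; apply/funext => x; rewrite cim_sum; apply: eq_bigr => i _.
  by rewrite !cimM !cim_real mul0r !cre_real mulr0 add0r addr0 cosBpihalf.
exact: mode_sum_sbd.
Qed.

Section stft_lin.
Variables (gam : V -> R[i]) (a : R).
Hypothesis sgam : schwartz gam.
Hypothesis a0 : 0 < a.

Lemma gam_shift_domc x : domc (fun t => cconj (gam (t - x))).
Proof.
have [s1 s2] := schwartz_sbd sgam.
have h (c : V -> R) : sbd (fun (_ : unit) x => W x) (fun _ => c) -> dom c.
  move=> sc; split; first exact: smooth_continuous (sc.1 tt).
  by have [C hC] := sc.2 [::]; exists C => y; exact: hC tt y.
split; first exact: dom_shift (- x) (h _ s1).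
rewrite (_ : (fun t => _) = fun t => -1 * cim (gam (t - x))); last by apply/funext => t; rewrite mulN1r.
apply: domZ; exact: dom_shift (- x) (h _ s2).
Qed.

Lemma stft_integrand_domc (f : V -> R[i]) B x xi : ccont f -> (forall t, cmod (f t) <= B) ->
  domc (fun t => f t * cconj (gam (t - x)) * cexp (- dotv xi t)).
Proof.
move=> cf bf; rewrite (_ : (fun t => _) = fun t => cconj (gam (t - x)) * (f t * cexp (- dotv xi t))).
  apply: (@domc_mul_bounded _ _ _ _ B); first exact: gam_shift_domc.
    by apply: ccontM => //; apply: ccont_cexp; apply: ctsN; exact: continuous_dotv.
  by move=> t; rewrite cmodM cmod_cexp mulr1.
by apply/funext => t; ring.
Qed.

Lemma mode_ccont om : ccont (mode a om : V -> R[i]).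
Proof. by have [h _] := (domcP _).1 (mode_domc om a0). Qed.

Lemma mode_cmod_bound : exists2 B, 0 <= B & forall om x, cmod (mode a om x) <= B.
Proof.
have [C C0 h] := gauss_bound (k := n) 0 a0; exists C => // om x.
rewrite /mode cmodM cmod_cexp mul1r cmod_real ger0_norm ?(ltW (gauss_gt0 _ _))//.
by have := h x; rewrite expr0 mulr1.
Qed.

Lemma stft_mode om x xi : stft gam (mode a om) x xi = Astft (gauss a) gam x (xi - om).
Proof.
apply: eq_Cint => t; rewrite /mode.
have -> : cexp (- dotv (xi - om) t) = cexp (dotv om t) * cexp (- dotv xi t).
  by rewrite -cexpD dotvDl dotvNl opprB.
ring.
Qed.

Lemma stft_expand (I : Type) (r : seq I) (b : I -> R) (om : I -> V) (E : V -> R[i]) B x xi :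
  ccont E -> (forall t, cmod (E t) <= B) ->
  stft gam (fun t => (\sum_(i <- r) (b i)%:C%C * mode a (om i) t) + E t) x xi =
  (\sum_(i <- r) (b i)%:C%C * Astft (gauss a) gam x (xi - om i)) + stft gam E x xi.
Proof.
move=> cE bE; have [Bm _ hBm] := mode_cmod_bound.
have dm i := stft_integrand_domc x xi (mode_ccont (om i)) (hBm (om i)).
have dE := stft_integrand_domc x xi cE bE.
rewrite [RHS](_ : _ = (\sum_(i <- r) Cint (fun t => (b i)%:C%C * (mode a (om i) t * cconj (gam (t - x)) * cexp (- dotv xi t)))) + stft gam E x xi); last first.
  by congr (_ + _); apply: eq_bigr => i _; rewrite CintZ// -stft_mode.
rewrite -Cint_sum; last by move=> i; apply: domcZ.
rewrite /stft -CintD//; last by apply: domc_sum => i; exact: domcZ.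
apply: eq_Cint => t; rewrite !mulrDl !mulr_suml; congr (_ + _).
by apply: eq_bigr => i _; rewrite !mulrA.
Qed.

(** The error of the operator enters the lower estimate pointwise, on boxes, so a uniform bound of
    its transform suffices; it follows from integrability of the window. *)
Lemma stft_small : exists2 Cg, 0 <= Cg & forall (E : V -> R[i]) B x xi,
  ccont E -> (forall t, cmod (E t) <= B) -> cmod (stft gam E x xi) <= Cg * B.
Proof.
have [C hC] := schwartz_W [::] sgam.
have C0 : 0 <= C by have := le_trans (cmod_ge0 _) (hC 0); rewrite pmulr_lge0// W_gt0.
exists (2 * C * Iw ^+ n); first by rewrite !mulr_ge0// exprn_ge0// Iw_ge0.
move=> E B x xi cE bE.
rewrite /stft -(@Cint_translate _ _ _ x); last exact: stft_integrand_domc bE.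
have B0 : 0 <= B by exact: le_trans (cmod_ge0 _) (bE 0).
rewrite (_ : 2 * C * Iw ^+ n * B = 2 * (C * B) * Iw ^+ n); last by ring.
have [[cc1 cc2] _] := (domcP _).1 (stft_integrand_domc x xi cE bE).
apply: Cint_bound.
  by split; [exact: (cts_comp (@cts_addcst _ _ x) cc1)|exact: (cts_comp (@cts_addcst _ _ x) cc2)].
move=> t; rewrite !cmodM cmod_cexp mulr1 cmod_conj addrK mulrC mulrAC.
by rewrite ler_pM ?cmod_ge0//; exact: hC.
Qed.

End stft_lin.
End modulation_norm.

(** * Trigonometric sums with lattice frequencies *)

Section exponential_sums.
Context {R : realType}.

Section lattice.
Implicit Types (T : finType).

Lemma inv_sqr_sum M : \sum_(1 <= d < M.+2) (d%:R ^+ 2 : R)^-1 <= 2 - M.+1%:R^-1.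
Proof.
elim: M => [|M IH]; first by rewrite big_nat1 expr1n invr1; lra.
rewrite big_nat_recr//= (le_trans (lerD IH (lexx _)))//.
have x0 : 0 < M.+1%:R :> R by rewrite ltr0n.
have e : (M.+2%:R : R) = M.+1%:R + 1 by rewrite -natr1.
rewrite e; move: x0; move: (M.+1%:R) => x x0.
have y0 : 0 < x + 1 by lra.
rewrite -subr_ge0 (_ : _ - _ = (x * (x + 1) ^+ 2)^-1); last first.
  by field; rewrite !gt_eqF.
by rewrite invr_ge0 mulr_ge0 ?exprn_ge0 ?(ltW x0) ?(ltW y0).
Qed.

(** Each absolute value is taken at most twice, and the sum of [1 / d^2] is at most [2] by
    telescoping. *)
Lemma sum_inv_sqr_int T (y : T -> int) : injective y ->
  \sum_(t | y t != 0) (((y t)%:~R : R) ^+ 2)^-1 <= 4.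
Proof.
move=> iy.
pose M := \max_(t : T) `|y t|%N.
have hM t : (`|y t|%N < M.+2)%N by rewrite ltnS leqW// (leq_bigmax t).
rewrite (partition_big (fun t => Ordinal (hM t)) (fun d => 0 < d)%N) /=; last first.
  by move=> t; rewrite absz_gt0.
apply: (@le_trans _ _ (\sum_(d < M.+2 | (0 < d)%N) 2 * ((d%:R : R) ^+ 2)^-1)).
  apply: ler_sum => d d0.
  rewrite (eq_bigr (fun=> ((d%:R : R) ^+ 2)^-1)); last first.
    move=> t /andP[_ /eqP <-] /=; congr (_^-1).
    by rewrite -[LHS]real_normK ?num_real// -intr_norm natr_absz.
  rewrite sumr_const -[leLHS]mulr_natl ler_wpM2r ?invr_ge0 ?sqr_ge0// ler_nat.
  rewrite cardE -(size_map y); apply: (@uniq_leq_size _ _ [:: (d : nat)%:Z; - (d : nat)%:Z]).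
    by rewrite map_inj_uniq ?enum_uniq.
  move=> y0 /mapP[t]; rewrite mem_enum inE => /andP[_ /eqP <-] ->{y0} /=.
  by rewrite !inE; case: (y t) => k /=; rewrite ?eqxx ?orbT// NegzE abszN eqxx orbT.
rewrite -mulr_sumr (_ : 4 = 2 * 2); last by ring.
rewrite ler_wpM2l// -(big_mkord (fun d => 0 < d)%N (fun d => ((d%:R : R) ^+ 2)^-1)).
rewrite big_mkcond big_ltn//= add0r.
rewrite (eq_big_nat _ _ (F2 := fun d => ((d%:R : R) ^+ 2)^-1)); last by move=> d /andP[->].
by rewrite (le_trans (inv_sqr_sum M))// gerBl invr_ge0.
Qed.

Lemma int_ge1 (m : int) : m != 0 -> 1 <= `|m%:~R : R|.
Proof. by move=> m0; rewrite -intr_norm -[1]/(1%:~R) ler_int -gtz0_ge1 normr_gt0. Qed.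

Lemma w1_far (L S s : R) (m : int) : 0 < L -> 2 * S <= L -> `|s| <= S -> m != 0 ->
  w1 (s - m%:~R * L) <= 4 / L ^+ 2 * ((m%:~R : R) ^+ 2)^-1.
Proof.
move=> L0 SL sS m0; have m1 := int_ge1 m0.
have h : `|m%:~R : R| * L / 2 <= `|s - m%:~R * L|.
  have : `|m%:~R * L| - `|s| <= `|s - m%:~R * L| by rewrite distrC lerB_dist.
  rewrite normrM (ger0_norm (ltW L0)).
  have := ler_wpM2r (ltW L0) m1; lra.
have p : 0 < `|m%:~R : R| * L / 2 by rewrite divr_gt0 ?mulr_gt0// (lt_le_trans ltr01).
have h2 : (`|m%:~R : R| * L / 2) ^+ 2 <= (s - m%:~R * L) ^+ 2.
  by rewrite -[leRHS]real_normK ?num_real//; apply: lerXn2r; rewrite ?nnegrE ?(ltW p).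
have -> : 4 / L ^+ 2 * ((m%:~R : R) ^+ 2)^-1 = ((`|m%:~R : R| * L / 2) ^+ 2)^-1.
  rewrite -[(m%:~R) ^+ 2]real_normK ?num_real//.
  field; rewrite !gt_eqF//; exact: lt_le_trans ltr01 m1.
rewrite /w1 lef_pV2 ?posrE ?exprn_gt0//; last by rewrite ltr_wpDr// sqr_ge0.
by rewrite (le_trans h2)// lerDr.
Qed.

(** The benefit of sparse frequencies: the joint contribution of all other lattice points tends to
    zero as [L] grows, however many there are. *)
Lemma far_sum T (z : T -> int) z0 (L S s : R) : injective z -> 0 < L -> 2 * S <= L -> `|s| <= S ->
  \sum_(t | z t != z0) w1 (s - (z t - z0)%:~R * L) <= 16 / L ^+ 2.
Proof.
move=> iz L0 SL sS; have iy : injective (fun t => z t - z0) by move=> t t' /addIr /iz.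
apply: (@le_trans _ _ (\sum_(t | z t - z0 != 0) 4 / L ^+ 2 * (((z t - z0)%:~R : R) ^+ 2)^-1)).
  rewrite (eq_bigl (fun t => z t - z0 != 0)); last by move=> t; rewrite subr_eq0.
  apply: ler_sum => t ht; apply: (@w1_far L S s) => //.
rewrite -mulr_sumr (_ : 16 / L ^+ 2 = 4 / L ^+ 2 * 4); last by ring.
by rewrite ler_wpM2l ?sum_inv_sqr_int// divr_ge0// exprn_ge0// ltW.
Qed.

(** The lattice point just below [s] contributes at most [1], the others at most [4] times the sum
    of inverse squares, hence [1 + 16]. *)
Lemma near_sum T (z : T -> int) (L s : R) : injective z -> 1 <= L ->
  \sum_t w1 (s - (z t)%:~R * L) <= 17.
Proof.
move=> iz L1; have L0 : 0 < L by lra.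
pose z0 := Num.floor (s / L); pose f := s - z0%:~R * L.
have [f0 fL] : 0 <= f /\ f < L.
  have /andP[h1 h2] := floor_itv (s / L).
  rewrite -/z0 ler_pdivlMr// in h1; rewrite -/z0 ltr_pdivrMr// intrD mulrDl mul1r in h2.
  by rewrite /f; split; lra.
have iy : injective (fun t => z t - z0) by move=> t t' /addIr /iz.
have key t : z t != z0 -> w1 (s - (z t)%:~R * L) <= 4 * (((z t - z0)%:~R : R) ^+ 2)^-1.
  move=> hz; have e : s - (z t)%:~R * L = f - (z t - z0)%:~R * L by rewrite /f intrB; ring.
  rewrite e; have : z t - z0 != 0 by rewrite subr_eq0.
  move: (z t - z0) => m m0; have m1 := int_ge1 m0.
  (* The next lattice point may be arbitrarily close to [s]; the trivial bound [w1 <= 1] is used for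
     it. *)
  have [->|hm1] := eqVneq m 1; first by rewrite (le_trans (w1_le1 _))// expr1n invr1; lra.
  have h : `|m%:~R : R| / 2 <= `|f - m%:~R * L|.
    have [mp|mn] := leP 0 m.
      have m2 : 2 <= (m%:~R : R).
        rewrite -[2]/(2%:~R) ler_int; case: m m0 hm1 mp {m1} => [[|[|k]]|]//.
      have := ler_wpM2r (ltW L0) m2; rewrite ger0_norm ?ler0z// => h3.
      rewrite ler0_norm; last by lra.
      have := ler_wpM2l (_ : 0 <= m%:~R - 1 :> R) L1; rewrite mulr1 mulrBl mul1r => h4.
      by have := h4 ltac:(lra); lra.
    have mn' : (m%:~R : R) <= 0 by rewrite lerz0 ltW.
    have := ler_wpM2l (_ : 0 <= - m%:~R :> R) L1; rewrite mulr1 oppr_ge0 => /(_ mn') h4.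
    rewrite ler0_norm// ger0_norm; first by lra.
    by lra.
  have p : 0 < `|m%:~R : R| / 2 by rewrite divr_gt0// (lt_le_trans ltr01).
  have h2 : (`|m%:~R : R| / 2) ^+ 2 <= (f - m%:~R * L) ^+ 2.
    by rewrite -[leRHS]real_normK ?num_real//; apply: lerXn2r; rewrite ?nnegrE ?(ltW p).
  have -> : 4 * ((m%:~R : R) ^+ 2)^-1 = ((`|m%:~R : R| / 2) ^+ 2)^-1.
    rewrite -[(m%:~R) ^+ 2]real_normK ?num_real//.
    field; rewrite !gt_eqF//; exact: lt_le_trans ltr01 m1.
  rewrite /w1 lef_pV2 ?posrE ?exprn_gt0//; last by rewrite ltr_wpDr// sqr_ge0.
  by rewrite (le_trans h2)// lerDr.
rewrite (bigID (fun t => z t == z0))/= (_ : 17 = 1 + 16); last by ring.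
apply: lerD.
  have [t0 /eqP ht0|hn] := pickP (fun t => z t == z0).
    rewrite (eq_bigl (pred1 t0)) ?big_pred1_eq ?w1_le1// => t /=.
    by rewrite -ht0 (inj_eq iz).
  by rewrite big_pred0.
rewrite (le_trans (ler_sum _ key))// -mulr_sumr.
rewrite (eq_bigl (fun t => z t - z0 != 0)); last by move=> t; rewrite subr_eq0.
by have := sum_inv_sqr_int iy; lra.
Qed.

End lattice.

Section coefs.
Variable N : nat.

(* [cos] split into two exponentials: the sign [t.1] and the index [t.2] give the
   frequency [zA t] and the coefficient [bA t]. *)
Definition TA : finType := (bool * 'I_(2 ^ N))%type.
Definition zA (t : TA) : int := if t.1 then - (t.2.+1)%:Z else (t.2.+1)%:Z.
Definition bA (t : TA) : R := rs false N t.2 / (2 * r2 ^+ N).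

(** Indices start at [1], so the two signs never share a frequency. *)
Lemma zA_inj : injective zA.
Proof.
move=> [[] k] [[] k']; rewrite /zA /= => h.
- by move/oppr_inj: h => [] /val_inj ->.
- by exfalso; have : (- (k.+1)%:Z < (k'.+1)%:Z) by []; rewrite h ltxx.
- by exfalso; have : (- (k'.+1)%:Z < (k.+1)%:Z) by []; rewrite -h ltxx.
- by case: h => /val_inj ->.
Qed.

Lemma zA_le t : `|(zA t)%:~R : R| <= 2 ^+ N.
Proof.
have h : (t.2.+1%:R : R) <= 2 ^+ N by rewrite -natrX ler_nat.
by rewrite /zA; case: t.1; rewrite ?intrN ?normrN -pmulrn ger0_norm.
Qed.

Lemma r2N_gt0 : 0 < r2 ^+ N :> R. Proof. by rewrite exprn_gt0// r2_gt0. Qed.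

Lemma bA_norm t : `|bA t| = (2 * r2 ^+ N)^-1.
Proof. by rewrite /bA normrM rs_norm mul1r ger0_norm// invr_ge0 mulr_ge0// ltW// r2N_gt0. Qed.

Lemma card_TA : #|TA| = (2 * 2 ^ N)%N.
Proof. by rewrite card_prod card_bool card_ord. Qed.

Definition flipA (t : TA) : TA := (~~ t.1, t.2).

Lemma zA_flip t : zA (flipA t) = - zA t.
Proof. by rewrite /zA /flipA /=; case: t => [[] k] /=; rewrite ?opprK. Qed.

(* [B] is the trigonometric sum with coefficients [b] and frequencies [th]. *)
Definition expsum (T : finType) (b th : T -> R) (B : R -> R) :=
  forall t, (B t)%:C%C = \sum_u (b u)%:C%C * cexp (th u * t).

Lemma rsA_expsum L : expsum bA (fun t => (zA t)%:~R * L) (rsA N L 0).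
Proof.
move=> t; rewrite -(pair_bigA _ (fun s k => (bA (s, k))%:C%C * cexp ((zA (s, k))%:~R * L * t))) /=.
rewrite big_bool /= -big_split /= /rsA mulr_sumr rmorph_sum /=; apply: eq_bigr => k _.
rewrite /bA /zA /= -mulrDr.
have -> : cexp ((- k.+1%:Z)%:~R * L * t) + cexp ((k.+1%:Z)%:~R * L * t) = (2 * cos (k.+1%:R * L * t))%:C%C.
  rewrite intrN -pmulrn !mulNr; apply: complex_ext; rewrite ?creD ?cimD /cre /cim /= ?cosN ?sinN; ring.
rewrite -rmorphM; congr (_%:C)%C; rewrite expr0 mul1r mul0r addr0.
by have r0 := r2N_gt0; field; rewrite gt_eqF.
Qed.

End coefs.

(** A single packet as a one-term sum, so that both test functions fit the same estimates. *)
Lemma expsum1 : expsum (fun _ : unit => 1) (fun=> 0) (fun=> 1).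
Proof.
move=> t; rewrite (eq_bigr (fun=> 1)); last by move=> u _; rewrite mul0r cexp0 mulr1.
by rewrite sumr_const card_unit.
Qed.

Lemma expsumM (T T' : finType) (b th : T -> R) (b' th' : T' -> R) B B' :
  expsum b th B -> expsum b' th' B' ->
  expsum (fun u : T * T' => b u.1 * b' u.2) (fun u => th u.1 + th' u.2) (fun t => B t * B' t).
Proof.
move=> h h' t; rewrite rmorphM /= h h' mulr_suml.
rewrite -(pair_bigA _ (fun u v => (b u * b' v)%:C%C * cexp ((th u + th' v) * t))) /=.
apply: eq_bigr => u _; rewrite mulr_sumr; apply: eq_bigr => v _.
by rewrite rmorphM mulrDl cexpD /=; ring.
Qed.

Section tensor.
Context {n : nat}.
Notation V := 'rV[R]_n.

Definition tvec (T : Type) (th : T -> R) (u : {ffun 'I_n -> T}) : V := \row_i th (u i).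

Lemma tensor_mode (T : finType) (b th : T -> R) B a (om x : V) : expsum b th B ->
  (\prod_i B (x 0 i))%:C%C * mode a om x =
  \sum_(u : {ffun 'I_n -> T}) (\prod_i b (u i))%:C%C * mode a (om + tvec th u) x.
Proof.
move=> h; rewrite rmorph_prod /= (eq_bigr (fun i => \sum_u (b u)%:C%C * cexp (th u * x 0 i))); last by move=> i _; rewrite h.
rewrite bigA_distr_bigA /= mulr_suml; apply: eq_bigr => u _.
rewrite big_split /= -rmorph_prod /= -mulrA; congr (_ * _).
rewrite /mode dotvDl cexpD mulrA; congr (_ * _); rewrite mulrC; congr (_ * _).
by rewrite -cexp_sum /dotv; congr cexp; apply: eq_bigr => i _; rewrite mxE.
Qed.

(** The bound on the perturbed product is carried along because the error [k i] of a new factor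
    multiplies the whole perturbed product of the others. *)
Lemma prod_diff_seq (I : Type) (r : seq I) (g k : I -> R) (D e : R) : 0 <= D -> (forall i, 0 <= g i <= D) ->
  (forall i, 0 <= k i <= D * e) -> 0 <= e ->
  \prod_(i <- r) (g i + k i) - \prod_(i <- r) g i <= D ^+ size r * ((1 + e) ^+ size r - 1) /\
  \prod_(i <- r) (g i + k i) <= D ^+ size r * (1 + e) ^+ size r.
Proof.
move=> D0 hg ho e0; elim: r => [|i r [IH1 IH2]].
  by rewrite !big_nil !expr0 subrr mulr0 mul1r.
rewrite !big_cons /= !exprS.
have /andP[g0 gD] := hg i; have /andP[k0 kD] := ho i.
have P0 : 0 <= \prod_(j <- r) (g j + k j).
  by apply: prodr_ge0 => j _; have /andP[? _] := hg j; have /andP[? _] := ho j; exact: addr_ge0.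
have G0 : 0 <= \prod_(j <- r) g j by apply: prodr_ge0 => j _; have /andP[] := hg j.
have GP : \prod_(j <- r) g j <= \prod_(j <- r) (g j + k j).
  by apply: ler_prod => j _; have /andP[-> _] := hg j; have /andP[? _] := ho j; rewrite lerDl.
move: IH1 IH2 P0 G0 GP; set P := \prod_(j <- r) (g j + k j); set G := \prod_(j <- r) g j.
set X := D ^+ size r; set Y := (1 + e) ^+ size r => IH1 IH2 P0 G0 GP.
have b1 : g i * (P - G) <= D * (X * (Y - 1)) by apply: ler_pM => //; rewrite subr_ge0.
have b2 : k i * P <= D * e * (X * Y) by exact: ler_pM.
split.
  rewrite (_ : _ - _ = g i * (P - G) + k i * P); last by ring.
  rewrite (le_trans (lerD b1 b2))// le_eqVlt; apply/orP; left; apply/eqP; ring.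
have b3 : g i * P <= D * (X * Y) by exact: ler_pM.
rewrite mulrDl (le_trans (lerD b3 b2))// le_eqVlt; apply/orP; left; apply/eqP; ring.
Qed.

Lemma cmod_sum_cond (I : Type) (r : seq I) (P : pred I) (F : I -> R[i]) :
  cmod (\sum_(i <- r | P i) F i) <= \sum_(i <- r | P i) cmod (F i).
Proof.
by rewrite -big_filter (le_trans (cmod_sum _ _))// big_filter.
Qed.

Lemma expand_upper (T : finType) (b th : T -> R) (A : V -> R[i]) (C : R) (eta : V) :
  (forall e, cmod (A e) <= C * W e) ->
  cmod (\sum_(u : {ffun 'I_n -> T}) (\prod_i b (u i))%:C%C * A (eta - tvec th u)) <=
  C * \prod_i \sum_u `|b u| * w1 (eta 0 i - th u).
Proof.
move=> hA; rewrite bigA_distr_bigA mulr_sumr (le_trans (cmod_sum _ _))//; apply: ler_sum => u _.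
rewrite cmodM cmod_real normr_prod big_split /= mulrCA ler_wpM2l ?prodr_ge0//.
rewrite (le_trans (hA _))// le_eqVlt; apply/orP; left; apply/eqP; congr (_ * _).
by apply: eq_bigr => i _; rewrite !mxE.
Qed.

(* At [zeta + s] the terms with frequency exactly [zeta] add up to [D^n A s]; the others
   are the difference of two products, which is small since the frequencies are sparse. *)
Lemma expand_lower (T : finType) (b th : T -> R) (A : V -> R[i]) (C D e : R) (zeta s : V) :
  0 <= C -> (forall eta, cmod (A eta) <= C * W eta) -> 0 <= e ->
  (forall i, `|\sum_(u | th u == zeta 0 i) b u| = D) ->
  (forall i, \sum_(u | th u == zeta 0 i) `|b u| = D) ->
  (forall i, \sum_(u | th u != zeta 0 i) `|b u| * w1 (zeta 0 i + s 0 i - th u) <= D * e) ->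
  D ^+ n * (cmod (A s) - C * ((1 + e) ^+ n - 1)) <=
  cmod (\sum_(u : {ffun 'I_n -> T}) (\prod_i b (u i))%:C%C * A (zeta + s - tvec th u)).
Proof.
move=> C0 hA e0 H1 H2 H3.
pose P (u : {ffun 'I_n -> T}) := u \in family (fun i => [pred t | th t == zeta 0 i]).
rewrite (bigID P) /=.
have good : \sum_(u | P u) (\prod_i b (u i))%:C%C * A (zeta + s - tvec th u) =
    (\prod_i \sum_(t | th t == zeta 0 i) b t)%:C%C * A s.
  rewrite bigA_distr_big_dep /= rmorph_sum /= mulr_suml.
  apply: eq_big => [u|u /familyP hu]; first by [].
  congr (_ * A _); apply/rowP => i; rewrite !mxE.
  by have := hu i; rewrite inE => /eqP ->; rewrite addrAC subrr add0r.
have cgood : cmod (\sum_(u | P u) (\prod_i b (u i))%:C%C * A (zeta + s - tvec th u)) = D ^+ n * cmod (A s).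
  rewrite good cmodM cmod_real normr_prod (eq_bigr (fun=> D)); last by move=> i _; rewrite H1.
  by rewrite prodr_const card_ord.
have cbad : cmod (\sum_(u | ~~ P u) (\prod_i b (u i))%:C%C * A (zeta + s - tvec th u)) <=
    C * (D ^+ n * ((1 + e) ^+ n - 1)).
  pose F (i : 'I_n) t := `|b t| * w1 (zeta 0 i + s 0 i - th t).
  have F0 i t : 0 <= F i t by rewrite mulr_ge0// ltW// w1_gt0.
  have D0 : (0 < n)%N -> 0 <= D by move=> n0; rewrite -(H1 (Ordinal n0)).
  apply: (@le_trans _ _ (C * (\sum_(u | ~~ P u) \prod_i F i (u i)))).
    rewrite mulr_sumr (le_trans (cmod_sum_cond _ _ _))//; apply: ler_sum => u _.
    rewrite cmodM cmod_real normr_prod big_split /= mulrCA ler_wpM2l ?prodr_ge0//.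
    rewrite (le_trans (hA _))// le_eqVlt; apply/orP; left; apply/eqP; congr (_ * _).
    by apply: eq_bigr => i _; rewrite !mxE.
  apply: ler_wpM2l => //.
  have -> : \sum_(u | ~~ P u) \prod_i F i (u i) =
     \prod_i (\sum_(t | th t == zeta 0 i) F i t + \sum_(t | th t != zeta 0 i) F i t)
     - \prod_i \sum_(t | th t == zeta 0 i) F i t.
    rewrite [X in X - _](eq_bigr (fun i => \sum_t F i t)); last first.
      by move=> i _; rewrite [RHS](bigID (fun t => th t == zeta 0 i)).
    rewrite bigA_distr_bigA [X in X - _](bigID P) /= [X in _ = _ - X]bigA_distr_big_dep /=.
    by rewrite addrAC subrr add0r.
  have [n0|n0] := posnP n.
    have E (G : 'I_n -> R) : \prod_i G i = 1 by rewrite big1// => i _; have := ltn_ord i; rewrite {2}n0.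
    by rewrite !E n0 !expr0 subrr mulr0.
  have D0' := D0 n0.
  have hg i : 0 <= \sum_(t | th t == zeta 0 i) F i t <= D.
    rewrite sumr_ge0//= -[leRHS](H2 i); apply: ler_sum => t _.
    by rewrite /F ler_piMr// w1_le1.
  have hk i : 0 <= \sum_(t | th t != zeta 0 i) F i t <= D * e by rewrite sumr_ge0//= H3.
  have [h _] := prod_diff_seq (enum 'I_n) D0' hg hk e0.
  by move: h; rewrite !big_enum size_enum_ord.
set X := \sum_(u | P u) _ in cgood *; set Y := \sum_(u | ~~ P u) _ in cbad *.
have : cmod X <= cmod (X + Y) + cmod Y.
  by rewrite -[X in cmod X <= _](addrK Y) (le_trans (cmodD _ _))// cmodN.
by rewrite cgood mulrBr; lra.
Qed.

End tensor.
End exponential_sums.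

(** * Norms of modulated Gaussians times trigonometric sums *)

Section norm_estimates.
Context {R : realType} {n : nat}.
Notation mu := (@lebesgue_measure R).
Notation V := 'rV[R]_n.

Lemma integral_w1_sub (c : R) : (\int[mu]_t (w1 (t - c))%:E = Iw%:E)%E.
Proof.
have cw : continuous (fun t : R => w1 (t - c)).
  exact: (cts_comp (@cts_addcst _ _ (- c)) w1_continuous).
have iw : mu.-integrable setT (EFin \o (fun t => w1 (t - c))).
  apply: (@continuous_w1_integrable _ _ (2 * (1 + (- c) ^+ 2))) => // t.
  by rewrite ger0_norm ?(ltW (w1_gt0 _))// w1_peetre.
rewrite -[LHS]fineK; last exact: integrable_fin_num iw.
congr (_%:E); rewrite -[Iw]/(\int[mu]_t w1 t)%R -(integral_shift (- c) w1_continuous).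
by [].
Qed.

Lemma measurable_w1_sub (c : R) : measurable_fun setT (fun t : R => w1 (t - c)).
Proof.
apply: continuous_measurable_fun; exact: (cts_comp (@cts_addcst _ _ (- c)) w1_continuous).
Qed.

Lemma integral_sum_w1 (T : finType) (k : R) (c : T -> R) : 0 <= k ->
  (\int[mu]_t (k * \sum_u w1 (t - c u))%:E = (k * (#|T|%:R * Iw))%:E)%E.
Proof.
move=> k0.
under eq_integral do rewrite EFinM -sumEFin.
rewrite ge0_integralZl//; first last.
- by move=> t _; apply: sume_ge0 => u _; rewrite lee_fin ltW// w1_gt0.
- by apply: emeasurable_sum => u; apply/measurable_EFinP; exact: measurable_w1_sub.
rewrite ge0_integral_sum//; first last.
- by move=> u t _; rewrite lee_fin ltW// w1_gt0.
- by move=> u; apply/measurable_EFinP; exact: measurable_w1_sub.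
rewrite (eq_bigr (fun=> Iw%:E)); last by move=> u _; rewrite integral_w1_sub.
by rewrite sumEFin sumr_const -[Iw *+ _]mulr_natl -EFinM.
Qed.

Definition box (r c : R) : set R := `[c - r, c + r].

Lemma measurable_box r c : measurable (box r c).
Proof. exact: measurable_itv. Qed.

Lemma measure_box r c : 0 < r -> mu (box r c) = (2 * r)%:E.
Proof.
move=> r0; rewrite lebesgue_measure_itv /= lte_fin ltrD2l (_ : - r < r); last by lra.
by rewrite -EFinD; congr (_%:E); ring.
Qed.

Lemma integral_sum_box (Z : finType) (r : R) (c : Z -> R) : 0 < r ->
  (\int[mu]_t (\sum_u \1_(box r (c u)) t)%:E = (#|Z|%:R * (2 * r))%:E)%E.
Proof.
move=> r0.
under eq_integral do rewrite -sumEFin.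
rewrite ge0_integral_sum//; first last.
- by move=> u; apply/measurable_EFinP; apply: measurable_indic; exact: measurable_box.
rewrite (eq_bigr (fun=> (2 * r)%:E)); last first.
  move=> u _; rewrite integral_indic ?setIT//; last exact: measurable_box.
  exact: measure_box.
by rewrite sumEFin sumr_const -[_ *+ #|_|]mulr_natl.
Qed.

Lemma powR_powR_inv (x q : R) : 0 <= x -> 0 < q -> powR (powR x q) q^-1 = x.
Proof. by move=> x0 q0; rewrite -powRrM divff ?gt_eqF// powRr1. Qed.

Lemma powR_exp (x r : R) k : 0 <= x -> powR (x ^+ k) r = (powR x r) ^+ k.
Proof.
by move=> x0; rewrite -(powR_mulrn k x0) -powRrM mulrC powRrM powR_mulrn ?powR_ge0.
Qed.

Lemma powR_prod (I : Type) (s : seq I) (F : I -> R) r : (forall i, 0 <= F i) ->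
  powR (\prod_(i <- s) F i) r = \prod_(i <- s) powR (F i) r.
Proof.
move=> F0; elim: s => [|i s IH]; first by rewrite !big_nil powR1.
by rewrite !big_cons powRM ?IH ?prodr_ge0.
Qed.

Section norms.
Variables (p q : R) (gam : V -> R[i]) (a C : R).
Hypothesis p1 : 1 < p.
Hypothesis q1 : 1 < q.
Hypothesis sgam : schwartz gam.
Hypothesis a0 : 0 < a.
Hypothesis C0 : 0 <= C.
Hypothesis hA : forall x e, cmod (Astft (gauss a) gam x e) <= C * (W x * W e).

Lemma stft_tensor (T : finType) (b th : T -> R) B (k : R) (om : V) (E : V -> R[i]) eE x xi :
  expsum b th B -> ccont E -> (forall t, cmod (E t) <= eE) ->
  stft gam (fun t : V => k%:C%C * ((\prod_i B (t 0 i))%:C%C * mode a om t) + E t) x xi =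
  k%:C%C * (\sum_(u : {ffun 'I_n -> T}) (\prod_i b (u i))%:C%C * Astft (gauss a) gam x (xi - om - tvec th u))
  + stft gam E x xi.
Proof.
move=> h cE bE.
have -> : (fun t : V => k%:C%C * ((\prod_i B (t 0 i))%:C%C * mode a om t) + E t) =
    (fun t : V => \sum_(u : {ffun 'I_n -> T}) (k * \prod_i b (u i))%:C%C * mode a (om + tvec th u) t + E t).
  apply/funext => t; rewrite (tensor_mode _ _ _ h) mulr_sumr; congr (_ + _).
  by apply: eq_bigr => u _; rewrite rmorphM mulrA.
rewrite (stft_expand sgam a0 _ _ _ _ _ cE bE) mulr_sumr; congr (_ + _).
by apply: eq_bigr => u _; rewrite rmorphM -mulrA opprD addrA.
Qed.

Let p0 : 0 < p. Proof. by rewrite (lt_trans ltr01). Qed.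
Let q0 : 0 < q. Proof. by rewrite (lt_trans ltr01). Qed.

Lemma W_le_powR (x : V) : W x <= powR (W x) p^-1.
Proof.
rewrite -[leLHS]powRr1 ?(ltW (W_gt0 _))//; apply: ger_powR; first by rewrite W_gt0 W_le1.
by rewrite invf_le1 // ltW.
Qed.

(** The inequality [S^q <= M^(q-1) S] linearizes the [q]-th power: under bounded overlap the
    frequency integral becomes one of a sum of translates of [w1], which is computed exactly. *)
Lemma sum_le_powR (M beta S : R) : 0 <= S <= M -> 0 <= beta ->
  beta * S <= powR (powR beta q * powR M (q - 1) * S) q^-1.
Proof.
move=> /andP[S0 SM] b0.
rewrite -[leLHS](@powR_powR_inv _ q) ?mulr_ge0//.
apply: ge0_ler_powR; rewrite ?nnegrE ?powR_ge0 ?mulr_ge0 ?powR_ge0 ?invr_ge0 ?(ltW q0)//.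
rewrite powRM// -mulrA ler_wpM2l ?powR_ge0//.
have [->|Sn] := eqVneq S 0; first by rewrite powR0 ?mulr0 ?gt_eqF.
have -> : powR S q = powR S (q - 1) * S.
  by rewrite -[X in _ = _ * X](powRr1 S0) -powRD ?Sn ?implybT// subrK.
rewrite ler_wpM2r//.
by apply: ge0_ler_powR; rewrite ?nnegrE ?subr_ge0 ?(ltW q1)// (le_trans S0).
Qed.

(** Packets with boundedly overlapping frequencies add up like an [l^q] sum. [K] depends on the
    overlap bound [M] but not on the frequencies or their number, so it is uniform over the
    scales. *)
Lemma mode_norm_upper (M : R) : 0 <= M -> exists2 K : R, 0 <= K &
  forall (T : finType) (b th : T -> R) B (beta : R) (om : V),
  expsum b th B -> (forall u, `|b u| = beta) -> 0 <= beta ->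
  (forall s, \sum_u w1 (s - th u) <= M) ->
  (Mnorm p q gam (fun x : V => (\prod_i B (x 0%R i))%:C%C * mode a om x)%R
    <= (K * (beta * powR #|T|%:R q^-1) ^+ n)%:E)%E.
Proof.
move=> M0.
exists (C * powR (Iw ^+ n) p^-1 * powR ((powR M (q - 1) * Iw) ^+ n) q^-1).
  by rewrite !mulr_ge0 ?powR_ge0.
move=> T b th B beta om hB hb b0 hM; rewrite Mnorm_mixed.
have -> : (fun x : V => (\prod_i B (x 0 i))%:C%C * mode a om x) =
   (fun t : V => 1%:C%C * ((\prod_i B (t 0 i))%:C%C * mode a om t) + (fun=> 0) t).
  by apply/funext => t; rewrite mul1r addr0.
have c0 : ccont (fun _ : V => 0 : R[i]) by exact: ccont_cst.
have h0 (t : V) : cmod ((fun=> 0) t) <= 0 :> R by rewrite cmod0.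
pose phi (i : 'I_n) (t : R) : R := w1 (t - 0).
pose psi (i : 'I_n) (t : R) := powR beta q * powR M (q - 1) * \sum_u w1 (t - (om 0 i + th u)).
have S0 s : 0 <= \sum_u w1 (s - th u) by apply: sumr_ge0 => u _; exact: ltW (w1_gt0 _).
apply: (@le_trans _ _ (mixed_norm p q (fun x xi => C * powR (\prod_i phi i (x 0 i)) p^-1 *
    powR (\prod_i psi i (xi 0 i)) q^-1))).
  apply: mixed_norm_le => // x xi; rewrite cmod_ge0/=.
  rewrite (stft_tensor _ _ _ _ hB c0 h0) mul1r (le_trans (cmodD _ _))//.
  have [Cg _ /(_ _ 0 x xi c0 h0)] := stft_small sgam.
  rewrite mulr0 => hz; rewrite -[leRHS]addr0 lerD//.
  apply: (le_trans (@expand_upper _ _ _ b th (fun e => Astft (gauss a) gam x e) (C * W x) _ _)).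
    by move=> e; rewrite -mulrA.
  apply: ler_pM.
  - by rewrite mulr_ge0// ltW// W_gt0.
  - by apply: prodr_ge0 => i _; apply: sumr_ge0 => u _; rewrite mulr_ge0// ltW// w1_gt0.
  - rewrite ler_wpM2l// (_ : \prod_i phi i (x 0 i) = W x) ?W_le_powR//.
    by apply: eq_bigr => i _; rewrite /phi subr0.
  apply: (@le_trans _ _ (\prod_i powR (psi i (xi 0 i)) q^-1)).
    apply: ler_prod => i _; rewrite sumr_ge0/=; last by move=> u _; rewrite mulr_ge0// ltW// w1_gt0.
    have -> : \sum_u `|b u| * w1 ((xi - om) 0 i - th u) = beta * \sum_u w1 (xi 0 i - om 0 i - th u).
      by rewrite mulr_sumr; apply: eq_bigr => u _; rewrite hb !mxE.
    rewrite (le_trans (sum_le_powR (M := M) _ b0)) ?S0 ?hM//.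
    rewrite le_eqVlt; apply/orP; left; apply/eqP; congr (powR (_ * _) _).
    by apply: eq_bigr => u _; rewrite opprD addrA.
  rewrite le_eqVlt; apply/orP; left; apply/eqP.
  rewrite powR_prod// => i; rewrite !mulr_ge0 ?powR_ge0//.
  by apply: sumr_ge0 => u _; exact: ltW (w1_gt0 _).
rewrite (mixed_norm_tensor (A := fun=> Iw) (B := fun=> powR beta q * powR M (q - 1) * (#|T|%:R * Iw)))//.
- rewrite lee_fin !prodr_const card_ord -mulrA -[leRHS]mulrA -[leRHS]mulrA !ler_wpM2l ?mulr_ge0 ?powR_ge0//.
  have -> : powR beta q * powR M (q - 1) * (#|T|%:R * Iw) =
      powR M (q - 1) * Iw * powR (beta * powR #|T|%:R q^-1) q.
    by rewrite powRM ?powR_ge0// -powRrM mulVf ?gt_eqF// powRr1//; ring.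
  have D0 : 0 <= beta * powR #|T|%:R q^-1 by rewrite mulr_ge0 ?powR_ge0.
  move: D0; move: (beta * _) => D D0.
  rewrite exprMn powRM ?exprn_ge0 ?mulr_ge0 ?powR_ge0 ?Iw_ge0//.
  by rewrite (powR_exp q^-1 n (powR_ge0 D q)) powR_powR_inv.
- by move=> i t; rewrite ltW// w1_gt0.
- by move=> i; exact: measurable_w1_sub.
- by move=> i; exact: integral_w1_sub.
- by move=> i t; rewrite !mulr_ge0 ?powR_ge0// sumr_ge0// => u _; rewrite ltW// w1_gt0.
- move=> i; apply: measurable_funM => //; apply: measurable_sum => u; exact: measurable_w1_sub.
- by move=> i; rewrite /psi integral_sum_w1// mulr_ge0 ?powR_ge0.
Qed.

Definition boxes (Z : finType) (r : R) (c : Z -> R) (t : R) : R := \sum_y \1_(box r (c y)) t.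

Lemma mem_box r c t : (t \in box r c) = (`|t - c| <= r).
Proof.
rewrite ler_distl; apply/idP/idP; first by rewrite inE /box /= in_itv/=.
by move=> h; rewrite inE /box /= in_itv/=.
Qed.

Lemma boxes_ge0 (Z : finType) r (c : Z -> R) t : 0 <= boxes r c t.
Proof. by apply: sumr_ge0 => y _; rewrite indicE ler0n. Qed.

(** Separated centers make the boxes disjoint, so the sum of indicators is again an indicator and
    taking roots of it is harmless. *)
Lemma boxes_cases (Z : finType) r (c : Z -> R) t :
  (forall y y', y != y' -> 2 * r < `|c y - c y'|) ->
  boxes r c t = 0 \/ exists2 y, `|t - c y| <= r & boxes r c t = 1.
Proof.
move=> hc; have [y hy|hn] := pickP (fun y => `|t - c y| <= r); last first.
  by left; rewrite /boxes big1// => y _; rewrite indicE mem_box hn.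
right; exists y => //; rewrite /boxes (bigD1 y)//= indicE mem_box hy big1 ?addr0// => y' yy'.
rewrite indicE mem_box; case: (leP `|t - c y'| r) => // h.
have := hc _ _ yy'; have := ler_distD t (c y') (c y); rewrite (distrC (c y') t); lra.
Qed.

Lemma measurable_boxes (Z : finType) r (c : Z -> R) : measurable_fun setT (boxes r c).
Proof. by apply: measurable_sum => y; apply: measurable_indic; exact: measurable_box. Qed.

(** On the boxes around [x0] and around each frequency vector, half of [c0] pays for the other
    frequencies and a quarter for the error [E], which leaves [k D^n c0 / 4]. Disjointness of the
    frequency boxes produces the factor [powR #|Z|%:R q^-1] in each coordinate. *)
Lemma mode_norm_lower (x0 : V) (r c0 Cg : R) : 0 < r -> 0 < c0 ->
  (forall x e : V, (forall j, `|x 0 j - x0 0 j| <= r) -> (forall j, `|e 0 j| <= r) ->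
    c0 <= cmod (Astft (gauss a) gam x e)) ->
  (forall (E : V -> R[i]) B x xi, ccont E -> (forall t, cmod (E t) <= B) ->
    cmod (stft gam E x xi) <= Cg * B) ->
  exists2 K : R, 0 < K &
  forall (T Z : finType) (b th : T -> R) B (z : Z -> R) (D e k eE : R) (om : V) (E : V -> R[i]),
  expsum b th B -> ccont E -> (forall t, cmod (E t) <= eE) -> 0 <= D -> 0 <= e -> 0 <= k ->
  C * ((1 + e) ^+ n - 1) <= c0 / 2 -> Cg * eE <= k * D ^+ n * (c0 / 4) ->
  (forall y, `|\sum_(u | th u == z y) b u| = D) ->
  (forall y, \sum_(u | th u == z y) `|b u| = D) ->
  (forall y s, `|s| <= r -> \sum_(u | th u != z y) `|b u| * w1 (z y + s - th u) <= D * e) ->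
  (forall y y', y != y' -> 2 * r < `|z y - z y'|) ->
  ((K * k * (D * powR #|Z|%:R q^-1) ^+ n)%:E <=
   Mnorm p q gam (fun t : V => k%:C%C * ((\prod_i B (t 0%R i))%:C%C * mode a om t) + E t)%R)%E.
Proof.
move=> r0 c00 hlow hsm.
have r20 : 0 < 2 * r by rewrite mulr_gt0.
exists (c0 / 4 * powR ((2 * r) ^+ n) p^-1 * powR ((2 * r) ^+ n) q^-1).
  by rewrite !mulr_gt0 ?powR_gt0 ?exprn_gt0.
move=> T Z b th B z D e k eE om E hB cE bE D0 e0 k0 he hE H1 H2 H3 hz; rewrite Mnorm_mixed.
pose phi (i : 'I_n) := boxes r (fun _ : unit => x0 0 i).
pose psi (i : 'I_n) := boxes r (fun y : Z => om 0 i + z y).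
have G0 : 0 <= k * D ^+ n * (c0 / 4) by rewrite !mulr_ge0 ?exprn_ge0// ltW.
apply: (@le_trans _ _ (mixed_norm p q (fun x xi => (k * D ^+ n * (c0 / 4)) * powR (\prod_i phi i (x 0 i)) p^-1 *
    powR (\prod_i psi i (xi 0 i)) q^-1))); last first.
  apply: mixed_norm_le => // x xi.
  have phi0 : 0 <= \prod_i phi i (x 0 i) by apply: prodr_ge0 => i _; exact: boxes_ge0.
  have psi0 : 0 <= \prod_i psi i (xi 0 i) by apply: prodr_ge0 => i _; exact: boxes_ge0.
  apply/andP; split; first exact: mulr_ge0 (mulr_ge0 G0 (powR_ge0 _ _)) (powR_ge0 _ _).
  have pV s : 1 < s -> s^-1 != 0 :> R by move=> s1; rewrite invr_eq0 gt_eqF// (lt_trans ltr01).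
  have [[i hi]|hx] := pselect (exists i, phi i (x 0 i) = 0).
    by rewrite (bigD1 i)//= hi mul0r powR0 ?pV// mulr0 mul0r cmod_ge0.
  have [[i hi]|hxi] := pselect (exists i, psi i (xi 0 i) = 0).
    by rewrite [X in _ * powR X q^-1](bigD1 i)//= hi mul0r powR0 ?pV// mulr0 cmod_ge0.
  have hx' i : `|x 0 i - x0 0 i| <= r /\ phi i (x 0 i) = 1.
    have [|h|[]] := @boxes_cases _ r (fun _ : unit => x0 0 i) (x 0 i); first by move=> [] [].
      by exfalso; apply: hx; exists i.
    by [].
  have hxi' i : exists y, `|xi 0 i - (om 0 i + z y)| <= r /\ psi i (xi 0 i) = 1.
    have [|h|[y ? ?]] := @boxes_cases _ r (fun y : Z => om 0 i + z y) (xi 0 i); last by exists y.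
      by move=> y y' yy'; rewrite opprD addrACA subrr add0r hz.
    by exfalso; apply: hxi; exists i.
  have [f hf] := choice hxi'.
  rewrite big1 ?powR1; last by move=> i _; have [] := hx' i.
  rewrite big1 ?powR1 ?mulr1; last by move=> i _; have [] := hf i.
  rewrite (stft_tensor _ _ _ _ hB cE bE).
  (* [f] selects the box containing each coordinate of [xi]; [zeta] is its center relative to [om],
     and [s] the offset from it. *)
  pose zeta : V := \row_i z (f i); pose s := xi - om - zeta.
  have -> : xi - om = zeta + s by rewrite /s addrCA subrr addr0.
  set X := \sum_u _; set Y := stft gam E x xi.
  have hY : cmod Y <= k * D ^+ n * (c0 / 4) by rewrite (le_trans (hsm _ _ _ _ cE bE)).
  have hX : D ^+ n * (c0 / 2) <= cmod X.
    have sr i : `|s 0 i| <= r by have [+ _] := hf i; rewrite !mxE opprD addrA.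
    have h1 : c0 <= cmod (Astft (gauss a) gam x s).
      by apply: hlow => // i; have [] := hx' i.
    apply: le_trans (@expand_lower _ _ _ b th (fun e => Astft (gauss a) gam x e) C D e zeta s _ _ e0 _ _ _) => //.
    - by apply: ler_wpM2l; [by rewrite exprn_ge0|lra].
    - move=> eta; rewrite (le_trans (hA _ _))// ler_wpM2l//.
      by rewrite ler_piMl ?W_le1// ltW// W_gt0.
    - by move=> i; rewrite mxE.
    - by move=> i; rewrite mxE.
    - by move=> i; rewrite [zeta _ _]mxE H3.
  have : cmod (k%:C%C * X) <= cmod (k%:C%C * X + Y) + cmod Y.
    by rewrite -[X in cmod X <= _](addrK Y) (le_trans (cmodD _ _))// cmodN.
  rewrite cmodM cmod_real ger0_norm//.
  have := ler_wpM2l k0 hX.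
  have -> : k * (D ^+ n * (c0 / 2)) = k * D ^+ n * (c0 / 4) + k * D ^+ n * (c0 / 4) by field.
  by move: hY; lra.
rewrite (mixed_norm_tensor (phi := phi) (psi := psi) (A := fun=> 2 * r) (B := fun=> #|Z|%:R * (2 * r)))//.
- rewrite lee_fin !prodr_const card_ord.
  move: (ltW r20); move: (2 * r) => r2 r2_ge0.
  have z0 : 0 <= #|Z|%:R :> R by exact: ler0n.
  have -> : powR ((#|Z|%:R * r2) ^+ n) q^-1 = powR #|Z|%:R q^-1 ^+ n * powR (r2 ^+ n) q^-1.
    rewrite exprMn powRM; [|exact: exprn_ge0|exact: exprn_ge0]. rewrite (powR_exp _ n z0). by [].
  by rewrite exprMn le_eqVlt; apply/orP; left; apply/eqP; ring.
- by move=> i t; exact: boxes_ge0.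
- by move=> i; exact: measurable_boxes.
- by move=> i; rewrite integral_sum_box// card_unit mul1r.
- by move=> i t; exact: boxes_ge0.
- by move=> i; exact: measurable_boxes.
- by move=> i; rewrite integral_sum_box.
Qed.

End norms.
End norm_estimates.

(** * Rudin-Shapiro coefficients: mass at a given frequency and away from it *)

Section coefficient_sums.
Context {R : realType}.

Lemma powR2_near_gt (th M : R) : 0 < th -> \forall j \near \oo, M < powR 2 (th * j%:R).
Proof.
move=> th0; have l2 : 0 < ln 2 :> R by rewrite ln_gt0// ltr1n.
near=> j; have hj : M / (th * ln 2) < j%:R by near: j; exact: nbhs_infty_gtr.
rewrite /powR pnatr_eq0/= (lt_le_trans _ (expR_ge1Dx _))//.
by rewrite ltr_pdivrMr ?mulr_gt0// in hj; rewrite mulrAC mulrC; lra.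
Unshelve. all: by end_near. Qed.

Lemma expr1D_sub1_le (e : R) k : 0 <= e <= 1 -> (1 + e) ^+ k - 1 <= e * 2 ^+ k.
Proof.
move=> /andP[e0 e1]; elim: k => [|k IH]; first by rewrite !expr0 subrr mulr1.
have h : (1 + e) ^+ k <= 2 ^+ k by apply: lerXn2r; rewrite ?nnegrE; lra.
by have := ler_wpM2l e0 h; rewrite !exprS; move: IH; lra.
Qed.

Section tensor_sums.
Variables (N : nat) (L r : R).
Hypothesis L0 : 0 < L.
Local Notation D := ((2 * r2 ^+ N)^-1 : R).
Local Notation th := (fun t : TA N => (zA t)%:~R * L).

Lemma coef_gt0 : 0 < D.
Proof. by rewrite invr_gt0 mulr_gt0// r2N_gt0. Qed.

(** The sum of the squared coefficients, which is the mean of the squared Rudin-Shapiro sum: each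
    squared cosine has mean [1/2]. *)
Lemma card_TA_D : #|TA N|%:R * (D * D) = 2^-1 :> R.
Proof.
have r0 : 0 < r2 ^+ N :> R by exact: r2N_gt0.
rewrite card_TA natrM natrX.
have -> : (2 : R) ^+ N = r2 ^+ N * r2 ^+ N by rewrite -expr2 -exprM mulnC exprM r2_sqr.
move: r0; move: (r2 ^+ N) => x x0; field; exact: lt0r_neq0.
Qed.

Lemma sum_bA : \sum_(u : TA N) `|bA u| = r2 ^+ N :> R.
Proof.
have r0 : 0 < r2 ^+ N :> R by exact: r2N_gt0.
rewrite (eq_bigr (fun=> D)); last by move=> u _; rewrite bA_norm.
rewrite sumr_const -[LHS]mulr_natl card_TA natrM natrX.
have -> : (2 : R) ^+ N = r2 ^+ N * r2 ^+ N by rewrite -expr2 -exprM mulnC exprM r2_sqr.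
move: r0; move: (r2 ^+ N) => x x0; field; exact: lt0r_neq0.
Qed.

Lemma bA_flip (u : TA N) : bA (flipA u) = bA u :> R.
Proof. by []. Qed.

Lemma freq_eq (u v : TA N) : (th u == th v) = (u == v).
Proof. by rewrite (inj_eq (mulIf (lt0r_neq0 L0))) eqr_int (inj_eq (@zA_inj N)). Qed.

Lemma freq_sep (u v : TA N) : 2 * r < L -> u != v -> 2 * r < `|th u - th v|.
Proof.
move=> rL uv; rewrite -mulrBl -intrB normrM (gtr0_norm L0) (lt_le_trans rL)//.
by rewrite ler_peMl ?(ltW L0)// int_ge1// subr_eq0 (inj_eq (@zA_inj N)).
Qed.

Lemma center_sum y : `|\sum_(u | th u == th y) bA u| = D.
Proof. by rewrite (eq_bigl _ _ (fun u => freq_eq u y)) big_pred1_eq bA_norm. Qed.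

Lemma center_sum_norm y : \sum_(u | th u == th y) `|bA u| = D.
Proof. by rewrite (eq_bigl _ _ (fun u => freq_eq u y)) big_pred1_eq bA_norm. Qed.

Lemma off_center_sum y s : 2 * r <= L -> `|s| <= r ->
  \sum_(u | th u != th y) `|bA u| * w1 (th y + s - th u) <= D * (16 / L ^+ 2).
Proof.
move=> rL sr.
rewrite (eq_bigl (fun u => zA u != zA y)); last by move=> u; rewrite freq_eq (inj_eq (@zA_inj N)).
rewrite (eq_bigr (fun u => D * w1 (s - (zA u - zA y)%:~R * L))); last first.
  move=> u _; rewrite bA_norm; congr (_ * w1 _); rewrite intrB; ring.
rewrite -mulr_sumr ler_wpM2l ?(ltW coef_gt0)//.
exact: (far_sum (zA y) (@zA_inj N) L0 rL sr).
Qed.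

Local Notation th2 := (fun u : TA N * TA N => th u.1 + th u.2).

Lemma freq_sum_eq0 u v : (th2 (u, v) == 0) = (v == flipA u).
Proof.
rewrite /= -mulrDl mulf_eq0 (gt_eqF L0) orbF -intrD intr_eq0.
by rewrite -(inj_eq (@zA_inj N)) zA_flip addrC addr_eq0.
Qed.

(* The frequencies [th u] and [- th u] carry equal coefficients, hence the square of the
   Rudin-Shapiro sum has mean [1/2]. *)
Lemma zero_sum (y : unit) : `|\sum_(u : TA N * TA N | th2 u == 0) (bA u.1 * bA u.2 : R)| = 2^-1.
Proof.
have -> : \sum_(u : TA N * TA N | th2 u == 0) (bA u.1 * bA u.2 : R) = \sum_(u : TA N) \sum_(v | v == flipA u) bA u * bA v.
  by rewrite pair_big_dep /=; apply: eq_bigl => -[u v]; rewrite freq_sum_eq0.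
rewrite (eq_bigr (fun=> D * D)); last first.
  by move=> u _; rewrite big_pred1_eq bA_flip -expr2 -[LHS]real_normK ?num_real// bA_norm.
by rewrite sumr_const -[X in `|X|]mulr_natl card_TA_D ger0_norm.
Qed.

Lemma zero_sum_norm (y : unit) : \sum_(u : TA N * TA N | th2 u == 0) `|bA u.1 * bA u.2 : R| = 2^-1.
Proof.
have -> : \sum_(u : TA N * TA N | th2 u == 0) `|bA u.1 * bA u.2 : R| = \sum_(u : TA N) \sum_(v | v == flipA u) `|bA u * bA v|.
  by rewrite pair_big_dep /=; apply: eq_bigl => -[u v]; rewrite freq_sum_eq0.
rewrite (eq_bigr (fun=> D * D)); last by move=> u _; rewrite big_pred1_eq normrM !bA_norm.
by rewrite sumr_const -[LHS]mulr_natl card_TA_D.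
Qed.

(** For fixed [u] the resonant partner is [flipA u]; the other [v] are summed by [far_sum] around
    [- zA u], and [card_TA_D] then sums over [u]. *)
Lemma off_zero_sum s : 2 * r <= L -> `|s| <= r ->
  \sum_(u : TA N * TA N | th2 u != 0) `|bA u.1 * bA u.2| * w1 (0 + s - th2 u) <= 2^-1 * (16 / L ^+ 2).
Proof.
move=> rL sr.
have -> : \sum_(u : TA N * TA N | th2 u != 0) `|bA u.1 * bA u.2| * w1 (0 + s - th2 u) =
    \sum_(u : TA N) \sum_(v : TA N | zA v != - zA u) D * D * w1 (s - (zA v - - zA u)%:~R * L).
  rewrite pair_big_dep /=; apply: eq_big => -[u v] /=.
    by rewrite freq_sum_eq0 -zA_flip (inj_eq (@zA_inj N)).
  by move=> _; rewrite normrM !bA_norm add0r; congr (_ * w1 _); rewrite intrB intrN; ring.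
apply: (@le_trans _ _ (\sum_(u : TA N) D * D * (16 / L ^+ 2))).
  apply: ler_sum => u _; rewrite -mulr_sumr ler_wpM2l ?mulr_ge0 ?(ltW coef_gt0)//.
  exact: (far_sum (- zA u) (@zA_inj N) L0 rL sr).
by rewrite -mulr_suml sumr_const -[X in X * _ <= _]mulr_natl card_TA_D.
Qed.

End tensor_sums.
End coefficient_sums.

(** * Unboundedness *)

Section operator_on_tensors.
Context {R : realType}.

Section pdo_tensor.
Variables (n : nat) (i0 : 'I_n) (m delta eps : R) (chi : nat -> R -> R).
Hypothesis eps_delta : eps < delta.
Hypothesis chi_derive : forall l (t : R), is_derive t 1 (chi l) (chi l.+1 t).
Hypothesis chi_one : forall t, 7 / 8 <= t <= 9 / 8 -> chi 0 t = 1.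
Hypothesis chi_supp : forall l t, (t <= 3 / 4) || (5 / 4 <= t) -> chi l t = 0.
Hypothesis chi_bound : forall l, exists C : R, forall t, `|chi l t| <= C.
Local Notation V := 'rV[R]_n.
Local Notation sy := (symb i0 m delta eps chi).
Local Notation rsj j := (rsA (Nexp delta eps j) (Lfreq eps j) 0).

Definition tmode a (B : R -> R) (om x : V) : R[i] := (\prod_i B (x 0 i))%:C%C * mode a om x.

Lemma tmode_ccont a (T : finType) (b th : T -> R) B om : 0 < a -> expsum b th B -> ccont (tmode a B om).
Proof.
move=> a0 hB.
have -> : tmode a B om = fun x => \sum_(u : {ffun 'I_n -> T}) (\prod_i b (u i))%:C%C * mode a (om + tvec th u) x.
  by apply/funext => x; exact: tensor_mode.
by apply: ccont_sum => u; apply: ccontM; [exact: ccont_cst|exact: mode_ccont].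
Qed.

Lemma tmode_schwartz a (T : finType) (b th : T -> R) B om : 0 < a -> expsum b th B -> schwartz (tmode a B om).
Proof.
move=> a0 hB.
have -> : tmode a B om = fun x => \sum_(u : {ffun 'I_n -> T}) (\prod_i b (u i))%:C%C * mode a (om + tvec th u) x.
  by apply/funext => x; exact: tensor_mode.
exact: mode_sum_schwartz.
Qed.

(** By linearity over the modes of the tensor product. The mode errors are summed against the [l^1]
    norm of the coefficients, harmless because [K] is arbitrary. *)
Lemma pdo_tensor a K : 0 < a -> exists2 CK : R, 0 <= CK &
  forall j (T : finType) (b th : T -> R) B, expsum b th B -> (forall u, `|th u| <= 2 ^+ j / 16) ->
  exists E : V -> R[i], [/\ ccont E,
    forall t, cmod (E t) <= CK * (\sum_u `|b u|) ^+ n * (2 ^- j) ^+ K &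
    pdo sy (tmode a B (const_mx (2 ^+ j))) =
    (fun t => (kap n a * amp m j)%:C%C * tmode a (fun s => B s * rsj j s) (const_mx (2 ^+ j)) t + E t)].
Proof.
move=> a0; have [CK CK0 hK] := pdo_mode_err i0 m eps_delta chi_derive chi_one chi_supp chi_bound K a0.
exists CK => // j T b th B hB hth.
pose om : V := const_mx (2 ^+ j).
pose E t : R[i] := pdo sy (tmode a B om) t -
  (kap n a * amp m j)%:C%C * tmode a (fun s => B s * rsj j s) om t.
have hp t : pdo sy (tmode a B om) t =
    \sum_(u : {ffun 'I_n -> T}) (\prod_i b (u i))%:C%C * pdo sy (mode a (om + tvec th u)) t.
  rewrite -(pdo_sum i0 m eps_delta chi_derive chi_supp chi_bound)//.
  by congr (pdo sy _ t); apply/funext => x; exact: tensor_mode.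
exists E; split; last by apply/funext => t; rewrite /E addrC subrK.
  have hBB := expsumM hB (@rsA_expsum R (Nexp delta eps j) (Lfreq eps j)).
  have -> : E = fun t => (\sum_(u : {ffun 'I_n -> T}) (\prod_i b (u i))%:C%C * pdo sy (mode a (om + tvec th u)) t)
     + (- (kap n a * amp m j)%:C%C) * tmode a (fun s => B s * rsj j s) om t.
    by apply/funext => t; rewrite /E hp mulNr.
  apply: ccontD.
    apply: ccont_sum => u; apply: ccontM; first exact: ccont_cst.
    exact: pdo_mode_ccont.
  by apply: ccontM; [exact: ccont_cst|exact: tmode_ccont hBB].
move=> t.
have -> : E t = \sum_(u : {ffun 'I_n -> T}) (\prod_i b (u i))%:C%C *
    (pdo sy (mode a (om + tvec th u)) t - (kap n a * (amp m j * ampl delta eps j t))%:C%C * mode a (om + tvec th u) t).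
  under eq_bigr do rewrite mulrBr; rewrite sumrB -hp /E; congr (_ - _).
  rewrite /tmode big_split /= -/(ampl delta eps j t).
  rewrite (eq_bigr (fun u : {ffun 'I_n -> T} => (kap n a * (amp m j * ampl delta eps j t))%:C%C *
    ((\prod_i b (u i))%:C%C * mode a (om + tvec th u) t))); last by move=> u _; rewrite mulrCA.
  by rewrite -mulr_sumr -(tensor_mode a om t hB) !rmorphM; ring.
rewrite (le_trans (cmod_sum _ _))//.
have -> : CK * (\sum_u `|b u|) ^+ n * (2 ^- j) ^+ K =
    \sum_(u : {ffun 'I_n -> T}) `|\prod_i b (u i)| * (CK * (2 ^- j) ^+ K).
  rewrite -mulr_suml (eq_bigr (fun u : {ffun 'I_n -> T} => \prod_i `|b (u i)|)); last by move=> u _; rewrite normr_prod.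
  by rewrite -(bigA_distr_bigA (fun _ => fun u => `|b u|)) prodr_const card_ord; ring.
apply: ler_sum => u _; rewrite cmodM cmod_real ler_wpM2l// hK// => i.
by rewrite !mxE addrC addrK.
Qed.

End pdo_tensor.
End operator_on_tensors.

(** * From an assumed operator bound to a bound on the growth in the scale *)

Section transfer.
Context {R : realType}.

Lemma near_one_pow (C c0 : R) n : 0 <= C -> 0 < c0 ->
  exists M : R, forall L, M <= L -> C * ((1 + 16 / L ^+ 2) ^+ n - 1) <= c0 / 2.
Proof.
(* The summand [16] ensures [16 / L <= 1]; the other one makes [C * 16 * 2^n / L] at most
   [c0 / 2]. *)
move=> C0 c00; exists (16 + 32 * C * 2 ^+ n / c0) => L hL.
have p0 : 0 <= 32 * C * 2 ^+ n / c0.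
  by apply: divr_ge0; [apply: mulr_ge0; [apply: mulr_ge0 => //|exact: exprn_ge0]|exact: ltW].
have L0 : 0 < L by lra.
have LL : L <= L ^+ 2 by rewrite expr2 ler_peMl; lra.
have e1 : 16 / L ^+ 2 <= 16 / L by rewrite ler_wpM2l// lef_pV2 ?posrE ?exprn_gt0.
have e2 : 16 / L <= 1 by rewrite ler_pdivrMr//; lra.
have e0 : 0 <= 16 / L ^+ 2 by rewrite divr_ge0 ?exprn_ge0 ?(ltW L0).
have h := @expr1D_sub1_le _ (16 / L ^+ 2) n.
have hh : (1 + 16 / L ^+ 2) ^+ n - 1 <= 16 / L * 2 ^+ n.
  have h2 : 0 <= 2 ^+ n :> R by exact: exprn_ge0.
  by rewrite (le_trans (h _)) ?e0 ?(le_trans e1 e2)// ler_wpM2r.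
rewrite (le_trans (ler_wpM2l C0 hh))//.
have -> : C * (16 / L * 2 ^+ n) = (32 * C * 2 ^+ n / c0) / L * (c0 / 2).
  by field; rewrite !gt_eqF.
by rewrite ler_piMl ?divr_ge0 ?(ltW c00)// ler_pdivrMr// mul1r; lra.
Qed.

(** With [X = 2^j]: of the powers of [1 / X], [n] cancel the [l^1] norm of the input, [n] match the
    lower bound of [D^n], [P] match that of the amplitude, and the last one beats the constants. *)
Lemma negligible_error (X A B : R) n P : 0 < X -> A <= B * X ->
  A * X ^+ n * X^-1 ^+ (n + n + P.+1) <= B * X^-1 ^+ P * X^-1 ^+ n.
Proof.
move=> X0 AB; have Y0 : 0 <= X^-1 by rewrite invr_ge0 ltW.
have e : X ^+ n * X^-1 ^+ n = 1 by rewrite -exprMn divff ?expr1n// gt_eqF.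
have -> : A * X ^+ n * X^-1 ^+ (n + n + P.+1) = A * X^-1 * (X^-1 ^+ P * X^-1 ^+ n) * (X ^+ n * X^-1 ^+ n).
  by rewrite !exprD exprS; ring.
rewrite e mulr1 -mulrA; have h : A * X^-1 <= B by rewrite ler_pdivrMr.
by rewrite -[leRHS]mulrA mulrA ler_wpM2r// mulr_ge0// exprn_ge0.
Qed.

(** The [l^q] size of the coefficients in one variable; the exponent [1/q - 1/2] of the theorem
    arises here. *)
Lemma size_TA (N : nat) (q : R) :
  (2 * r2 ^+ N)^-1 * powR #|TA N|%:R q^-1 = powR 2 q^-1 / 2 * powR (2 ^+ N) (q^-1 - 2^-1).
Proof.
have P0 : 0 < 2 ^+ N :> R by rewrite exprn_gt0.
have r0 : 0 < r2 ^+ N :> R by exact: r2N_gt0.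
have e : (2 : R) ^+ N = r2 ^+ N ^+ 2 by rewrite -exprM mulnC exprM r2_sqr.
have h : powR (2 ^+ N) 2^-1 = r2 ^+ N :> R.
  by rewrite e -(powR_mulrn 2 (ltW r0)) -powRrM divff ?pnatr_eq0// powRr1// ltW.
rewrite card_TA natrM natrX powRM// powRD ?(gt_eqF P0) ?implybT//.
by rewrite powRN h invfM; ring.
Qed.

Section growth.
Variables (n : nat) (i0 : 'I_n) (m delta eps : R) (chi : nat -> R -> R).
Hypothesis eps_delta : eps < delta.
Hypothesis eps0 : 0 < eps.
Hypothesis delta1 : delta < 1.
Hypothesis chi_derive : forall l (t : R), is_derive t 1 (chi l) (chi l.+1 t).
Hypothesis chi_one : forall t, 7 / 8 <= t <= 9 / 8 -> chi 0 t = 1.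
Hypothesis chi_supp : forall l t, (t <= 3 / 4) || (5 / 4 <= t) -> chi l t = 0.
Hypothesis chi_bound : forall l, exists C : R, forall t, `|chi l t| <= C.
Local Notation V := 'rV[R]_n.
Local Notation sy := (symb i0 m delta eps chi).
Local Notation Nj j := (Nexp delta eps j).
Local Notation Lj j := (Lfreq eps j).
Local Notation rsj j := (rsA (Nj j) (Lj j) 0).

Variables (p q : R) (gam : V -> R[i]) (Cop : R).
Hypothesis p1 : 1 < p.
Hypothesis q1 : 1 < q.
Hypothesis sgam : schwartz gam.
Hypothesis gam_neq0 : exists x, gam x != 0.
Hypothesis Cop0 : 0 <= Cop.
Hypothesis bounded : forall f, schwartz f -> (Mnorm p q gam (pdo sy f) <= Cop%:E * Mnorm p q gam f)%E.

Lemma amp_lower j : (2 ^+ j)^-1 ^+ pord m <= amp m j.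
Proof.
rewrite -exprVn -exprM exprVn -powR_mulrn// -powRN /amp; apply: ler_powR; first by rewrite ler1n.
have h := m_le_pord m; have := lerNnormlW h => hm.
rewrite natrM mulrC -mulNr ler_wpM2r//.
Qed.

(* [T] describes the input, [T'] the output and [Z] the output frequencies at which the
   short-time Fourier transform is bounded below. *)
Lemma norm_transfer : exists2 K : R, 0 <= K & \forall j \near \oo,
  [/\ 1 <= Lj j, 2 ^+ Nj j * Lj j <= 2 ^+ j / 16 &
  forall (T T' Z : finType) (b th : T -> R) (b' th' : T' -> R) B (z : Z -> R) (beta D : R),
  @expsum R T b th B -> @expsum R T' b' th' (fun s => B s * rsj j s) ->
  (forall u, `|b u| = beta) -> 0 <= beta -> (forall s, \sum_u w1 (s - th u) <= 17) ->
  (forall u, `|th u| <= 2 ^+ j / 16) -> \sum_u `|b u| <= 2 ^+ j -> (2 * 2 ^+ j)^-1 <= D ->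
  (forall y, `|\sum_(u | th' u == z y) b' u| = D) ->
  (forall y, \sum_(u | th' u == z y) `|b' u| = D) ->
  (forall r y s, 2 * r <= Lj j -> `|s| <= r ->
    \sum_(u | th' u != z y) `|b' u| * w1 (z y + s - th' u) <= D * (16 / Lj j ^+ 2)) ->
  (forall r y y', 2 * r < Lj j -> y != y' -> 2 * r < `|z y - z y'|) ->
  amp m j * (D * powR #|Z|%:R q^-1) ^+ n <= K * (beta * powR #|T|%:R q^-1) ^+ n].
Proof.
have [a a0 [x0 A0]] := Astft_nonvanishing sgam gam_neq0.
have sg : sbd (fun (_ : unit) (x : V) => W x * W x) (fun _ => gauss a).
  exact: (gauss_sbd 2 a0).
have [C C0 hA] := Astft_bound sgam sg.
have [r r0 [c0 c00 hlow]] := Astft_lower sgam sg A0.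
have {}hlow (x e : V) : (forall j, `|x 0 j - x0 0 j| <= r) -> (forall j, `|e 0 j| <= r) ->
    c0 <= cmod (Astft (gauss a) gam x e).
  by move=> hx he; apply: hlow => // j; rewrite mxE subr0.
have [Cg Cg0 hsm] := stft_small sgam.
have [Ku Ku0 upper] := mode_norm_upper p1 q1 sgam a0 C0 hA (ler0n R 17).
have [K1 K10 lower] := mode_norm_lower p1 q1 sgam a0 C0 hA r0 c00 hlow hsm.
pose Q := (n + n + (pord m).+1)%N.
have [CK CK0 hpdo] := pdo_tensor i0 m eps_delta chi_derive chi_one chi_supp chi_bound Q a0.
have k0 := kap_gt0 n a0.
have [M hM] := near_one_pow n C0 c00.
exists (Cop * Ku / (K1 * kap n a)).
  apply: divr_ge0; [exact: (mulr_ge0 Cop0 Ku0)|exact: (mulr_ge0 (ltW K10) (ltW k0))].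
pose A0' := Cg * CK.
pose B0 := kap n a * (2^-1) ^+ n * (c0 / 4).
have B00 : 0 < B0.
  by apply: mulr_gt0; [apply: mulr_gt0 => //; rewrite exprn_gt0// invr_gt0|rewrite divr_gt0].
near=> j.
pose X : R := 2 ^+ j.
have X0 : 0 < X by rewrite exprn_gt0.
have X1 : 1 <= X by rewrite exprn_ege1// ler1n.
have XE : X = powR 2 (1 * j%:R) by rewrite mul1r powR_mulrn.
have L1 : 1 <= Lj j by apply: ltW; near: j; exact: powR2_near_gt.
have LM : M <= Lj j by apply: ltW; near: j; exact: powR2_near_gt.
have Lr : 2 * r < Lj j by near: j; exact: powR2_near_gt.
have hX : A0' <= B0 * X.
  rewrite mulrC -ler_pdivrMr// XE; apply: ltW; near: j; exact: powR2_near_gt.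
(* Here [delta < 1] enters: [2^(delta j)] falls below [2^j / 16], so the packets stay on the plateau
   of the cutoff. *)
have hNL : 2 ^+ Nj j * Lj j <= 2 ^+ j / 16.
  rewrite (le_trans (NL_le eps_delta j))// ler_pdivlMr// -/X.
  have : 16 < powR 2 ((1 - delta) * j%:R) by near: j; apply: powR2_near_gt; rewrite subr_gt0.
  move=> h; have := ler_wpM2l (powR_ge0 2 (delta * j%:R)) (ltW h).
  have -> : powR 2 (delta * j%:R) * powR 2 ((1 - delta) * j%:R) = X.
    by rewrite -powRD ?pnatr_eq0 ?implybT// XE; congr powR; ring.
  by [].
split=> // T T' Z b th b' th' B z beta D hB hB' hb beta0 h17 hth hsum hD H1 H2 H3 hz.
have D0 : 0 < D by rewrite (lt_le_trans _ hD)// invr_gt0 mulr_gt0.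
have [E [cE bE pE]] := hpdo j T b th B hB hth.
have kk : 0 <= kap n a * amp m j by rewrite mulr_ge0 ?(ltW k0)// powR_ge0.
have L0 := Lfreq_gt0 eps j.
have e0 : 0 <= 16 / Lj j ^+ 2 by rewrite divr_ge0// exprn_ge0// ltW.
have hE : Cg * (CK * (\sum_u `|b u|) ^+ n * (2 ^- j) ^+ Q) <= kap n a * amp m j * D ^+ n * (c0 / 4).
  have s0 : 0 <= \sum_u `|b u| by apply: sumr_ge0.
  have t1 : Cg * (CK * (\sum_u `|b u|) ^+ n * (2 ^- j) ^+ Q) <= A0' * X ^+ n * X^-1 ^+ Q.
    rewrite !mulrA -/A0' ler_wpM2r ?exprn_ge0 ?invr_ge0 ?(ltW X0)//.
    rewrite ler_wpM2l ?mulr_ge0//; apply: lerXn2r => //; exact: ltW.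
  rewrite (le_trans t1)// (le_trans (negligible_error n (pord m) X0 hX))//.
  have -> : B0 * X^-1 ^+ pord m * X^-1 ^+ n = kap n a * X^-1 ^+ pord m * ((2 * X)^-1) ^+ n * (c0 / 4).
    by rewrite /B0 invfM exprMn; ring.
  apply: ler_wpM2r; first by rewrite divr_ge0// ltW.
  apply: ler_pM.
  - by rewrite mulr_ge0 ?(ltW k0)// exprn_ge0// invr_ge0 ltW.
  - by rewrite exprn_ge0// invr_ge0 mulr_ge0// ltW.
  - by rewrite ler_wpM2l ?(ltW k0)// amp_lower.
  - by apply: lerXn2r; rewrite ?nnegrE ?(ltW D0)// invr_ge0 mulr_ge0// ltW.
have low := lower T' Z b' th' (fun s => B s * rsj j s) z D (16 / Lj j ^+ 2) (kap n a * amp m j) _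
  (const_mx (2 ^+ j)) E hB' cE bE (ltW D0) e0 kk (hM _ LM) hE H1 H2
  (fun y s => H3 r y s (ltW Lr)) (fun y y' => hz r y y' Lr).
have up := upper T b th B beta (const_mx (2 ^+ j)) hB hb beta0 h17.
have bd := bounded (tmode_schwartz (const_mx (2 ^+ j)) a0 hB).
rewrite pE in bd.
have := le_trans low (le_trans bd (lee_wpmul2l _ up)); rewrite lee_fin => /(_ Cop0).
rewrite -EFinM lee_fin => h.
rewrite mulrAC ler_pdivlMr; last exact: (mulr_gt0 K10 k0).
by move: h; rewrite !mulrA => h; apply: le_trans h; rewrite le_eqVlt; apply/orP; left; apply/eqP; ring.
Unshelve. all: by end_near. Qed.

Lemma amp_growth : exists K : R, \forall j \near \oo,
  amp m j * powR (2 ^+ Nj j) (`|q^-1 - 2^-1| * n%:R) <= K.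
Proof.
have [K K0 h] := norm_transfer.
(* The factor [2^n] compensates the bound [u >= 1/2] when [q <= 2] and the mean [2^(-n)] of the
   squared multiplier when [q > 2]. *)
exists (K * 2 ^+ n); apply: filterS h => j [L1 hNL tr].
have am0 : 0 <= amp m j by exact: powR_ge0.
have L0 := Lfreq_gt0 eps j.
pose D : R := (2 * r2 ^+ Nj j)^-1.
pose P : R := 2 ^+ Nj j.
have P0 : 0 < P by rewrite exprn_gt0.
have r0 : 0 < r2 ^+ Nj j :> R by exact: r2N_gt0.
have D0 : 0 <= D by exact: ltW (coef_gt0 _).
have q0 : 0 < q by rewrite (lt_trans ltr01).
pose u : R := powR 2 q^-1 / 2.
have [u1 u2] : 2^-1 <= u /\ u <= 1.
  have h1 : 1 <= powR 2 q^-1 :> R by rewrite -[leLHS](powRr0 2); apply: ler_powR; rewrite ?ler1n ?invr_ge0 ?ltW.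
  have h2 : powR 2 q^-1 <= 2 :> R.
    by rewrite -[leRHS](@powRr1 _ 2)//; apply: ler_powR; rewrite ?ler1n// invf_le1// ltW.
  by rewrite /u; split; lra.
have szD : D * powR #|TA (Nj j)|%:R q^-1 = u * powR P (q^-1 - 2^-1) by exact: size_TA.
have r2j : r2 ^+ Nj j <= 2 ^+ j :> R.
  have h2 : r2 <= 2 :> R by have := @r2_sqr R; have := @r2_ge R; rewrite expr2; nra.
  have : r2 ^+ Nj j <= P by apply: lerXn2r; rewrite ?nnegrE// ltW// r2_gt0.
  have : P <= P * Lj j by rewrite ler_peMr// ltW.
  have : 0 <= 2 ^+ j :> R by exact: exprn_ge0.
  by move: hNL; rewrite -/P; lra.
have thb (v : TA (Nj j)) : `|(zA v)%:~R * Lj j| <= 2 ^+ j / 16.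
  by rewrite normrM (gtr0_norm L0) (le_trans _ hNL)// ler_wpM2r ?zA_le// ltW.
have X0 : 0 < 2 ^+ j :> R by rewrite exprn_gt0.
have X1 : 1 <= 2 ^+ j :> R by rewrite exprn_ege1// ler1n.
have hD : (2 * 2 ^+ j)^-1 <= D.
  by rewrite lef_pV2 ?posrE; [rewrite ler_wpM2l|exact: mulr_gt0|exact: mulr_gt0].
have h12 : (2 * 2 ^+ j)^-1 <= 2^-1 :> R.
  by rewrite lef_pV2 ?posrE; move: X0 X1; lra.
have [hq|hq] := leP 2^-1 q^-1.
  have e1 : expsum (fun v : TA (Nj j) => bA v) (fun v => (zA v)%:~R * Lj j)
      (fun s => (fun=> 1) s * rsj j s).
    by have := @rsA_expsum R (Nj j) (Lj j); congr expsum; apply/funext => s; rewrite mul1r.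
  have hA : amp m j * (D * powR #|TA (Nj j)|%:R q^-1) ^+ n <= K * (1 * powR #|{: unit}|%:R q^-1) ^+ n.
    apply: (tr _ _ _ _ _ _ _ _ (fun v => (zA v)%:~R * Lj j) 1 D (@expsum1 R) e1) => //.
    - by move=> ?; exact: normr1.
    - move=> s; rewrite sumr_const card_unit (le_trans (w1_le1 _))//; lra.
    - by move=> ?; rewrite normr0 divr_ge0// exprn_ge0.
    - by rewrite sumr_const card_unit normr1 exprn_ege1// ler1n.
    - exact: center_sum.
    - exact: center_sum_norm.
    - by move=> r y s rL sr; exact: off_center_sum rL sr.
    - by move=> r y y' rL yy'; exact: freq_sep.
  move: hA; rewrite card_unit powR1 mul1r expr1n mulr1 szD ger0_norm ?subr_ge0//.
  rewrite exprMn powRrM powR_mulrn ?powR_ge0// => hA.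
  have hu : 2^-1 ^+ n <= u ^+ n by apply: lerXn2r; rewrite ?nnegrE//; lra.
  rewrite -ler_pdivrMr ?exprn_gt0// -exprVn mulrC (le_trans _ hA)//.
  by rewrite mulrCA ler_wpM2l// ler_wpM2r// exprn_ge0// powR_ge0.
(* In the square only the resonance at frequency zero is kept, hence a single output frequency and
   [D = 1/2]. *)
have e2 := expsumM (@rsA_expsum R (Nj j) (Lj j)) (@rsA_expsum R (Nj j) (Lj j)).
have hB : amp m j * (2^-1 * powR #|{: unit}|%:R q^-1) ^+ n <= K * (D * powR #|TA (Nj j)|%:R q^-1) ^+ n.
  apply: (tr _ _ _ _ _ _ _ _ (fun=> 0) D 2^-1 (@rsA_expsum R (Nj j) (Lj j)) e2) => //.
  - by move=> v; exact: bA_norm.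
  - by move=> s; exact: (near_sum _ (@zA_inj (Nj j)) L1).
  - by rewrite sum_bA.
  - exact: zero_sum.
  - exact: zero_sum_norm.
  - by move=> r y s rL sr; exact: off_zero_sum rL sr.
move: hB; rewrite card_unit powR1 mulr1 szD ltr0_norm ?subr_lt0//.
rewrite exprMn exprVn powRrM powR_mulrn ?powR_ge0// => hB.
have hu : u ^+ n <= 1 by apply: exprn_ile1 => //; lra.
have v0 : 0 <= powR P (q^-1 - 2^-1) ^+ n by rewrite exprn_ge0// powR_ge0.
have hB2 : amp m j <= K * powR P (q^-1 - 2^-1) ^+ n * 2 ^+ n.
  rewrite -ler_pdivrMr ?exprn_gt0// (le_trans hB)// ler_wpM2l// ler_piMl//.
apply: (le_trans (ler_wpM2r _ hB2)); first by rewrite exprn_ge0// powR_ge0.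
have e3 : powR P (q^-1 - 2^-1) ^+ n * powR P (- (q^-1 - 2^-1)) ^+ n = 1.
  by rewrite -exprMn -powRD ?(gt_eqF P0) ?implybT// subrr powRr0 expr1n.
move: e3; set v := powR P _ ^+ n; set w := powR P _ ^+ n => e3.
have -> : K * v * 2 ^+ n * w = K * 2 ^+ n * (v * w) by ring.
by rewrite e3 mulr1.
Qed.

End growth.
End transfer.

Theorem theorem1p1 (R : realType) (n : nat) (p q m delta : R) :
  (1 <= n)%N -> 1 < p -> 1 < q -> 0 < delta -> delta < 1 ->
  - (`|q^-1 - 2^-1| * delta * n%:R) < m ->
  exists sigma : 'rV[R]_n -> 'rV[R]_n -> R[i],
    symbol_class m 1 delta sigma /\
    forall gamma : 'rV[R]_n -> R[i],
      schwartz gamma -> (exists x, gamma x != 0) ->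
      ~ (exists C : R, forall f : 'rV[R]_n -> R[i], schwartz f ->
           (Mnorm p q gamma (pdo sigma f) <= C%:E * Mnorm p q gamma f)%E).
Proof.
move=> n1 p1 q1 d0 d1 hm.
have [chi [chi_derive chi_one chi_supp chi_bound]] := @cutoff_exists R.
pose i0 : 'I_n := Ordinal n1.
pose c := `|q^-1 - 2^-1| * n%:R.
have c0 : 0 <= c by rewrite mulr_ge0.
have [eps e0 [ed theta0]] : exists2 eps, 0 < eps & eps < delta /\ 0 < m + (delta - eps) * c.
  have t0 : 0 < m + delta * c by move: hm; rewrite /c; lra.
  have k0 : 0 < c + 1 by lra.
  (* The loss [eps * c] may use at most half of the room [m + delta * c]; [c + 1] in place of [c]
     covers [q = 2], where [c = 0]. *)
  pose e1 := (m + delta * c) / (2 * (c + 1)).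
  have e10 : 0 < e1 by rewrite divr_gt0// mulr_gt0.
  have ce1 : e1 * c <= (m + delta * c) / 2.
    have -> : (m + delta * c) / 2 = e1 * (c + 1) by rewrite /e1; field; rewrite gt_eqF.
    by rewrite ler_wpM2l ?(ltW e10)//; lra.
  exists (Num.min (delta / 2) e1); first by rewrite lt_min e10 andbT divr_gt0.
  split; first by rewrite gt_min; apply/orP; left; lra.
  have : Num.min (delta / 2) e1 * c <= e1 * c by rewrite ler_wpM2r// ge_min lexx orbT.
  by rewrite mulrBl; lra.
exists (symb i0 m delta eps chi); split; first exact: symb_class.
move=> gam sgam gam0 [C hC].
(* The growth estimate asks for a nonnegative operator bound, so [C] is replaced by its absolute
   value. *)
have [K] := @amp_growth R n i0 m delta eps chi ed e0 d1 chi_derive chi_one chi_supp chi_bound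
  p q gam `|C| p1 q1 sgam gam0 (normr_ge0 C)
  (fun f sf => le_trans (hC f sf) (lee_wpmul2r (poweR_ge0 _ _) (ler_norm C : (C%:E <= `|C|%:E)%E))).
move=> hK.
pose theta := m + (delta - eps) * c.
have [j [h1 h2]] : exists j, amp m j * powR (2 ^+ Nexp delta eps j) c <= K /\
    K * powR 2 c < powR 2 (theta * j%:R).
  apply: (@filter_ex _ \oo); apply: filterS2 hK (powR2_near_gt (K * powR 2 c) theta0) => j; by split.
(* Truncation to an integer loses less than one in the exponent of [2 ^+ Nexp delta eps j], which
   costs the factor [powR 2 c]. *)
have : powR 2 (theta * j%:R) <= amp m j * powR (2 ^+ Nexp delta eps j) c * powR 2 c.
  rewrite -powR_mulrn// -powRrM /amp -!powRD ?pnatr_eq0 ?implybT//.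
  apply: ler_powR; first by rewrite ler1n.
  have := truncnS_gt ((delta - eps) * j%:R); rewrite -/(Nexp delta eps j) -natr1 => /ltW h.
  by have := ler_wpM2r c0 h; rewrite /theta; lra.
by move=> h; have := le_lt_trans (le_trans h (ler_wpM2r (powR_ge0 2 c) h1)) h2; rewrite ltxx.
Qed.
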